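(* Let $1<p<\infty$, $r_0>0$, $a\in\mathbb{R}$, and assume that $0\le\alpha<p-2$, or that $\alpha=0=p-2$. For $\varepsilon\in\,]0,1]$ let $v^\varepsilon=(v^\varepsilon_-,v^\varepsilon_+)$ denote the solution, for $t\ge0$, $r\ge0$, of $$\left\{\begin{aligned} &(\partial_t\pm\partial_r)v^\varepsilon_\pm=\varepsilon^\alpha r^{1-p}g(v^\varepsilon_-+v^\varepsilon_+),\qquad g(y):=-a\,2^{-p}|y|^{p-1}y,\\ &(v^\varepsilon_-+v^\varepsilon_+)\big|_{r=0}=0,\\ &v^\varepsilon_\mp\big|_{t=0}=P_\mp\Big(r,\frac{r-r_0}{\varepsilon}\Big)\pm\varepsilon P_1\Big(r,\frac{r-r_0}{\varepsilon}\Big). \end{aligned}\right.$$ (i) If the equation is dissipative, $a>0$, the pulses are absorbed before reaching the focus. If $T\ge r_0$, $$\limsup_{\varepsilon\to0}\Big(\|v^\varepsilon_-(T)\|_{L^\infty(0\le r\le T)}+\|v^\varepsilon_+(T)\|_{L^\infty(0\le r\le T)}\Big)=0.$$ More precisely, for $\lambda>0$, define $T(\lambda,\varepsilon)$ as follows: if $0\le\alpha<p-2$, then $T(\lambda,\varepsilon):=r_0-z_0\varepsilon-\lambda\varepsilon^{\alpha/(p-2)}$, and if $\alpha=0=p-2$, then $T(\lambda,\varepsilon):=r_0-z_0\varepsilon-\lambda$. For any $T=T(\varepsilon)\ge T(\lambda,\varepsilon)$, $$\lim_{\lambda\to0}\ \limsup_{\varepsilon\to0}\Big(\|v^\varepsilon_-(T)\|_{L^\infty(0\le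 r\le T)}+\|v^\varepsilon_+(T)\|_{L^\infty(0\le r\le T)}\Big)=0.$$ (ii) If the equation is accretive, $a<0$, there exists $T^*\le r_0$ such that the family $(v^\varepsilon_-,v^\varepsilon_+)$ is not bounded in $L^\infty([0,T^*]\times\mathbb{R}_+)^2$.
   Context: $\mathbb{R}_+=[0,\infty[$. The functions $U_0(r,z)$ and $U_1(r,z)$, $r\ge0$, $z\in\mathbb{R}$, are real-valued, infinitely differentiable and bounded, and $z_0>0$ is such that $\operatorname{supp}U_j(r,\cdot)\subset[-z_0,z_0]$ for all $r\ge0$ and $j=0,1$. Define $$P_\mp(r,z):=rU_1(r,z)\pm r\,\partial_zU_0(r,z),\qquad P_1(r,z):=U_0(r,z)+r\,\partial_rU_0(r,z).$$ In formulas with $\pm$ or $\mp$, upper signs go together and lower signs go together. The initial data are supported in $\{|r-r_0|\le z_0\varepsilon\}$. Origin of the system: if $u^\varepsilon(t,|x|)$ is the spherically symmetric solution on $\mathbb{R}^{1+3}$ of $(\partial_t^2-\Delta_x)u^\varepsilon+a\,\varepsilon^\alpha|\partial_tu^\varepsilon|^{p-1}\partial_tu^\varepsilon=0$ with $u^\varepsilon|_{t=0}=\varepsilon U_0(r,\frac{r-r_0}{\varepsilon})$, $\partial_tu^\varepsilon|_{t=0}=U_1(r,\frac{r-r_0}{\varepsilon})$, where $r=|x|$, then $v^\varepsilon_\mp=(\partial_t\pm\partial_r)(ru^\varepsilon)$. The focus is the point $(t,r)=(r_0,0)$; by finite speed of propagation the pulses do not reach $r=0$ before time $t=r_0-z_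0\varepsilon$.
   Formalization: In (ii) the formal statement additionally assumes that the leading incoming amplitude P_-(r_0,·) is not identically zero; as written, (ii) fails for U_0=U_1=0, where the solution is v=0 and hence bounded. *)

(* Defs.v *)
From HB Require Import structures.
From mathcomp Require Import all_boot all_order all_algebra.
From mathcomp Require Import all_classical all_reals all_analysis.
Set Implicit Arguments.
Unset Strict Implicit.
Unset Printing Implicit Defensive.
Import Order.TTheory GRing.Theory Num.Theory.
Import numFieldNormedType.Exports.
Local Open Scope classical_set_scope.
Local Open Scope ring_scope.

(* U is C^oo up to the boundary on {r >= 0} x R: all iterated partial
   derivatives D i j = d_r^i d_z^j U exist for r > 0 and extend continuously to
   r = 0.  The values U r z with r < 0 are irrelevant. *)
Definition smooth_half_plane (R : realType) (U : R -> R -> R) : Prop :=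
  exists D : nat -> nat -> R -> R -> R,
    D 0%N 0%N = U /\
    forall i j : nat,
      {within [set x : R * R | 0 <= x.1],
         continuous (fun x : R * R => D i j x.1 x.2)} /\
      (forall r z : R, 0 < r ->
         is_derive r (1 : R) (fun s : R => D i j s z) (D i.+1 j r z) /\
         is_derive z (1 : R) (fun y : R => D i j r y) (D i j.+1 r z)).

Definition bounded_half_plane (R : realType) (U : R -> R -> R) : Prop :=
  exists M : R, forall r z : R, 0 <= r -> `|U r z| <= M.

Definition supported_in (R : realType) (z0 : R) (U : R -> R -> R) : Prop :=
  forall r : R, 0 <= r ->
    closure [set z : R | U r z != 0] `<=` `[- z0, z0].

Definition pulse_profile (R : realType) (z0 : R) (U : R -> R -> R) : Prop :=
  [/\ smooth_half_plane U, bounded_half_plane U & supported_in z0 U].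

(* At r = 0 the derivatives below are multiplied by 0, so that the values they
   take there (where U is only constrained for r >= 0) do not matter. *)
Definition P_minus (R : realType) (U0 U1 : R -> R -> R) (r z : R) : R :=
  r * U1 r z + r * derive1 (U0 r) z.

Definition P_plus (R : realType) (U0 U1 : R -> R -> R) (r z : R) : R :=
  r * U1 r z - r * derive1 (U0 r) z.

Definition P_one (R : realType) (U0 : R -> R -> R) (r z : R) : R :=
  U0 r z + r * derive1 (fun s : R => U0 s z) r.

Definition g_nl (R : realType) (a p y : R) : R :=
  - a * 2 `^ (- p) * `|y| `^ (p - 1) * y.

(* [0, Tmax[ x [0, +oo[, in the variables (t, r). *)
Definition slab (R : realType) (Tmax : \bar R) : set (R * R) :=
  [set x | [/\ 0 <= x.1, (x.1%:E < Tmax)%E & 0 <= x.2]].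

(* (vm, vp) = (v_-, v_+) solves the initial boundary value problem on
   [0, Tmax[ x [0, +oo[.  The components are continuous up to the boundary and
   (d_t -+ d_r) v_-+ is the derivative in the characteristic direction
   (1, -1), resp. (1, 1), so C^1 regularity is not required.
   The last clause says that d_t u = (v_- + v_+) / (2 r) is locally bounded; it
   holds for every solution that is C^1 up to the boundary, and it makes the
   solution unique whatever the sign of a. *)
Definition is_solution (R : realType) (p alpha a r0 : R) (U0 U1 : R -> R -> R)
    (eps : R) (Tmax : \bar R) (vm vp : R -> R -> R) : Prop :=
  (0 < Tmax)%E /\
  {within slab Tmax, continuous (fun x : R * R => vm x.1 x.2)} /\
  {within slab Tmax, continuous (fun x : R * R => vp x.1 x.2)} /\
  (forall t r : R, 0 < t -> (t%:E < Tmax)%E -> 0 < r ->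
     is_derive ((t, r) : R * R) ((1, -1) : R * R)
       (fun x : R * R => vm x.1 x.2)
       (eps `^ alpha * r `^ (1 - p) * g_nl a p (vm t r + vp t r)) /\
     is_derive ((t, r) : R * R) ((1, 1) : R * R)
       (fun x : R * R => vp x.1 x.2)
       (eps `^ alpha * r `^ (1 - p) * g_nl a p (vm t r + vp t r))) /\
  (forall t : R, 0 <= t -> (t%:E < Tmax)%E -> vm t 0 + vp t 0 = 0) /\
  (forall r : R, 0 <= r ->
     vm 0 r = P_minus U0 U1 r ((r - r0) / eps)
              + eps * P_one U0 r ((r - r0) / eps) /\
     vp 0 r = P_plus U0 U1 r ((r - r0) / eps)
              - eps * P_one U0 r ((r - r0) / eps)) /\
  (forall T rho : R, (T%:E < Tmax)%E ->
     exists C : R, forall t r : R, 0 <= t <= T -> 0 <= r <= rho ->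
       `|vm t r + vp t r| <= C * r).

(* No solution exists on a longer time interval: Tmax is the lifespan. *)
Definition is_maximal_solution (R : realType) (p alpha a r0 : R)
    (U0 U1 : R -> R -> R) (eps : R) (Tmax : \bar R) (vm vp : R -> R -> R) :
    Prop :=
  is_solution p alpha a r0 U0 U1 eps Tmax vm vp /\
  forall (Tmax' : \bar R) (vm' vp' : R -> R -> R),
    is_solution p alpha a r0 U0 U1 eps Tmax' vm' vp' -> (Tmax' <= Tmax)%E.

Definition Linf_norm_at (R : realType) (v : R -> R -> R) (T : R) : \bar R :=
  'N[@lebesgue_measure R]_(+oo)[(EFin \o (v T \_ `[0, T]%classic)%R)]%E.

(* The L^oo norm of v on [0, T] x [0, +oo[, restricted to the times t < Tmax at
   which v is defined when Tmax <= T. *)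
Definition Linf_norm_slab (R : realType) (Tmax : \bar R) (T : R)
    (v : R -> R -> R) : \bar R :=
  'N[(@lebesgue_measure R \x @lebesgue_measure R)%E]_(+oo)[(EFin \o
     ((fun x : R * R => v x.1 x.2) \_
        (slab Tmax `&` [set x : R * R | x.1 <= T]))%R)]%E.

Definition T_absorb (R : realType) (p alpha r0 z0 lambda eps : R) : R :=
  if p == 2 then r0 - z0 * eps - lambda
  else r0 - z0 * eps - lambda * eps `^ (alpha / (p - 2)).

(* Main.v *)
Require Import Defs.
From HB Require Import structures.
From mathcomp Require Import all_boot all_order all_algebra.
From mathcomp Require Import all_classical all_reals all_analysis.
From mathcomp Require Import ess_sup_inf.
From mathcomp Require Import ring lra.
Import Order.TTheory GRing.Theory Num.Theory.
Import numFieldNormedType.Exports.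
Local Open Scope classical_set_scope.
Local Open Scope ring_scope.

(* Unfold the two waves into one function [w] on the line, [w(t, x) = v_-(t, x)]
   for [x >= 0] and [w(t, x) = - v_+(t, -x)] for [x <= 0]. It satisfies
   [(d_t - d_x) w = eps^alpha |x|^(1-p) g(w(t, x) - w(t, -x))], to which a maximum
   principle applies. With [beta = alpha / (p - 2)] the coefficient is at least
   [1 / r] for [r <= eps^beta], while the wave [v_+] created inside the incoming
   pulse is [O(eps^(1 - beta))] as long as [r >= lambda eps^beta]. So, up to the
   time [T(lambda, eps)], [v_-] essentially solves
   [v' = -+ k r^(1-p) eps^alpha |v|^p], and the divergence of [int dr / r] forces
   [v_-] to be small (if [a > 0]) or larger than any prescribed bound (if
   [a < 0]) there. In the first case the maximum principle propagates smallness
   to later times, behind the outgoing pulse. In the second case a solution that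
   stays bounded cannot stop before that time: it coincides with the global
   solution of a truncated equation, obtained by Picard iteration. *)

Set Implicit Arguments.
Unset Strict Implicit.
Unset Printing Implicit Defensive.

(** * One-variable lemmas *)

(** Two features resist standard arguments: the weight [|x|^(1-p)] blows up on the axis, and the
    equation couples the mirror points [x] and [-x]. The coupling is why all regions are symmetric
    under [x -> -x]: at a maximum of [|w|] the mirror value is dominated, which fixes the sign or
    the size of the source. The weight is tamed by [|w(t,x) - w(t,-x)| <= C |x|], which leaves a
    source that is at most linear in this difference.

    At [r = eps^beta] the coefficient equals exactly [1 / r], and [beta < 1] makes the pulse, of
    width of order [eps], thin compared with its distance to the axis at the critical time.

    The constants are chosen in the order [M], [lambda], [eps]. [M] bounds [|w|]: by the maximum
    principle if [a > 0], by the assumption to be refuted if [a < 0]. Along an incoming ray the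
    logarithmic integral contributes about [k ln(1/lambda)], with [k] fixed by the target size of
    the wave; [lambda] of order [e^(-M/k)] makes this exceed [M]. Last, [eps] is taken so small that
    the opposite wave cannot spoil the sign of the source. *)

Lemma is_derive_lt0_left (R : realType) (f : R -> R) (t d e : R) :
  is_derive t 1 f d -> d < 0 -> 0 < e ->
  exists s, [/\ 0 < s, s < e & f t < f (t - s)].
Proof.
move=> [df vd] d0 e0.
have dfd : (fun h => h^-1 *: (f (h *: (1 : R) + t) - f t)) @ 0^' --> d.
  by rewrite -vd; exact: df.
move/cvgrPdist_lt : dfd => /(_ (- d)); rewrite oppr_gt0 => /(_ d0).
rewrite /dnbhs /within /= => -[k /= k0 hk].
pose s := Num.min (k / 2) (e / 2).
have s0 : 0 < s by rewrite lt_min !divr_gt0.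
have sk : s < k by rewrite gt_min; apply/orP; left; lra.
have se : s < e by rewrite gt_min; apply/orP; right; lra.
exists s; split=> //.
have := hk (- s); rewrite /= sub0r opprK ger0_norm ?ltW// => /(_ sk).
have -> : - s != 0 by rewrite oppr_eq0 gt_eqF.
move=> /(_ isT); rewrite [_ *: (1 : R)]mulr1 [- s + t]addrC.
set D := _ *: _ => hD.
have D0 : D < 0 by move: hD; rewrite ltr_norml => /andP[]; lra.
have : (- s) * D > 0 by rewrite nmulr_rgt0// oppr_lt0.
rewrite /D /GRing.scale /= mulrA divff ?oppr_eq0 ?gt_eqF// mul1r; lra.
Qed.

Lemma le_increment (R : realType) (y dy : R -> R) (t0 t1 K : R) :
  t0 <= t1 -> continuous y ->
  (forall t, t0 < t < t1 -> is_derive t 1 y (dy t)) ->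
  (forall t, t0 < t < t1 -> dy t <= K) ->
  y t1 - y t0 <= K * (t1 - t0).
Proof.
rewrite le_eqVlt => /predU1P[<-|t01] cy hy hK; first by rewrite !subrr mulr0.
have hd x : x \in `]t0, t1[%R -> is_derive x 1 y (dy x).
  by rewrite in_itv; exact: hy.
have [|x] := MVT t01 hd; first exact: continuous_subspaceT.
rewrite in_itv => /= xt ->.
by rewrite ler_wpM2r ?hK// subr_ge0 ltW.
Qed.

Lemma abs_increment (R : realType) (y dy : R -> R) (t0 t1 K : R) :
  t0 <= t1 -> continuous y ->
  (forall t, t0 < t < t1 -> is_derive t 1 y (dy t)) ->
  (forall t, t0 < t < t1 -> `|dy t| <= K) ->
  `|y t1 - y t0| <= K * (t1 - t0).
Proof.
rewrite le_eqVlt => /predU1P[<-|t01] cy hy hK.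
  by rewrite !subrr mulr0 normr0.
have hd x : x \in `]t0, t1[%R -> is_derive x 1 y (dy x).
  by rewrite in_itv; exact: hy.
have [|x] := MVT t01 hd; first exact: continuous_subspaceT.
rewrite in_itv => /= xt ->.
by rewrite normrM [`|t1 - _|]ger0_norm ?subr_ge0 ?(ltW t01)// ler_wpM2r ?hK// subr_ge0 ltW.
Qed.

(** The sign of [dy] above the barrier is not strict, so a small linear term is subtracted: at a
    maximum of [y - k t] the derivative is then strictly negative, and larger values just to the
    left give a contradiction. *)
Lemma barrier_le (R : realType) (y dy : R -> R) (t0 t1 mu : R) :
  t0 <= t1 -> continuous y ->
  (forall t, t0 < t <= t1 -> is_derive t 1 y (dy t)) ->
  (forall t, t0 < t <= t1 -> mu < y t -> dy t <= 0) ->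
  y t0 <= mu -> y t1 <= mu.
Proof.
rewrite le_eqVlt => /predU1P[<-//|t01] cy hy hdy y0.
rewrite leNgt; apply/negP => y1.
(* Half of the mean slope from [mu] to [y t1]: small enough that the maximum of [y - k t] still lies
   above [mu]. *)
pose k := (y t1 - mu) / (t1 - t0) / 2.
have k0 : 0 < k by rewrite !divr_gt0 ?subr_gt0.
have kt : k * (t1 - t0) < y t1 - mu.
  by rewrite /k mulrAC mulfVK ?subr_eq0 ?(gt_eqF t01)//; lra.
pose psi t := y t - k * t.
have cpsi : continuous psi.
  move=> t; apply: cvgB; first exact: cy.
  by apply: cvgM; [exact: cvg_cst|exact: cvg_id].
have [] := @EVT_max R psi t0 t1 (ltW t01); first exact: continuous_subspaceT.
move=> c; rewrite in_itv /= => /andP[c0 c1] hc.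
have hc1 : psi t1 <= psi c by apply: hc; rewrite in_itv /= lexx ltW.
have yc : mu < y c.
  have : k * c <= k * t1 by rewrite ler_pM2l.
  have : k * t0 <= k * c by rewrite ler_pM2l.
  move: hc1 kt; rewrite /psi; lra.
have c0' : t0 < c.
  rewrite lt_neqAle c0 andbT; apply/eqP => ec.
  by move: yc; rewrite -ec ltNge y0.
have [] := @is_derive_lt0_left R psi c (dy c - k) (c - t0).
- have hyc : is_derive c 1 y (dy c) by apply: hy; rewrite c0'.
  have -> : psi = y - k \*: id by [].
  by apply: is_derive_eq; rewrite /GRing.scale /= mulr1.
- by have := hdy c; rewrite c0' c1 => /(_ isT yc); lra.
- by rewrite subr_gt0.
move=> s [s0 sc]; apply/negP; rewrite -leNgt; apply: hc.
by rewrite in_itv /=; apply/andP; split; lra.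
Qed.

(** * Maximum principle *)

(* If [e^(-Lt) |w| - theta t] exceeded [del] somewhere, it would attain its
   maximum over [K] off [D], where it decreases strictly along the
   characteristic, which stays in [K] backwards in time. *)
Lemma max_principle (R : realType) (w f : R -> R -> R) (K D : set (R * R))
    (L del : R) :
  continuous (fun z : R * R => w z.1 z.2) -> compact K -> 0 <= del ->
  (forall t x, K (t, x) -> 0 <= t /\ K (t, - x)) ->
  (forall t x, K (t, x) -> ~ D (t, x) ->
     is_derive t 1 (fun s => w s (x + t - s)) (f t x)) ->
  (forall t x, K (t, x) -> ~ D (t, x) ->
     exists2 e, 0 < e & forall s, 0 < s < e -> K (t - s, x + s)) ->
  (forall t x, K (t, x) -> ~ D (t, x) -> `|w t (- x)| <= `|w t x| ->
     f t x * w t x <= L * w t x ^+ 2) ->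
  (forall t x, D (t, x) -> `|w t x| <= del) -> 0 <= L ->
  forall t x, K (t, x) -> `|w t x| <= del * expR (L * t).
Proof.
move=> cw cK del0 Ksym hder hback hf hD L0 t x Ktx.
rewrite leNgt; apply/negP => hlt.
have t0 : 0 <= t by case: (Ksym _ _ Ktx).
have hlt' : del < expR (- L * t) * `|w t x|.
  by rewrite mulNr expRN mulrC ltr_pdivlMr// expR_gt0.
set A := expR _ * _ in hlt'.
(* Chosen so that the penalty [th * t] stays below the gap [A - del]; dividing by [t + 1] allows
   [t = 0]. *)
pose th := (A - del) / (t + 1) / 2.
have t1 : 0 < t + 1 by lra.
have th0 : 0 < th by rewrite !divr_gt0 ?subr_gt0.
have tht : th * t < A - del.
  have : th * (t + 1) < A - del.
    by rewrite /th mulrAC mulfVK ?(gt_eqF t1)//; lra.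
  lra.
pose psi (z : R * R) := expR (- L * z.1) * `|w z.1 z.2| - th * z.1.
have cpsi : continuous psi.
  move=> z; apply: cvgB; last first.
    by apply: cvgM; [exact: cvg_cst|exact: cvg_fst].
  apply: cvgM; last by apply: cvg_norm; exact: cw.
  apply: (@continuous_comp _ _ _ (fun z : R * R => - L * z.1) (@expR R)).
    by apply: cvgM; [exact: cvg_cst|exact: cvg_fst].
  exact: continuous_expR.
have [||[s y]] := @compact_EVT_max _ R psi K _ cK.
- by exists (t, x).
- exact: continuous_subspaceT.
rewrite inE => Ksy hmax.
have hsy : del < psi (s, y).
  have := hmax (t, x); rewrite inE => /(_ Ktx); rewrite {1}/psi /= -/A.
  by move: tht; lra.
have s0 : 0 <= s by case: (Ksym _ _ Ksy).
have ths0 : 0 <= th * s by rewrite mulr_ge0// ltW.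
have e0 : 0 < expR (- L * s) by exact: expR_gt0.
have nD : ~ D (s, y).
  move=> Dsy; have := hD _ _ Dsy.
  have e1 : expR (- L * s) <= 1 by rewrite -expR0 ler_expR mulNr oppr_le0 mulr_ge0.
  have : expR (- L * s) * `|w s y| <= `|w s y| by rewrite ler_piMl.
  by move: hsy; rewrite /psi /=; lra.
(* Since [K] is symmetric, the maximum over [K] also beats the mirror point, which is the case that
   [hf] covers. *)
have hsym : `|w s (- y)| <= `|w s y|.
  have := hmax (s, - y); rewrite inE => /(_ (proj2 (Ksym _ _ Ksy))).
  by rewrite /psi /= lerD2r ler_pM2l.
have w0 : 0 < `|w s y|.
  rewrite -(pmulr_rgt0 _ e0); move: hsy; rewrite /psi /=; lra.
have hfw := hf _ _ Ksy nD hsym.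
(* [|w|] need not be differentiable; [sg * w] is, it touches [|w|] from below at [(s, y)], and an
   increase of it backwards in time is an increase of [|w|]. *)
pose sg := Num.sg (w s y).
have sgw : sg * w s y = `|w s y| by rewrite -normrEsg.
have hfs : sg * f s y <= L * `|w s y|.
  rewrite -(ler_pM2r w0) -[leRHS]mulrA -expr2 real_normK ?num_real//.
  suff -> : sg * f s y * `|w s y| = f s y * w s y by [].
  by rewrite -sgw mulrACA -expr2 sqr_sg -normr_gt0 w0 mul1r.
have hd := hder _ _ Ksy nD.
pose phi u := expR (- L * u) * (sg * w u (y + s - u)) - th * u.
have dphi : is_derive s 1 phi
    (expR (- L * s) * (sg * f s y - L * `|w s y|) - th).
  have -> : phi = (fun u => expR (- L * u)) * (sg \*: (fun u => w u (y + s - u)))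
     - th \*: id by [].
  have hE : is_derive s 1 (fun u => expR (- L * u)) (expR (- L * s) * - L).
    have hl : is_derive s 1 (fun u : R => - L * u) (- L).
      have -> : (fun u : R => - L * u) = (- L) \*: id by [].
      by apply: is_derive_eq; rewrite /GRing.scale /= mulr1.
    have := is_derive1_comp (is_derive_expR (- L * s)) hl.
    by move/is_derive_eq; apply; rewrite mulrC.
  apply: is_derive_eq.
  by rewrite /GRing.scale /= -[_ *: _]/(sg * _) addrK sgw; ring.
have [e e1 he] := hback _ _ Ksy nD.
have [|u [u0 ue]] := is_derive_lt0_left dphi _ e1.
  have : expR (- L * s) * (sg * f s y - L * `|w s y|) <= 0.
    by rewrite pmulr_rle0// subr_le0.
  lra.
have Ku : K (s - u, y + u) by apply: he; rewrite u0.
have := hmax (s - u, y + u); rewrite inE => /(_ Ku).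
rewrite /psi /phi /= addrK.
have -> : y + s - (s - u) = y + u by lra.
rewrite sgw => h1 h2.
have h3 : expR (- L * (s - u)) * (sg * w (s - u) (y + u)) <=
   expR (- L * (s - u)) * `|w (s - u) (y + u)|.
  rewrite ler_pM2l ?expR_gt0// (le_trans (ler_norm _))// normrM.
  by rewrite /sg normr_sg -normr_gt0 w0 mul1r.
lra.
Qed.

(** * Unfolding *)

Lemma continuous_comp_within (S T U : topologicalType) (A : set T)
    (f : T -> U) (g : S -> T) :
  {within A, continuous f} -> continuous g -> (forall z, A (g z)) ->
  continuous (f \o g).
Proof.
move=> /subspace_continuousP cf cg gA z P /(cf _ (gA z)) nP.
have /= := cg z _ nP; rewrite nbhs_simpl /=.
by apply: (@filterS _ (nbhs z)) => y; apply; exact: gA.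
Qed.

Lemma continuous_pair (S T U : topologicalType) (f : S -> T) (g : S -> U) :
  continuous f -> continuous g -> continuous (fun z => (f z, g z)).
Proof. by move=> cf cg z; exact: (cvg_pair (cf z) (cg z)). Qed.

Lemma is_derive_along (R : realType) (f : R * R -> R) (t x k df : R) :
  is_derive ((t, x) : R * R) ((1, k) : R * R) f df <->
  is_derive t 1 (fun s => f (s, x + k * (s - t))) df.
Proof.
suff E : (fun h : R => h^-1 *: (((fun s => f (s, x + k * (s - t))) \o shift t)
     (h *: (1 : R)) - f (t, x + k * (t - t)))) =
  (fun h : R => h^-1 *: ((f \o shift ((t, x) : R * R)) (h *: ((1, k) : R * R))
     - f (t, x))).
  split=> -[h1 h2]; split; first by rewrite /derivable E.
  - by rewrite /derive E.
  - by rewrite /derivable -E.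
  - by rewrite /derive -E.
apply/funext => h /=; congr (_ *: (f _ - f _)); last by rewrite subrr mulr0 addr0.
change (h *: (1 : R)) with (h * 1).
have -> : h *: ((1, k) : R * R) + ((t, x) : R * R) = (h * 1 + t, h * k + x).
  by [].
by congr pair; ring.
Qed.

(** Meant for the axis, where the equation is not prescribed and has to be recovered from its
    validity on both sides. *)
Lemma is_derive0_quad (R : realType) (f : R -> R) (t C e : R) :
  0 < e -> (forall h, `|h| < e -> `|f (t + h) - f t| <= C * h ^+ 2) ->
  is_derive t 1 f 0.
Proof.
move=> e0 hf.
suff H : (fun h => h^-1 *: ((f \o shift t) (h *: (1 : R)) - f t)) @ 0^' --> (0 : R).
  by split; [apply/cvg_ex; exists 0|apply: cvg_lim].
have C0 : 0 <= C.
  have := hf (e / 2); rewrite gtr0_norm ?divr_gt0// => /(_ _).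
  have -> : e / 2 < e by lra.
  move=> /(_ isT) /(le_trans (normr_ge0 _)).
  by rewrite pmulr_lge0// exprn_gt0// divr_gt0.
apply/cvgrPdist_lt => d d0.
have d1 : 0 < d / (C + 1) by rewrite divr_gt0// ltr_wpDl.
near=> h.
have h0 : h != 0 by near: h; exact: nbhs_dnbhs_neq.
have hn0 : 0 < `|h| by rewrite normr_gt0.
have he : `|h| < e.
  near: h; apply: dnbhs0_lt => //.
have hd : `|h| < d / (C + 1).
  by near: h; apply: dnbhs0_lt.
rewrite sub0r normrN /= /shift /= /GRing.scale /= mulr1 normrM normfV.
rewrite ltr_pdivrMl// [h + t]addrC.
apply: le_lt_trans (hf _ he) _.
rewrite -real_normK ?num_real// expr2 mulrCA ltr_pM2l//.
rewrite ltr_pdivlMr ?ltr_wpDl// in hd.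
nra.
Unshelve. all: by end_near. Qed.

Lemma g_nl0 (R : realType) (a p : R) : g_nl a p 0 = 0.
Proof. by rewrite /g_nl mulr0. Qed.

Lemma g_nlN (R : realType) (a p y : R) : g_nl a p (- y) = - g_nl a p y.
Proof. by rewrite /g_nl normrN mulrN. Qed.

Lemma normr_g_nl (R : realType) (a p y : R) : 1 < p ->
  `|g_nl a p y| = `|a| * 2 `^ (- p) * `|y| `^ p.
Proof.
move=> p1; rewrite /g_nl !normrM normrN (ger0_norm (powR_ge0 _ (- p))).
rewrite (ger0_norm (powR_ge0 _ (p - 1))) -!mulrA; do 2 congr (_ * _).
by rewrite mulrC mulr_powRB1// (lt_trans _ p1).
Qed.

Lemma ler_normr_g_nl (R : realType) (a p y B : R) : 1 < p -> `|y| <= B ->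
  `|g_nl a p y| <= `|a| * 2 `^ (- p) * B `^ p.
Proof.
move=> p1 yB; rewrite normr_g_nl// ler_wpM2l// ?mulr_ge0 ?powR_ge0//.
apply: ge0_ler_powR; rewrite ?nnegrE//.
  by rewrite ltW// (lt_trans _ p1).
by rewrite (le_trans _ yB).
Qed.

(** With [|x|] in the weight the source is odd under [(x, y) -> (-x, -y)]; this is what lets one
    equation on the line carry both components. *)
Definition source (R : realType) (p alpha a eps x y : R) : R :=
  eps `^ alpha * `|x| `^ (1 - p) * g_nl a p y.

Lemma sourceN (R : realType) (p alpha a eps x y : R) :
  source p alpha a eps (- x) (- y) = - source p alpha a eps x y.
Proof. by rewrite /source normrN g_nlN mulrN. Qed.

(* The two components are unfolded into one function on the whole line,
   [w t x = v_-(t, x)] for [x >= 0] and [w t x = - v_+(t, -x)] for [x <= 0]. *)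
Definition unfolded_solution (R : realType) (p alpha a eps T : R)
    (w : R -> R -> R) : Prop :=
  [/\ continuous (fun z : R * R => w z.1 z.2),
      forall t x, 0 < t < T ->
        is_derive t 1 (fun s => w s (x + t - s))
          (source p alpha a eps x (w t x - w t (- x))) &
      forall rho, exists2 C, 0 <= C & forall t x, 0 <= t <= T -> `|x| <= rho ->
        `|w t x - w t (- x)| <= C * `|x|].

(** The linear bound cancels the weight: [|x|^(1-p) |y|^(p-1) <= C^(p-1)], and one factor [|y|] is
    left. At [x = 0] the power takes the value 0, as its exponent is not 0. *)
Lemma source_lin (R : realType) (p alpha a eps C x y : R) :
  1 < p -> 0 <= C -> `|y| <= C * `|x| ->
  `|source p alpha a eps x y| <=
     eps `^ alpha * (`|a| * 2 `^ (- p)) * C `^ (p - 1) * `|y|.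
Proof.
move=> p1 C0 yC.
have p10 : 0 < p - 1 by rewrite subr_gt0.
have [->|x0] := eqVneq x 0.
  rewrite /source normr0 powR0 ?mulr0 ?mul0r ?normr0 ?mulr_ge0 ?powR_ge0//.
  by rewrite -oppr_eq0 opprB gt_eqF.
have xp : 0 < `|x| by rewrite normr_gt0.
rewrite /source normrM normr_g_nl// -(mulr_powRB1 (normr_ge0 y))//; last first.
  exact: lt_trans p1.
rewrite normrM (ger0_norm (powR_ge0 eps _)) (ger0_norm (powR_ge0 `|x| _)).
have h : `|x| `^ (1 - p) * `|y| `^ (p - 1) <= C `^ (p - 1).
  apply: (@le_trans _ _ (`|x| `^ (1 - p) * (C * `|x|) `^ (p - 1))).
    rewrite ler_wpM2l ?powR_ge0//.
    by apply: ge0_ler_powR; rewrite ?nnegrE ?mulr_ge0//; exact: ltW.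
  rewrite powRM// mulrCA -powRD; last by rewrite normr_eq0 x0 implybT.
  by rewrite (_ : 1 - p + (p - 1) = 0) ?powRr0 ?mulr1//; lra.
have -> : eps `^ alpha * `|x| `^ (1 - p) *
    (`|a| * 2 `^ (- p) * (`|y| * `|y| `^ (p - 1))) =
  eps `^ alpha * (`|a| * 2 `^ (- p)) * `|y| * (`|x| `^ (1 - p) * `|y| `^ (p - 1)).
  by ring.
rewrite [leRHS]mulrAC ler_wpM2l// !mulr_ge0 ?powR_ge0//.
Qed.

Lemma continuous_maxr (R : realType) (T : topologicalType) (f g : T -> R) :
  continuous f -> continuous g -> continuous (fun x => Num.max (f x) (g x)).
Proof. by move=> cf cg x; exact: (@continuous_max R T f g x (cf x) (cg x)). Qed.

Lemma continuous_minr (R : realType) (T : topologicalType) (f g : T -> R) :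
  continuous f -> continuous g -> continuous (fun x => Num.min (f x) (g x)).
Proof. by move=> cf cg x; exact: (@continuous_min R T f g x (cf x) (cg x)). Qed.

(** Freezing the time outside [[0, T]] makes the unfolded function continuous on the whole plane, so
    that no one-sided continuity has to be carried along. *)
Definition clamp (R : realType) (T t : R) : R := Num.max 0 (Num.min t T).

Lemma clamp_id (R : realType) (T t : R) : 0 <= t <= T -> clamp T t = t.
Proof. by move=> /andP[t0 tT]; rewrite /clamp min_l// max_r. Qed.

Lemma clampP (R : realType) (T t : R) : 0 <= T -> 0 <= clamp T t <= T.
Proof.
by move=> T0; rewrite /clamp le_max lexx/= ge_max T0/= ge_min lexx orbT.
Qed.

Lemma continuous_clamp (R : realType) (T : R) : continuous (@clamp R T).
Proof.
apply: continuous_maxr => [t|]; first exact: cvg_cst.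
by apply: continuous_minr => t; [exact: cvg_id|exact: cvg_cst].
Qed.

Lemma exists_unfolded (R : realType) (p alpha a r0 : R) (U0 U1 : R -> R -> R)
    (eps T : R) (Tmax : \bar R) (vm vp : R -> R -> R) :
  1 < p -> 0 < T -> (T%:E < Tmax)%E ->
  is_solution p alpha a r0 U0 U1 eps Tmax vm vp ->
  exists2 w, unfolded_solution p alpha a eps T w &
    forall t r, 0 <= t <= T -> 0 <= r -> w t r = vm t r /\ w t (- r) = - vp t r.
Proof.
move=> p1 T0 TT [_ [cm [cp [hder [h0 [hini hlin]]]]]].
(* One formula instead of gluing at [x = 0]: because [v_- + v_+ = 0] on the axis, the last two terms
   cancel for [x >= 0], and the first and the last cancel for [x <= 0]. Continuity then follows by
   composition. *)
pose w t x := vm (clamp T t) (Num.max x 0) - vp (clamp T t) (Num.max (- x) 0)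
  - vm (clamp T t) 0.
have inslab (t r : R) : 0 <= t <= T -> 0 <= r -> slab Tmax (t, r).
  move=> /andP[t0 tT] r0'; split => //=.
  by rewrite (le_lt_trans _ TT)// lee_fin.
have wE t r : 0 <= t <= T -> 0 <= r -> w t r = vm t r /\ w t (- r) = - vp t r.
  move=> tT rge0; rewrite /w clamp_id// opprK.
  have hb : vm t 0 + vp t 0 = 0.
    by case/andP: tT => t0 tT; apply: h0 => //; rewrite (le_lt_trans _ TT)// lee_fin.
  rewrite (max_l rge0) (@max_r _ _ (- r)) ?oppr_le0//; split; lra.
have wE2 t x : 0 <= t <= T -> `|w t x - w t (- x)| =  `|vm t `|x| + vp t `|x| |.
  move=> tT; have [x0|x0] := leP 0 x.
    by have [-> ->] := wE _ _ tT x0; rewrite opprK [`|x|]ger0_norm.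
  have nx0 : 0 <= - x by rewrite oppr_ge0 ltW.
  have [-> ] := wE _ _ tT nx0; rewrite opprK => ->.
  by rewrite distrC opprK [`|x|]ltr0_norm.
have cw : continuous (fun z : R * R => w z.1 z.2).
  have cc : continuous (fun z : R * R => clamp T z.1).
    move=> z; apply: (@continuous_comp _ _ _ fst (clamp T)); first exact: cvg_fst.
    exact: continuous_clamp.
  have clT (z : R * R) : 0 <= clamp T z.1 <= T by apply: clampP; exact: ltW.
  have cx : continuous (fun z : R * R => Num.max z.2 0).
    by apply: continuous_maxr => z; [exact: cvg_snd|exact: cvg_cst].
  have cnx : continuous (fun z : R * R => Num.max (- z.2) 0).
    apply: continuous_maxr => z; last exact: cvg_cst.
    by apply: cvgN; exact: cvg_snd.
  move=> z; apply: cvgB; first apply: cvgB.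
  - apply: (@continuous_comp_within (R * R)%type _ _ _ _
      (fun z => (clamp T z.1, Num.max z.2 0)) cm).
      exact: continuous_pair cc cx.
    by move=> {}z; apply: inslab => //; rewrite le_max lexx orbT.
  - apply: (@continuous_comp_within (R * R)%type _ _ _ _
      (fun z => (clamp T z.1, Num.max (- z.2) 0)) cp).
      exact: continuous_pair cc cnx.
    by move=> {}z; apply: inslab => //; rewrite le_max lexx orbT.
  - apply: (@continuous_comp_within (R * R)%type _ _ _ _
      (fun z => (clamp T z.1, 0)) cm).
      by apply: (continuous_pair cc) => {}z; exact: cvg_cst.
    by move=> {}z; exact: inslab.
have lin : forall rho, exists2 C, 0 <= C &
    forall t x, 0 <= t <= T -> `|x| <= rho -> `|w t x - w t (- x)| <= C * `|x|.
  move=> rho; have [C hC] := hlin T rho TT.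
  exists (Num.max 0 C); first by rewrite le_max lexx.
  move=> t x tT xr; rewrite wE2//.
  have xr' : 0 <= `|x| <= rho by rewrite normr_ge0.
  apply: (le_trans (hC t `|x| tT xr')).
  by rewrite ler_wpM2r// le_max lexx orbT.
have cwl t x : continuous (fun s => w s (x + t - s)).
  move=> s; apply: (@continuous_comp _ _ _ (fun s : R => (s, x + t - s))
    (fun z : R * R => w z.1 z.2)); last exact: cw.
  apply: continuous_pair => {}s; first exact: cvg_id.
  by apply: cvgB; [exact: cvg_cst|exact: cvg_id].
have nearT (t : R) : 0 < t < T -> \forall s \near t, 0 <= s <= T.
  move=> tT; have := @near_in_itvoo R 0 T t; rewrite in_itv => /(_ tT).
  by apply: filterS => s; rewrite in_itv /= => /andP[s0 sT]; rewrite !ltW.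
have derpos t x : 0 < t < T -> 0 < x ->
   is_derive t 1 (fun s => w s (x + t - s))
          (source p alpha a eps x (w t x - w t (- x))).
  move=> tT x0; have /andP[t0 tT'] := tT.
  have tT2 : 0 <= t <= T by rewrite !ltW.
  have [|hd _] := hder t x t0 _ x0; first by rewrite (lt_trans _ TT)// lte_fin.
  have := (is_derive_along _ _ _ _ _).1 hd.
  have [-> ->] := wE _ _ tT2 (ltW x0).
  rewrite opprK /source (gtr0_norm x0).
  apply: near_eq_is_derive.
  have xn : \forall s \near t, s < x + t by apply: lt_nbhsl; lra.
  near=> s => /=.
  have [|| -> _] := wE s (x + t - s).
  - by near: s; exact: nearT.
  - by rewrite subr_ge0 ltW//; near: s.
  - by congr vm; ring.
have derneg t x : 0 < t < T -> x < 0 ->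
   is_derive t 1 (fun s => w s (x + t - s))
          (source p alpha a eps x (w t x - w t (- x))).
  move=> tT x0; have /andP[t0 tT'] := tT.
  have tT2 : 0 <= t <= T by rewrite !ltW.
  have nx0 : 0 < - x by rewrite oppr_gt0.
  have [|_ hd] := hder t (- x) t0 _ nx0; first by rewrite (lt_trans _ TT)// lte_fin.
  have := (is_derive_along _ _ _ _ _).1 hd => {}hd.
  have := wE t (- x) tT2 (ltW nx0); rewrite opprK => -[-> ->].
  rewrite -[x in source _ _ _ _ x]opprK.
  have -> : - vp t (- x) - vm t (- x) = - (vm t (- x) + vp t (- x)) by ring.
  rewrite sourceN /source (gtr0_norm nx0).
  have := is_deriveN hd.
  apply: near_eq_is_derive.
  have xn : \forall s \near t, x + t < s by apply: lt_nbhsr; lra.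
  near=> s => /=.
  have [|| _ ] := wE s (- (x + t - s)).
  - by near: s; exact: nearT.
  - by rewrite oppr_ge0 subr_le0 ltW//; near: s.
  - by rewrite opprK => ->; congr (- vp _ _); ring.
exists w => //; split=> // t x tT.
have [x0|x0|->] := ltgtP x 0; [exact: derneg|exact: derpos|].
(* On the axis the source is 0. At time [s] on the ray through [(t, 0)] the distance to the axis is
   [|s - t|], so the linear bound makes the source at most [K |s - t|] and the increment at most
   quadratic. *)
rewrite oppr0 subrr /source g_nl0 mulr0.
have [C C0 hC] := lin 1.
pose K := eps `^ alpha * (`|a| * 2 `^ (- p)) * C `^ (p - 1) * C.
have K0 : 0 <= K by rewrite !mulr_ge0 ?powR_ge0.
have /andP[t0 tT'] := tT.
pose e := Num.min 1 (Num.min t (T - t)).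
have e0 : 0 < e by rewrite !lt_min ltr01 t0 subr_gt0.
have [e1 et eT] : [/\ e <= 1, e <= t & e <= T - t].
  by rewrite /e; split; rewrite !ge_min lexx ?orbT.
have bnd s : `|s - t| < e -> s != t ->
   is_derive s 1 (fun s => w s (0 + t - s))
     (source p alpha a eps (t - s) (w s (t - s) - w s (- (t - s)))) /\
   `|source p alpha a eps (t - s) (w s (t - s) - w s (- (t - s)))| <= K * `|s - t|.
  move=> se st.
  have sT : 0 < s < T by move: se; rewrite ltr_norml => /andP[]; lra.
  have hE : (fun u : R => w u (0 + t - u)) = (fun u => w u ((t - s) + s - u)).
    by apply/funext => u; congr w; ring.
  split.
    rewrite hE; have [ts|ts|/eqP] := ltgtP s t; last by rewrite (negbTE st).
      by apply: derpos => //; rewrite subr_gt0.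
    by apply: derneg => //; rewrite subr_lt0.
  have hl : `|w s (t - s) - w s (- (t - s))| <= C * `|t - s|.
    apply: hC; first by case/andP: sT => *; rewrite !ltW.
    by rewrite distrC (le_trans (ltW se)).
  apply: (le_trans (source_lin _ _ _ p1 C0 hl)).
  by rewrite /K -[leRHS]mulrA [`|s - t|]distrC ler_wpM2l// !mulr_ge0 ?powR_ge0.
pose W s := w s (0 + t - s).
apply: (@is_derive0_quad _ W _ K e) => // h he.
have [->|h0'] := eqVneq h 0; first by rewrite addr0 subrr normr0 expr0n/= mulr0.
have [hp|hn] := ltP 0 h.
  have := @abs_increment R W
   (fun s => source p alpha a eps (t - s) (w s (t - s) - w s (- (t - s))))
   t (t + h) (K * h).
  rewrite (_ : t + h - t = h); last by ring.
  move=> hh.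
  rewrite expr2 mulrA; apply: hh; first by rewrite lerDl ltW.
  - exact: cwl.
  - move=> s /andP[s1 s2]; apply: (proj1 (bnd s _ _)); last by rewrite gt_eqF.
    by move: he; rewrite !gtr0_norm ?subr_gt0//; lra.
  - move=> s /andP[s1 s2]; apply: le_trans (proj2 (bnd s _ _)) _.
    + by move: he; rewrite !gtr0_norm ?subr_gt0//; lra.
    + by rewrite gt_eqF.
    + by rewrite ler_wpM2l// gtr0_norm ?subr_gt0//; lra.
have {}hn : h < 0 by rewrite lt_neqAle h0'.
have := @abs_increment R W
   (fun s => source p alpha a eps (t - s) (w s (t - s) - w s (- (t - s))))
   (t + h) t (K * - h).
rewrite (_ : t - (t + h) = - h); last by ring.
rewrite distrC => hh.
rewrite -sqrrN expr2 mulrA; apply: hh; first by lra.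
- exact: cwl.
- move=> s /andP[s1 s2]; apply: (proj1 (bnd s _ _)); last by rewrite lt_eqF.
  by move: he; rewrite !ltr0_norm ?subr_lt0//; lra.
- move=> s /andP[s1 s2]; apply: le_trans (proj2 (bnd s _ _)) _.
  + by move: he; rewrite !ltr0_norm ?subr_lt0//; lra.
  + by rewrite lt_eqF.
  + by rewrite ler_wpM2l// ltr0_norm ?subr_lt0//; lra.
Unshelve. all: by end_near. Qed.

(** * Source estimates and uniqueness *)

Lemma compact_closed_box (R : realType) (K : set (R * R)) (T rho : R) :
  closed K -> (forall t x, K (t, x) -> 0 <= t <= T /\ `|x| <= rho) -> compact K.
Proof.
move=> clK hK.
apply: (@subclosed_compact _ _ (`[0, T] `*` `[- rho, rho])) => //.
  by apply: compact_setX; exact: segment_compact.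
by move=> [t x] /hK [tT xr]; split; rewrite /= in_itv//= -ler_norml.
Qed.

Lemma closed_le_continuous (R : realType) (T : topologicalType) (f g : T -> R) :
  continuous f -> continuous g -> closed [set z | f z <= g z].
Proof.
move=> cf cg.
have -> : [set z | f z <= g z] = (fun z => g z - f z) @^-1` [set x | 0 <= x].
  by apply/seteqP; split=> z /=; rewrite subr_ge0.
apply: closed_comp; last exact: closed_ge.
by move=> z _; apply: cvgB; [exact: cg|exact: cf].
Qed.

Lemma path_continuous (R : realType) (w : R -> R -> R) (xi : R) :
  continuous (fun z : R * R => w z.1 z.2) -> continuous (fun s => w s (xi - s)).
Proof.
move=> cw s; apply: (@continuous_comp _ _ _ (fun s : R => (s, xi - s))
  (fun z : R * R => w z.1 z.2)); last exact: cw.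
apply: continuous_pair => {}s; first exact: cvg_id.
by apply: cvgB; [exact: cvg_cst|exact: cvg_id].
Qed.

Lemma path_derive (R : realType) (p alpha a eps T : R) (w : R -> R -> R)
    (xi s : R) :
  unfolded_solution p alpha a eps T w -> 0 < s < T ->
  is_derive s 1 (fun s => w s (xi - s))
    (source p alpha a eps (xi - s) (w s (xi - s) - w s (- (xi - s)))).
Proof.
move=> [_ h _] sT; have := h s (xi - s) sT.
by rewrite subrK.
Qed.

Lemma unfolded_solutionN (R : realType) (p alpha a eps T : R) (w : R -> R -> R) :
  unfolded_solution p alpha a eps T w ->
  unfolded_solution p alpha a eps T (fun t x => - w t x).
Proof.
move=> [cw dw lw]; split.
- by move=> z; apply: cvgN; exact: cw.
- move=> t x tT; rewrite -opprD /source g_nlN mulrN.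
  by apply: is_deriveN; exact: dw.
- move=> rho; have [C C0 hC] := lw rho; exists C => // t x tT xr.
  by rewrite -opprD normrN hC.
Qed.

(** When [y] dominates its mirror value [y'], the difference [y - y'] has the sign of [y], so that
    damping acts against [y]. *)
Lemma source_le0 (R : realType) (p alpha a eps x y y' : R) :
  0 < a -> `|y'| <= `|y| -> source p alpha a eps x (y - y') * y <= 0.
Proof.
move=> a0 yy; rewrite /source /g_nl.
have h : 0 <= (y - y') * y.
  have : `|y' * y| <= `|y| * `|y| by rewrite normrM ler_wpM2r.
  rewrite -[`|y| * _]expr2 real_normK ?num_real// => /ler_normlP[]; nra.
set A := eps `^ _; set B := `|x| `^ _; set E := 2 `^ _; set G := _ `^ (p - 1).
have -> : A * B * (- a * E * G * (y - y')) * y = - (A * B * a * E * G * ((y - y') * y)).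
  by ring.
by rewrite oppr_le0 mulr_ge0// !mulr_ge0 ?powR_ge0 ?(ltW a0).
Qed.

Lemma normr_source_le (R : realType) (p alpha a eps x y l B : R) :
  1 < p -> 0 < l -> l <= `|x| -> `|y| <= B ->
  `|source p alpha a eps x y| <=
    eps `^ alpha * l `^ (1 - p) * (`|a| * 2 `^ (- p) * B `^ p).
Proof.
move=> p1 l0 lx yB; rewrite /source normrM; apply: ler_pM => //; last first.
  exact: ler_normr_g_nl.
rewrite normrM (ger0_norm (powR_ge0 eps _)) (ger0_norm (powR_ge0 `|x| _)).
rewrite ler_wpM2l ?powR_ge0// -opprB !powRN lef_pV2 ?posrE ?powR_gt0//.
- apply: ge0_ler_powR; rewrite ?nnegrE//; first by rewrite subr_ge0 ltW.
  exact: ltW.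
- exact: lt_le_trans lx.
Qed.

(* Below [eps^beta], where [alpha = beta (p - 2)], the coefficient
   [eps^alpha r^(1-p)] dominates [1 / r], whose integral diverges at [r = 0]. *)
Lemma coef_ge (R : realType) (p alpha beta eps r : R) :
  2 <= p -> alpha = beta * (p - 2) -> 0 < eps -> 0 < r -> r <= eps `^ beta ->
  r^-1 <= eps `^ alpha * r `^ (1 - p).
Proof.
move=> p2 -> e0 rpos rle.
have -> : 1 - p = (2 - p) + (-1) by ring.
rewrite powRD ?(gt_eqF rpos) ?implybT// powR_inv1 ?(ltW rpos)// mulrA.
rewrite ler_peMl ?invr_ge0 ?(ltW rpos)//.
have r0 : 0 < r `^ (p - 2) by rewrite powR_gt0.
rewrite powRrM (_ : 2 - p = - (p - 2)); last by ring.
rewrite powRN ler_pdivlMr// mul1r.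
by apply: ge0_ler_powR; rewrite ?nnegrE ?powR_ge0 ?(ltW rpos)//; lra.
Qed.

(** * Domains of dependence and finite speed of propagation *)

Lemma continuous_absD (R : realType) :
  continuous (fun z : R * R => `|z.2| + z.1).
Proof.
move=> z; apply: cvgD; last exact: cvg_fst.
by apply: cvg_norm; exact: cvg_snd.
Qed.

(** Domains of dependence: incoming rays traced backwards stay inside down to [t = 0], and so do
    mirror points, whose values enter the source. *)
Definition backward_closed (R : realType) (T1 : R) (K : set (R * R)) : Prop :=
  [/\ compact K,
      forall t x, K (t, x) -> 0 <= t <= T1,
      forall t x, K (t, x) -> K (t, - x) &
      forall t x u, K (t, x) -> 0 < u < t -> K (t - u, x + u)].

Lemma cone_backward_closed (R : realType) (T1 c : R) :
  backward_closed T1 [set z : R * R | [/\ 0 <= z.1, z.1 <= T1 & `|z.2| + z.1 <= c]].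
Proof.
split.
- apply: (@compact_closed_box _ _ T1 c).
    have -> : [set z : R * R | [/\ 0 <= z.1, z.1 <= T1 & `|z.2| + z.1 <= c]] =
      [set z | 0 <= z.1] `&` ([set z | z.1 <= T1] `&` [set z | `|z.2| + z.1 <= c]).
      by apply/seteqP; split=> z [h1 h2]; [split|case: h2 => h2 h3; split].
    apply: closedI; last apply: closedI; apply: closed_le_continuous => z;
      do ?[exact: cvg_cst|exact: cvg_fst|exact: continuous_absD].
  by move=> s y [/= h1 h2 h3]; split; [rewrite h1 h2|lra].
- by move=> s y [/= -> ->].
- by move=> s y [/= h1 h2 h3]; split=> //=; rewrite normrN.
- move=> s y u [/= h1 h2 h3] /andP[u0 us]; split=> /=; [lra|lra|].
  have := ler_normD y u; rewrite (gtr0_norm u0); lra.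
Qed.

(** The exterior [|x| >= t + d] is unbounded; intersecting it with a cone makes it compact and keeps
    the closure under backward rays. *)
Lemma outer_backward_closed (R : realType) (T1 c d : R) :
  backward_closed T1 [set z : R * R |
    [/\ 0 <= z.1, z.1 <= T1, `|z.2| + z.1 <= c & z.1 + d <= `|z.2|]].
Proof.
have [cK hT hs hb] := cone_backward_closed T1 c.
have -> : [set z : R * R |
    [/\ 0 <= z.1, z.1 <= T1, `|z.2| + z.1 <= c & z.1 + d <= `|z.2|]] =
  [set z : R * R | [/\ 0 <= z.1, z.1 <= T1 & `|z.2| + z.1 <= c]] `&`
  [set z | z.1 + d <= `|z.2|].
  by apply/seteqP; split=> z; [case=> *; split|case=> -[]].
split.
- apply: compact_closedI => //; apply: closed_le_continuous => z.
    by apply: cvgD; [exact: cvg_fst|exact: cvg_cst].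
  by apply: cvg_norm; exact: cvg_snd.
- by move=> s y [/hT].
- by move=> s y [/hs h1 /= h2]; split=> //=; rewrite normrN.
- move=> s y u [h1 /= h2] hu; split; first exact: hb.
  have /andP[u0 us] := hu.
  by have := ler_normB (y + u) u; rewrite /= addrK (gtr0_norm u0); lra.
Qed.

(* [w - v] solves a linear inequality, so [max_principle] applies with [del = 0]. *)
Lemma uniqueness_on (R : realType) (w v f h : R -> R -> R) (K : set (R * R))
    (T1 A : R) :
  continuous (fun z : R * R => w z.1 z.2) ->
  continuous (fun z : R * R => v z.1 z.2) ->
  backward_closed T1 K -> 0 <= A ->
  (forall t x, K (t, x) -> 0 < t ->
     is_derive t 1 (fun s => w s (x + t - s)) (f t x)) ->
  (forall t x, K (t, x) -> 0 < t ->
     is_derive t 1 (fun s => v s (x + t - s)) (h t x)) ->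
  (forall t x, K (t, x) -> 0 < t -> `|f t x - h t x| <=
     A * `|w t x - v t x - (w t (- x) - v t (- x))|) ->
  (forall x, K (0, x) -> w 0 x = v 0 x) ->
  forall t x, K (t, x) -> w t x = v t x.
Proof.
move=> cw cv [cK KT Ks Kb] A0 dw dv fh w0 t x Ktx.
pose D : set (R * R) := [set z | K z /\ z.1 = 0].
have pos s y : K (s, y) -> ~ D (s, y) -> 0 < s.
  move=> Ksy nD; have /andP[h1 _] := KT _ _ Ksy.
  by rewrite lt_neqAle h1 andbT eq_sym; apply/eqP => s0; apply: nD; split.
apply/eqP; rewrite -subr_eq0; apply/eqP/normr0_eq0/eqP.
(* The rate is [2 * A] because at a point dominating its mirror image the difference of the two
   values of [w - v] is at most [2 |w - v|]. *)
rewrite eq_le normr_ge0 andbT -[leRHS](mul0r (expR (2 * A * t))).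
apply: (@max_principle R (fun t x => w t x - v t x)
    (fun t x => f t x - h t x) K D) => //.
- by move=> z; apply: cvgB; [exact: cw|exact: cv].
- by move=> s y Ksy; have /andP[h1 _] := KT _ _ Ksy; split=> //; exact: Ks.
- move=> s y Ksy /(pos _ _ Ksy) s0.
  exact: (is_deriveB (dw _ _ Ksy s0) (dv _ _ Ksy s0)).
- by move=> s y Ksy /(pos _ _ Ksy) s0; exists s => // u us; exact: Kb.
- move=> s y Ksy /(pos _ _ Ksy) s0 hy.
  apply: (le_trans (ler_norm _)); rewrite normrM.
  rewrite -[X in _ <= _ * X]real_normK ?num_real// expr2 mulrA ler_wpM2r//.
  apply: (le_trans (fh _ _ Ksy s0)).
  rewrite [2 * A]mulrC -[leRHS]mulrA ler_wpM2l//.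
  have := ler_normB (w s y - v s y) (w s (- y) - v s (- y)); lra.
- by move=> s y [Ksy /= s0]; rewrite s0 in Ksy *; rewrite w0// subrr normr0.
- by rewrite mulr_ge0.
Qed.

(** Comparison with the zero solution: on [|x| <= c] the bound of [source_lin] provides the constant
    [A] of [uniqueness_on], in spite of the singular weight. *)
Lemma zero_on (R : realType) (p alpha a eps T T1 c : R) (w : R -> R -> R)
    (K : set (R * R)) :
  1 < p -> T1 < T -> unfolded_solution p alpha a eps T w ->
  backward_closed T1 K -> (forall t x, K (t, x) -> `|x| <= c) ->
  (forall x, K (0, x) -> w 0 x = 0) ->
  forall t x, K (t, x) -> w t x = 0.
Proof.
move=> p1 T1T U bK Kc w0.
have [cw dw lw] := U; have [_ KT _ _] := bK.
have [C C0 hC] := lw c.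
apply: (@uniqueness_on _ w (fun _ _ => 0)
    (fun t x => source p alpha a eps x (w t x - w t (- x))) (fun _ _ => 0) K T1
    (eps `^ alpha * (`|a| * 2 `^ (- p)) * C `^ (p - 1))) => //.
- by move=> z; exact: cvg_cst.
- by rewrite !mulr_ge0 ?powR_ge0.
- move=> s y /KT /andP[_ sT] s0; apply: dw.
  by rewrite s0 (le_lt_trans sT).
- by move=> s y _ _; exact: is_derive_cst.
- move=> s y Ksy s0; rewrite !subr0; apply: source_lin => //; apply: hC.
    by have /andP[h1 h2] := KT _ _ Ksy; rewrite h1 (le_trans h2) ?ltW.
  exact: Kc Ksy.
Qed.

Lemma zero_inner (R : realType) (p alpha a eps T T1 c : R) (w : R -> R -> R) :
  1 < p -> T1 < T -> unfolded_solution p alpha a eps T w ->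
  (forall x, `|x| <= c -> w 0 x = 0) ->
  forall t x, 0 <= t <= T1 -> `|x| + t <= c -> w t x = 0.
Proof.
move=> p1 T1T U w0 t x /andP[t0 tT] xt.
apply: (@zero_on _ p alpha a eps T T1 c w _ p1 T1T U (cone_backward_closed T1 c)).
- by move=> s y [/= *]; lra.
- by move=> y [/= _ _]; rewrite addr0; exact: w0.
- by split.
Qed.

Lemma zero_outer (R : realType) (p alpha a eps T T1 d : R) (w : R -> R -> R) :
  1 < p -> T1 < T -> unfolded_solution p alpha a eps T w ->
  (forall x, d <= `|x| -> w 0 x = 0) ->
  forall t x, 0 <= t <= T1 -> t + d <= `|x| -> w t x = 0.
Proof.
move=> p1 T1T U w0 t x /andP[t0 tT] xt.
apply: (@zero_on _ p alpha a eps T T1 (`|x| + t) w _ p1 T1T U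
  (outer_backward_closed T1 (`|x| + t) d)).
- by move=> s y [/= *]; lra.
- by move=> y [/= _ _ _]; rewrite add0r; exact: w0.
- by split.
Qed.

(** [max_principle] with rate 0, since damping never increases a dominating value; the backward cone
    below [(t, x)] is the compact region, and its initial slice carries the bound [M]. *)
Lemma dissipative_bound (R : realType) (p alpha a eps T T1 M : R)
    (w : R -> R -> R) :
  0 < a -> T1 < T -> unfolded_solution p alpha a eps T w ->
  (forall x, `|w 0 x| <= M) ->
  forall t x, 0 <= t <= T1 -> `|w t x| <= M.
Proof.
move=> a0 T1T [cw dw _] w0 t x /andP[t0 tT].
have [] := cone_backward_closed T1 (`|x| + t).
set K := (X in compact X) => cK KT Ks Kb.
pose D : set (R * R) := [set z | K z /\ z.1 = 0].
have pos s y : K (s, y) -> ~ D (s, y) -> 0 < s.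
  move=> Ksy nD; have /andP[h1 _] := KT _ _ Ksy.
  by rewrite lt_neqAle h1 andbT eq_sym; apply/eqP => s0; apply: nD; split.
have M0 : 0 <= M by apply: le_trans (w0 0).
rewrite -[leRHS]mulr1 -expR0 -(mul0r t).
apply: (@max_principle R w
    (fun t x => source p alpha a eps x (w t x - w t (- x))) K D) => //.
- by move=> s y Ksy; have /andP[h1 _] := KT _ _ Ksy; split=> //; exact: Ks.
- move=> s y Ksy /(pos _ _ Ksy) s0; apply: dw.
  by have /andP[_ h2] := KT _ _ Ksy; rewrite s0 (le_lt_trans h2).
- by move=> s y Ksy /(pos _ _ Ksy) s0; exists s => // u us; exact: Kb.
- by move=> s y _ _ hy; rewrite mul0r source_le0.
- by move=> s y [_ /= ->].
Qed.

(** * The incoming pulse *)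

(* [v_+] is created only while it crosses the incoming pulse, which takes a time
   at most [dl]. *)
Lemma strip_bound (R : realType) (p alpha a eps T T1 c l dl M : R)
    (w : R -> R -> R) :
  1 < p -> T1 < T -> unfolded_solution p alpha a eps T w ->
  0 < l -> T1 = c - l ->
  (forall t x, 0 <= t <= T1 -> `|w t x| <= M) ->
  (forall t x, 0 <= t <= T1 -> `|x| + t <= c -> w t x = 0) ->
  forall t r, t <= T1 -> c <= r + t <= c + 2 * dl -> r - t <= c ->
  `|w t (- r)| <=
     eps `^ alpha * l `^ (1 - p) * (`|a| * 2 `^ (- p) * (2 * M) `^ p) * dl.
Proof.
move=> p1 T1T U l0 T1E hM hz t r tT1 /andP[h1 h2] h3.
(* The time at which the ray through [(t, -r)] meets the inner edge [|x| + s = c], where [w]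
   vanishes. From then on it stays at distance at least [l] from the axis, and
   [t - s0 = (r + t - c) / 2 <= dl]. *)
pose s0 := (c - (r - t)) / 2.
have s00 : 0 <= s0 by rewrite /s0; lra.
have s0t : s0 <= t by rewrite /s0; lra.
pose y s := w s ((t - r) - s).
have ys0 : y s0 = 0.
  apply: hz; first by rewrite s00 (le_trans s0t).
  rewrite ler0_norm /s0; lra.
have yt : y t = w t (- r) by rewrite /y; congr w; ring.
have cy : continuous y by apply: path_continuous; case: U.
set B := eps `^ alpha * _ * _.
have B0 : 0 <= B by rewrite !mulr_ge0 ?powR_ge0.
have rng s : s0 < s < t -> 0 < s < T.
  by move=> /andP[a1 a2]; apply/andP; split; lra.
have := @abs_increment R y _ s0 t B s0t cy
   (fun s hs => path_derive (t - r) U (rng s hs)).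
rewrite ys0 subr0 yt => H; apply: (le_trans (H _)).
  move=> s hs; apply: normr_source_le => //.
    rewrite ler0_norm; move: hs; rewrite /s0 => /andP[]; lra.
  have sT : 0 <= s <= T1.
    by move: hs => /andP[u1 u2]; apply/andP; split; lra.
  have := ler_normB (w s (t - r - s)) (w s (- (t - r - s))).
  have := hM s (t - r - s) sT; have := hM s (- (t - r - s)) sT; lra.
by rewrite ler_wpM2l// /s0; lra.
Qed.

(* An incoming wave leaving the outgoing pulse is small for the same reason. *)
Lemma crossing_bound (R : realType) (p alpha a eps T T1 c dl M : R)
    (w : R -> R -> R) :
  1 < p -> T1 < T -> unfolded_solution p alpha a eps T w ->
  0 < c ->
  (forall t x, 0 <= t <= T1 -> `|w t x| <= M) ->
  (forall t x, 0 <= t <= T1 -> t + (c + 2 * dl) <= `|x| -> w t x = 0) ->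
  forall t, dl <= t <= T1 -> 0 <= dl ->
  `|w t (t + c)| <=
     eps `^ alpha * c `^ (1 - p) * (`|a| * 2 `^ (- p) * (2 * M) `^ p) * dl.
Proof.
move=> p1 T1T U c0 hM hz t /andP[h1 h2] dl0.
(* At this time the ray is on the outer edge [|x| = s + c + 2 dl], where [w] still vanishes. *)
pose s0 := t - dl.
have s00 : 0 <= s0 by rewrite /s0; lra.
have s0t : s0 <= t by rewrite /s0; lra.
pose y s := w s (t + c + t - s).
have ys0 : y s0 = 0.
  apply: hz; first by rewrite s00 (le_trans s0t).
  rewrite ger0_norm /s0; lra.
have yt : y t = w t (t + c) by rewrite /y; congr w; ring.
have cy : continuous y by apply: path_continuous; case: U.
set B := eps `^ alpha * _ * _.
have B0 : 0 <= B by rewrite !mulr_ge0 ?powR_ge0.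
have rng s : s0 < s < t -> 0 < s < T.
  by move=> /andP[a1 a2]; apply/andP; split; lra.
have := @abs_increment R y _ s0 t B s0t cy
   (fun s hs => path_derive (t + c + t) U (rng s hs)).
rewrite ys0 subr0 yt => H; apply: (le_trans (H _)).
  move=> s hs; apply: normr_source_le => //.
    rewrite ger0_norm; move: hs; rewrite /s0 => /andP[]; lra.
  have sT : 0 <= s <= T1.
    by move: hs => /andP[u1 u2]; apply/andP; split; lra.
  have := ler_normB (w s (t + c + t - s)) (w s (- (t + c + t - s))).
  have := hM s (t + c + t - s) sT; have := hM s (- (t + c + t - s)) sT; lra.
by rewrite ler_wpM2l// /s0; lra.
Qed.

(** * Logarithmic growth and decay along incoming rays *)

Lemma is_derive_ln_path (R : realType) (k xi s : R) : s < xi ->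
  is_derive s 1 (fun s => k * ln (xi - s)) (- (k / (xi - s))).
Proof.
move=> sx.
have h1 : is_derive s 1 (fun s : R => xi - s) (- 1).
  have -> : (fun s : R => xi - s) = cst xi - id by [].
  by apply: is_derive_eq; rewrite sub0r.
have h2 : is_derive s 1 (@ln R \o (fun s => xi - s)) ((xi - s)^-1 * -1).
  by apply: is_derive1_comp; apply: is_derive1_ln; rewrite subr_gt0.
have -> : (fun s => k * ln (xi - s)) = k \*: (@ln R \o (fun s => xi - s)) by [].
apply: is_derive_eq.
by rewrite /GRing.scale /= mulrN1 mulrN.
Qed.

Lemma source_ge (R : realType) (p alpha beta a eps x y b : R) :
  2 <= p -> alpha = beta * (p - 2) -> 0 < eps -> 0 < x -> x <= eps `^ beta ->
  a < 0 -> 0 < b -> b <= y ->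
  (`|a| * 2 `^ (- p) * b `^ p) / x <= source p alpha a eps x y.
Proof.
move=> p2 aE e0 x0 xe a0 b0 yb.
have y0 : 0 < y by exact: lt_le_trans yb.
have p1 : 1 < p by lra.
have -> : source p alpha a eps x y =
    `|a| * 2 `^ (- p) * y `^ p * (eps `^ alpha * x `^ (1 - p)).
  rewrite /source /g_nl (gtr0_norm x0) (gtr0_norm y0) (ltr0_norm a0).
  by rewrite -(@mulr_powRB1 _ y p) ?(ltW y0)//; [ring|lra].
apply: ler_pM; rewrite ?mulr_ge0 ?powR_ge0 ?invr_ge0 ?(ltW x0)//.
- rewrite ler_wpM2l ?mulr_ge0 ?powR_ge0//.
  by apply: ge0_ler_powR; rewrite ?nnegrE ?(ltW b0) ?(ltW y0)//; lra.
- exact: coef_ge p2 aE e0 x0 xe.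
Qed.

(* Along the incoming characteristic [x = xi - t], where the opposite wave is at
   most [b], [|dw/dt|] is at least [k / x] as long as [|w| >= 2b]. *)
Lemma log_growth (R : realType) (p alpha beta a sg eps T T1 xi s0 b : R)
    (w : R -> R -> R) :
  2 <= p -> alpha = beta * (p - 2) -> 0 < eps -> `|sg| = 1 -> sg * a < 0 ->
  unfolded_solution p alpha a eps T w ->
  0 <= s0 -> s0 <= T1 -> T1 < T -> 0 < b -> T1 < xi -> xi - s0 <= eps `^ beta ->
  (forall s, s0 < s < T1 -> `|w s (- (xi - s))| <= b) ->
  (forall s, s0 < s < T1 -> 2 * b <= w s (xi - s)) ->
  sg * w s0 (xi - s0) + `|a| * 2 `^ (- p) * b `^ p * ln ((xi - s0) / (xi - T1))
    <= sg * w T1 (xi - T1).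
Proof.
move=> p2 aE e0 sg1 a0 U s00 s0T T1T b0 T1xi xie hb hw.
set k := `|a| * _ * _.
pose y s := k * ln (xi - s) + sg * w s (xi - s).
have xs : 0 < xi - s0 by lra.
have xT : 0 < xi - T1 by lra.
rewrite ln_div ?posrE// mulrBr.
(* The derivative [-k / (xi - s)] of the logarithm is exactly what the lower bound on the source
   compensates, so [y] is nondecreasing. *)
suff : y s0 <= y T1 by rewrite /y; lra.
move: s0T; rewrite le_eqVlt => /predU1P[->//|s0T].
have dy s : s0 < s < T1 -> is_derive s 1 y (- (k / (xi - s)) +
    sg * source p alpha a eps (xi - s) (w s (xi - s) - w s (- (xi - s)))).
  move=> /andP[s1 s2]; apply: is_deriveD.
    by apply: is_derive_ln_path; lra.
  have sT : 0 < s < T by apply/andP; split; lra.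
  have h := path_derive xi U sT.
  have -> : (fun s => sg * w s (xi - s)) = sg \*: (fun s => w s (xi - s)) by [].
  exact: is_deriveZ.
have hd x : x \in `]s0, T1[%R -> is_derive x 1 y (- (k / (xi - x)) +
    sg * source p alpha a eps (xi - x) (w x (xi - x) - w x (- (xi - x)))).
  by rewrite in_itv; exact: dy.
have [|x] := MVT s0T hd.
  apply: continuous_in_subspaceT => x; rewrite inE /= in_itv /= => /andP[x1 x2].
  apply: cvgD; apply: cvgM; do ?exact: cvg_cst; last first.
    by apply: (@path_continuous _ w); case: U.
  apply: (@continuous_comp _ _ _ (fun s : R => xi - s) (@ln R)).
    by apply: cvgB; [exact: cvg_cst|exact: cvg_id].
  by apply: continuous_ln; lra.
rewrite in_itv /= => xr; rewrite -subr_ge0 => ->; rewrite mulr_ge0//; last first.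
  by rewrite subr_ge0 ltW.
rewrite addrC subr_ge0 /k; have /andP[x1 x2] := xr.
have -> : `|a| = `|sg * a| by rewrite normrM sg1 mul1r.
set Y := w x _ - _.
(* The source is linear in [a], so the sign moves into [a]. With [sg = -1] the same estimate, read
   backwards in time, serves the dissipative case. *)
have -> : sg * source p alpha a eps (xi - x) Y = source p alpha (sg * a) eps (xi - x) Y.
  by rewrite /source /g_nl; ring.
apply: (source_ge p2 aE e0 _ _ a0 b0); rewrite /Y; [lra|lra|].
have := hw x xr; have := ler_norm (w x (- (xi - x))); have := hb x xr; lra.
Qed.

(** A bound on the source at distance at least [l] from the axis while [|w| <= M], the [2 * M]
    accounting for [w(x) - w(-x)]. Multiplied by a crossing time it bounds the wave created in the
    meantime. *)
Definition creation_bound (R : realType) (p alpha a eps l M : R) : R :=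
  eps `^ alpha * l `^ (1 - p) * (`|a| * 2 `^ (- p) * (2 * M) `^ p).

Lemma source_sign (R : realType) (p alpha a eps x y : R) :
  0 <= y -> 0 <= - a * source p alpha a eps x y.
Proof.
move=> y0; rewrite /source /g_nl.
have -> : - a * (eps `^ alpha * `|x| `^ (1 - p) *
    (- a * 2 `^ (- p) * `|y| `^ (p - 1) * y)) =
  eps `^ alpha * `|x| `^ (1 - p) * 2 `^ (- p) * `|y| `^ (p - 1) * y * (a ^+ 2).
  by ring.
by rewrite mulr_ge0 ?sqr_ge0// !mulr_ge0 ?powR_ge0.
Qed.

Lemma ler_ln_ratio (R : realType) (kap y z : R) :
  0 < kap -> 0 < y -> y <= z -> ln (kap / z) <= ln (kap / y).
Proof.
move=> k0 y0 yz; have z0 : 0 < z by exact: lt_le_trans yz.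
by rewrite ler_ln ?posrE ?divr_gt0// ler_pM2l// lef_pV2 ?posrE.
Qed.

(** If [w] exceeded [eta] at the end of the ray, it would do so on the whole stretch from distance
    [kap]: the level [eta] is a barrier, as the opposite wave is at most [eta / 2]. Logarithmic
    decay over this stretch would then require a starting value above [M]. The end point lies in
    [[l, 2 l]], whence the ratio [kap / (2 * l)]. *)
Lemma absorbed_le (R : realType) (p alpha beta a eps T T1 c l dl kap M eta : R)
    (w : R -> R -> R) :
  2 <= p -> alpha = beta * (p - 2) -> 0 < eps -> 0 < a ->
  unfolded_solution p alpha a eps T w ->
  T1 < T -> 0 < l -> T1 = c - l ->
  (forall t x, 0 <= t <= T1 -> `|w t x| <= M) ->
  (forall t x, 0 <= t <= T1 -> `|x| + t <= c -> w t x = 0) ->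
  kap <= eps `^ beta -> kap <= c -> 2 * l <= kap -> 2 * dl <= l ->
  0 < eta -> creation_bound p alpha a eps l M * dl <= eta / 2 ->
  M < `|a| * 2 `^ (- p) * (eta / 2) `^ p * ln (kap / (2 * l)) ->
  forall x, c <= x + T1 <= c + 2 * dl -> w T1 x <= eta.
Proof.
move=> p2 aE e0 a0 U T1T l0 T1E hM hz ke kc lk dll eta0 hcb hln x /andP[x1 x2].
have p1 : 1 < p by apply: lt_le_trans p2; rewrite ltr1n.
have kap0 : 0 < kap by lra.
have x0 : 0 < x by lra.
rewrite leNgt; apply/negP => hx.
(* [s0] is the time at which the ray is at distance [kap] from the axis. *)
pose xi := x + T1; pose s0 := xi - kap.
have s00 : 0 <= s0 by rewrite /s0 /xi; lra.
have s0T : s0 <= T1 by rewrite /s0 /xi; lra.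
have hop s : s0 <= s <= T1 -> `|w s (- (xi - s))| <= eta / 2.
  move=> /andP[h1 h2]; apply: le_trans hcb.
  apply: (strip_bound p1 T1T U l0 T1E hM hz) => //.
    by rewrite subrK /xi; apply/andP; split; lra.
  by move: h1; rewrite /s0 /xi; lra.
have cy : continuous (fun s => w s (xi - s)) by apply: path_continuous; case: U.
have hw s : s0 < s < T1 -> 2 * (eta / 2) <= w s (xi - s).
  move=> /andP[h1 h2]; rewrite leNgt; apply/negP => hs.
  suff : w T1 (xi - T1) <= eta by rewrite /xi addrK; lra.
  have rng t : s < t <= T1 -> 0 < t < T.
    by move=> /andP[h3 h4]; apply/andP; split; lra.
  apply: (@barrier_le R (fun s => w s (xi - s)) _ s T1 eta (ltW h2) cy
    (fun t ht => path_derive xi U (rng t ht))); last by lra.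
  move=> t /andP[h3 h4] ht.
  have hot : `|w t (- (xi - t))| <= eta / 2.
    by apply: hop; rewrite h4 andbT; lra.
  have := ler_norm (w t (- (xi - t))) => hn.
  have := @source_sign R p alpha a eps (xi - t) (w t (xi - t) - w t (- (xi - t))).
  rewrite subr_ge0 mulNr oppr_ge0 pmulr_rle0//; apply; lra.
have eta2 : 0 < eta / 2 by lra.
have h1 : `|-1 : R| = 1 by rewrite normrN normr1.
have h2 : -1 * a < 0 by lra.
have h3 : T1 < xi by rewrite /xi; lra.
have h4 : xi - s0 <= eps `^ beta by rewrite /s0; lra.
have h5 s : s0 < s < T1 -> `|w s (- (xi - s))| <= eta / 2.
  by move=> /andP[? ?]; apply: hop; rewrite !ltW.
have := log_growth p2 aE e0 h1 h2 U s00 s0T T1T eta2 h3 h4 h5 hw.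
have -> : xi - s0 = kap by rewrite /s0; ring.
have -> : xi - T1 = x by rewrite /xi; ring.
have hM0 := hM s0 kap; have {}hM0 : `|w s0 kap| <= M by apply: hM0; rewrite s00.
have := ler_norm (w s0 kap).
have hl : ln (kap / (2 * l)) <= ln (kap / x).
  by apply: ler_ln_ratio; [exact: kap0|exact: x0|lra].
have hk : 0 <= `|a| * 2 `^ (- p) * (eta / 2) `^ p by rewrite !mulr_ge0 ?powR_ge0.
have := ler_wpM2l hk hl.
lra.
Qed.

Lemma absorbed (R : realType) (p alpha beta a eps T T1 c l dl kap M eta : R)
    (w : R -> R -> R) :
  2 <= p -> alpha = beta * (p - 2) -> 0 < eps -> 0 < a ->
  unfolded_solution p alpha a eps T w ->
  T1 < T -> 0 < l -> T1 = c - l ->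
  (forall t x, 0 <= t <= T1 -> `|w t x| <= M) ->
  (forall t x, 0 <= t <= T1 -> `|x| + t <= c -> w t x = 0) ->
  kap <= eps `^ beta -> kap <= c -> 2 * l <= kap -> 2 * dl <= l ->
  0 < eta -> creation_bound p alpha a eps l M * dl <= eta / 2 ->
  M < `|a| * 2 `^ (- p) * (eta / 2) `^ p * ln (kap / (2 * l)) ->
  forall x, c <= x + T1 <= c + 2 * dl -> `|w T1 x| <= eta.
Proof.
move=> p2 aE e0 a0 U T1T l0 T1E hM hz ke kc lk dll eta0 hcb hln x hx.
rewrite ler_norml; apply/andP; split.
  rewrite lerNl.
  apply: (absorbed_le p2 aE e0 a0 (unfolded_solutionN U) T1T l0 T1E _ _ ke kc
    lk dll eta0 hcb hln hx).
    by move=> t y tT; rewrite normrN hM.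
  by move=> t y tT ty; rewrite hz ?oppr0.
exact: (absorbed_le p2 aE e0 a0 U T1T l0 T1E hM hz ke kc lk dll eta0 hcb hln hx).
Qed.

(** The budget is: start at [m], lose at most [m / 4] up to the time [ta] by the crude bound on the
    source, then never fall to [m / 2], because the opposite wave is at most [m / 4] and the
    accretive source pushes upwards. [log_growth] with [b = m / 4] does the rest. *)
Lemma amplified (R : realType) (p alpha beta a eps T T1 c l dl kap M m xi : R)
    (w : R -> R -> R) :
  2 <= p -> alpha = beta * (p - 2) -> 0 < eps -> a < 0 ->
  unfolded_solution p alpha a eps T w ->
  T1 < T -> 0 < l -> T1 = c - l ->
  (forall t x, 0 <= t <= T1 -> `|w t x| <= M) ->
  (forall t x, 0 <= t <= T1 -> `|x| + t <= c -> w t x = 0) ->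
  kap <= eps `^ beta -> kap <= c / 2 -> 2 * l <= kap -> 2 * dl <= l ->
  0 < m -> creation_bound p alpha a eps l M * dl <= m / 4 ->
  creation_bound p alpha a eps (c / 2) M * dl <= m / 4 ->
  c <= xi <= c + 2 * dl -> m <= w 0 xi ->
  m / 2 + `|a| * 2 `^ (- p) * (m / 4) `^ p * ln (kap / (2 * l)) <= M.
Proof.
move=> p2 aE e0 a0 U T1T l0 T1E hM hz ke kc lk dll m0 hcb hcb' /andP[xi1 xi2] hm.
have p1 : 1 < p by lra.
have c0 : 0 < c by lra.
have kap0 : 0 < kap by lra.
have xT0 : 0 < xi - T1 by lra.
(* Before [ta] the outgoing ray through the mirror point can be traced back into the initial pulse,
   where [v_+] need not vanish; [strip_bound] applies from [ta] on. *)
pose ta := (xi - c) / 2; pose s0 := xi - kap.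
have ta0 : 0 <= ta by rewrite /ta; lra.
have tas : ta <= s0 by rewrite /s0 /ta; lra.
have s0T : s0 <= T1 by rewrite /s0; lra.
have s00 : 0 <= s0 by rewrite /s0; lra.
have hop s : ta <= s <= T1 -> `|w s (- (xi - s))| <= m / 4.
  move=> /andP[h1 h2]; apply: le_trans hcb.
  apply: (strip_bound p1 T1T U l0 T1E hM hz) => //.
    by rewrite subrK xi1.
  by move: h1; rewrite /ta; lra.
pose y s := w s (xi - s).
have cy : continuous y by apply: path_continuous; case: U.
have yta : m / 2 < y ta.
  have rng s : 0 < s < ta -> 0 < s < T.
    by move=> /andP[a1 a2]; apply/andP; split; lra.
  have h := @abs_increment R y _ 0 ta (creation_bound p alpha a eps (c / 2) M)
     ta0 cy (fun s hs => path_derive xi U (rng s hs)).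
  suff : `|y ta - y 0| <= m / 4.
    by rewrite {2}/y subr0 ler_norml => /andP[]; lra.
  apply: le_trans hcb'; rewrite subr0 in h; apply: (le_trans (h _)).
    move=> s hs; apply: normr_source_le => //; first lra.
      rewrite ger0_norm; move: hs; rewrite /ta => /andP[]; lra.
    have sT : 0 <= s <= T1.
      by move: hs => /andP[u1 u2]; apply/andP; split; lra.
    have := ler_normB (w s (xi - s)) (w s (- (xi - s))).
    have := hM s (xi - s) sT; have := hM s (- (xi - s)) sT; lra.
  apply: ler_wpM2l; last by rewrite /ta; lra.
  by rewrite /creation_bound !mulr_ge0 ?powR_ge0.
have hw s : ta <= s <= T1 -> m / 2 < y s.
  move=> /andP[hs1 hs2]; rewrite ltNge; apply/negP => hs.
  (* The least element [u] of [A] is the first time at which [y] is at most [m / 2]. Before it the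
     source is nonnegative, so [y u >= y ta > m / 2]. *)
  pose A : set R := [set t | ta <= t] `&` ([set t | t <= s] `&` [set t | y t <= m / 2]).
  have clA : closed A.
    apply: closedI; last apply: closedI;
    by apply: closed_le_continuous => // t; do ?[exact: cvg_cst|exact: cvg_id].
  have cA : compact A.
    apply: (@subclosed_compact _ _ `[ta, s]) => //; first exact: segment_compact.
    by move=> t [/= h1 [/= h2 _]]; rewrite in_itv /= h1.
  have [||u] := @compact_EVT_min _ R id A _ cA; first by exists s; do !split => /=.
    by apply: continuous_subspaceT => t; exact: cvg_id.
  rewrite inE => -[/= u1 [/= u2 u3]] umin.
  have yu t : ta < t < u -> m / 2 < y t.
    move=> /andP[t1 t2]; rewrite ltNge; apply/negP => yt.
    have := umin t; rewrite inE => /(_ _); suff : A t by move=> At /(_ At); lra.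
    by split => /=; [exact: ltW|split => //=; lra].
  have rng t : ta < t < u -> 0 < t < T.
    by move=> /andP[a1 a2]; apply/andP; split; lra.
  suff : - y u - - y ta <= 0 * (u - ta) by lra.
  apply: (@le_increment R (fun t => - y t) _ ta u 0 u1 _
     (fun t ht => is_deriveN (path_derive xi U (rng t ht)))).
    by move=> t; apply: cvgN; exact: cy.
  move=> t ht; rewrite oppr_le0.
  have /andP[t1 t2] := ht.
  have hot : `|w t (- (xi - t))| <= m / 4.
    by apply: hop; apply/andP; split; lra.
  have := ler_norm (w t (- (xi - t))) => hn.
  have := yu t ht; rewrite /y => hy.
  have := @source_sign R p alpha a eps (xi - t) (w t (xi - t) - w t (- (xi - t))).
  rewrite subr_ge0 pmulr_rge0 ?oppr_gt0//; apply; lra.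
have m4 : 0 < m / 4 by lra.
have h1 : `|1 : R| = 1 by rewrite normr1.
have h2 : 1 * a < 0 by lra.
have h3 : T1 < xi by lra.
have h4 : xi - s0 <= eps `^ beta by rewrite /s0; lra.
have h5 s : s0 < s < T1 -> `|w s (- (xi - s))| <= m / 4.
  by move=> /andP[? ?]; apply: hop; apply/andP; split; lra.
have h6 s : s0 < s < T1 -> 2 * (m / 4) <= w s (xi - s).
  move=> /andP[? ?]; have := hw s; rewrite /y => /(_ _) h.
  suff : m / 2 < w s (xi - s) by lra.
  by apply: h; apply/andP; split; lra.
have := log_growth p2 aE e0 h1 h2 U s00 s0T T1T m4 h3 h4 h5 h6.
have -> : xi - s0 = kap by rewrite /s0; ring.
have hM0 : `|w T1 (xi - T1)| <= M by apply: hM; rewrite lexx andbT; lra.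
have := ler_norm (w T1 (xi - T1)).
have hs0 : m / 2 < w s0 kap.
  have := hw s0; rewrite /y.
  have -> : xi - s0 = kap by rewrite /s0; ring.
  by apply; rewrite tas.
have hl : ln (kap / (2 * l)) <= ln (kap / (xi - T1)).
  by apply: ler_ln_ratio; [exact: kap0|exact: xT0|lra].
have hk : 0 <= `|a| * 2 `^ (- p) * (m / 4) `^ p by rewrite !mulr_ge0 ?powR_ge0.
have := ler_wpM2l hk hl.
lra.
Qed.

(** * Behind the outgoing pulse *)

(* Maximum principle in the region behind the outgoing pulse, after the incoming
   pulse has passed or after the time [T1]. *)
Lemma aftermath (R : realType) (p alpha a eps T T1 T2 c dl eta : R)
    (w : R -> R -> R) :
  0 < a -> unfolded_solution p alpha a eps T w ->
  T1 <= T2 -> T2 < T -> 0 < dl -> dl <= T1 -> 0 <= eta -> 0 < c ->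
  (forall x, `|x| + T1 <= c -> w T1 x = 0) ->
  (forall t r, t <= T1 -> c <= r + t <= c + 2 * dl -> r - t <= c ->
     `|w t (- r)| <= eta) ->
  (forall x, c <= x + T1 <= c + 2 * dl -> `|w T1 x| <= eta) ->
  (forall t, dl <= t <= T2 -> `|w t (t + c)| <= eta) ->
  forall t x, T1 <= t <= T2 -> `|x| <= t + c -> `|w t x| <= eta.
Proof.
move=> a0 U T12 T2T dl0 dlT eta0 c0 hz hstrip habs hcross t x /andP[t1 t2] xt.
have [cw dw lw] := U.
pose d := c + 2 * dl.
pose K : set (R * R) := [set z | 0 <= z.1] `&` ([set z | z.1 <= T2] `&`
  ([set z | `|z.2| <= z.1 + c] `&`
   ([set z | T1 <= z.1] `|` [set z | d <= `|z.2| + z.1]))).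
(* The part of the boundary through which backward rays can leave [K]: the slice [t = T1] within the
   incoming pulse and inside it, the rear edge of the outgoing pulse on the incoming side, and the
   rear edge of the incoming pulse on the side [x <= 0]. On the side [x >= 0] rays run parallel to
   the latter. *)
pose D : set (R * R) := [set z | K z /\ [\/ z.1 = T1 /\ `|z.2| + z.1 <= d,
  z.2 = z.1 + c | [/\ z.2 <= 0, z.1 <= T1 & `|z.2| + z.1 = d]]].
(* The two pulses need the time [dl] to separate; this keeps [K] away from [t = 0], where the
   equation is not assumed. *)
have Kpos s y : K (s, y) -> dl <= s.
  by move=> [/= h1 [h2 [/= h3 [/= h4|/= h4]]]]; move: h4; rewrite /d; lra.
rewrite -[leRHS]mulr1 -expR0 -(mul0r t).
apply: (@max_principle R w
    (fun t x => source p alpha a eps x (w t x - w t (- x))) K D) => //.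
- apply: (@compact_closed_box _ _ T2 (T2 + c)); last first.
    by move=> s y [/= h1 [/= h2 [/= h3 _]]]; split; [rewrite h1 h2|lra].
  apply: closedI; last (apply: closedI; last (apply: closedI; last apply: closedU));
    apply: closed_le_continuous => z;
    do ?[exact: cvg_cst|exact: cvg_fst|exact: continuous_absD].
    by apply: cvg_norm; exact: cvg_snd.
  by apply: cvgD; [exact: cvg_fst|exact: cvg_cst].
- move=> s y [/= h1 [/= h2 [/= h3 /= h4]]]; split=> //; do !split=> //=;
    by rewrite normrN.
- move=> s y Ksy nD; have [/= h1 [/= h2 h3]] := Ksy.
  apply: dw; apply/andP; split; last exact: le_lt_trans T2T.
  by apply: lt_le_trans (Kpos _ _ Ksy).
- move=> s y Ksy nD; have [/= h1 [/= h2 [/= h3 h4]]] := Ksy.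
  have sdl := Kpos _ _ Ksy.
  have [e1 e10 he1] : exists2 e, 0 < e &
      forall u, 0 < u < e -> `|y + u| <= s - u + c.
    have [y0|y0] := leP 0 y.
      have yn : y != s + c by apply/eqP => ye; apply: nD; split=> //; exact: Or32.
      have yl : y < s + c by rewrite lt_neqAle yn (le_trans _ h3)// ler_norm.
      exists ((s + c - y) / 2); first by lra.
      by move=> u /andP[u0 u1]; rewrite ger0_norm; lra.
    exists (- y); first lra.
    move=> u /andP[u0 u1]; rewrite ltr0_norm; last lra.
    by move: h3; rewrite ltr0_norm//; lra.
  have [e2 e20 he2] : exists2 e, 0 < e &
      forall u, 0 < u < e -> T1 <= s - u \/ d <= `|y + u| + (s - u).
    have [sT|sT|sT] := ltgtP s T1.
    - have h : d <= `|y| + s by case: h4 => /= h4 //; lra.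
      have [y0|y0] := leP 0 y.
        exists 1 => // u /andP[u0 u1]; right.
        by move: h; rewrite !ger0_norm; lra.
      have hn : `|y| + s != d.
        apply/eqP => he; apply: nD; split=> //; apply: Or33.
        by split=> //=; rewrite ltW.
      have hl : d < `|y| + s by rewrite lt_neqAle eq_sym hn.
      exists ((`|y| + s - d) / 2); first lra.
      move=> u /andP[u0 u1]; right.
      by have := ler_normB (y + u) u; rewrite addrK (gtr0_norm u0); lra.
    - exists (s - T1); first lra.
      by move=> u /andP[u0 u1]; left; lra.
    - have hl : d < `|y| + s.
        rewrite ltNge; apply/negP => hle; apply: nD; split=> //; apply: Or31.
        by split.
      exists ((`|y| + s - d) / 2); first lra.
      move=> u /andP[u0 u1]; right.
      by have := ler_normB (y + u) u; rewrite addrK (gtr0_norm u0); lra.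
  exists (Num.min dl (Num.min e1 e2)); first by rewrite !lt_min dl0 e10 e20.
  move=> u /andP[u0]; rewrite !lt_min => /and3P[u1 u2 u3].
  split; [|split; [|split]] => /=; [lra|lra| |].
    by apply: he1; rewrite u0.
  by apply: he2; rewrite u0.
- by move=> s y _ _ hy; rewrite mul0r source_le0.
- move=> s y [Ksy [[/= sT hy]|/= ye|[/= y0 sT hy]]].
  + rewrite sT in hy *.
    have [yc|yc] := leP (`|y| + T1) c; first by rewrite hz// normr0.
    have [y0|y0] := leP 0 y.
      by apply: habs; rewrite ger0_norm// in yc hy; rewrite ltW.
    rewrite -[y]opprK; apply: hstrip => //.
      by rewrite ltr0_norm// in yc hy; rewrite ltW.
    by have [_ [_ [/= h3 _]]] := Ksy; rewrite ltr0_norm// in h3; lra.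
  + rewrite ye; apply: hcross; rewrite (Kpos _ _ Ksy).
    by have [_ [/= ]] := Ksy.
  + rewrite -[y]opprK; apply: hstrip => //.
      by rewrite ler0_norm// in hy; rewrite hy /d; apply/andP; split; lra.
    by have [_ [_ [/= h3 _]]] := Ksy; rewrite ler0_norm// in h3; lra.
- by do !split=> //=; [lra|left].
Qed.

(** * Initial data *)

Lemma profile_eq0 (R : realType) (z0 : R) (U : R -> R -> R) (r z : R) :
  supported_in z0 U -> 0 <= r -> z0 < `|z| -> U r z = 0.
Proof.
move=> hU rge0 hz; apply/eqP; rewrite -[_ == _]negbK; apply/negP => hne.
have hc : closure [set z | U r z != 0] z by exact: subset_closure.
have := hU r rge0 z hc; rewrite /= in_itv /= -ler_norml.
by rewrite leNgt hz.
Qed.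

Lemma derive1_near_cst (R : realType) (f : R -> R) (c x : R) :
  (\forall y \near x, f y = c) -> derive1 f x = 0.
Proof.
move=> h; rewrite derive1E (near_eq_derive _ (_ : \near x, f x = cst c x))//.
exact: derive_cst.
Qed.

Section profile.
Context {R : realType} {z0 : R} {U0 U1 : R -> R -> R}.
Context (hU0 : pulse_profile z0 U0) (hU1 : pulse_profile z0 U1).

Lemma dz_profile_eq0 r z : 0 <= r -> z0 < `|z| -> derive1 (U0 r) z = 0.
Proof.
case: hU0 => _ _ hs rge0 hz; apply: (@derive1_near_cst _ _ 0).
have : \forall y \near z, z0 < `|y|.
  have : `|y| @[y --> z] --> `|z| by apply: cvg_norm; exact: cvg_id.
  by move/(cvgr_gt `|z|); apply.
by apply: filterS => y; exact: profile_eq0.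
Qed.

Lemma dr_profile_eq0 r z : 0 < r -> z0 < `|z| ->
  derive1 (fun s => U0 s z) r = 0.
Proof.
case: hU0 => _ _ hs rpos hz; apply: (@derive1_near_cst _ _ 0).
have : \forall y \near r, 0 < y by exact: lt_nbhsr.
by apply: filterS => y y0; apply: profile_eq0 hs (ltW y0) hz.
Qed.

Lemma P_minus_eq0 r z : 0 <= r -> z0 < `|z| -> P_minus U0 U1 r z = 0.
Proof.
case: hU1 => _ _ hs rge0 hz; rewrite /P_minus (profile_eq0 hs rge0 hz).
by rewrite dz_profile_eq0// !mulr0 addr0.
Qed.

Lemma P_plus_eq0 r z : 0 <= r -> z0 < `|z| -> P_plus U0 U1 r z = 0.
Proof.
case: hU1 => _ _ hs rge0 hz; rewrite /P_plus (profile_eq0 hs rge0 hz).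
by rewrite dz_profile_eq0// !mulr0 subr0.
Qed.

Lemma P_one_eq0 r z : 0 <= r -> z0 < `|z| -> P_one U0 r z = 0.
Proof.
move=> rge0 hz; have [_ _ hs] := hU0; rewrite /P_one (profile_eq0 hs rge0 hz).
move: rge0; rewrite le_eqVlt => /predU1P[<-|rpos]; first by rewrite mul0r addr0.
by rewrite dr_profile_eq0// mulr0 addr0.
Qed.

(** [derive1] is under control for [r > 0] only; these representatives are continuous up to [r = 0],
    hence bounded on compact boxes. *)
Lemma profile_derivatives : exists Dz Dr : R -> R -> R,
  [/\ {within [set x : R * R | 0 <= x.1], continuous (fun x => Dz x.1 x.2)},
      {within [set x : R * R | 0 <= x.1], continuous (fun x => Dr x.1 x.2)} &
      forall r z, 0 < r -> derive1 (U0 r) z = Dz r z /\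
        derive1 (fun s => U0 s z) r = Dr r z].
Proof.
have [[D [D00 hD]] _ _] := hU0.
exists (D 0%N 1%N), (D 1%N 0%N); split; [exact: (hD 0%N 1%N).1|exact: (hD 1%N 0%N).1|].
move=> r z r0; have [h1 h2] := (hD 0%N 0%N).2 r z r0.
by rewrite !derive1E -D00; split; exact: derive_val.
Qed.

Lemma bounded_half_box (f : R -> R -> R) (rho z1 : R) :
  {within [set x : R * R | 0 <= x.1], continuous (fun x => f x.1 x.2)} ->
  exists2 M, 0 <= M & forall r z, 0 <= r <= rho -> `|z| <= z1 -> `|f r z| <= M.
Proof.
move=> cf; pose A : set (R * R) := `[0, rho] `*` `[- z1, z1].
have cA : compact A by apply: compact_setX; exact: segment_compact.
have cfA : {within A, continuous (fun x : R * R => f x.1 x.2)}.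
  apply: continuous_subspaceW cf => -[r z] [/=]; rewrite in_itv /=.
  by move=> /andP[].
have /ex_strict_bound_gt0[M M0 /= hM] :
    bounded_set ((fun x : R * R => f x.1 x.2) @` A).
  exact/compact_bounded/continuous_compact.
exists M; first exact: ltW.
move=> r z rr zz; apply/ltW/hM.
by exists (r, z) => //; split => /=; rewrite in_itv //= -ler_norml.
Qed.

(** The derivatives of the profiles are not assumed bounded, but for [eps <= 1] the support confines
    [r] to [[0, r0 + z0]], so a fixed compact box gives a bound uniform in [eps]. *)
Lemma data_bounded (r0 : R) : 0 < r0 -> 0 < z0 -> exists2 M, 0 <= M &
  forall eps r, 0 < eps <= 1 -> 0 <= r ->
    `|P_minus U0 U1 r ((r - r0) / eps) + eps * P_one U0 r ((r - r0) / eps)| <= M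
    /\ `|P_plus U0 U1 r ((r - r0) / eps) - eps * P_one U0 r ((r - r0) / eps)| <= M.
Proof.
move=> r00 z00.
have [Dz [Dr [cz cr hD]]] := profile_derivatives.
have [Mz Mz0 hMz] := @bounded_half_box _ (r0 + z0) z0 cz.
have [Mr Mr0 hMr] := @bounded_half_box _ (r0 + z0) z0 cr.
have [_ [M0 hM0] _] := hU0; have [_ [M1 hM1] _] := hU1.
have M00 : 0 <= M0 by apply: le_trans (hM0 0 0 (lexx _)).
have M10 : 0 <= M1 by apply: le_trans (hM1 0 0 (lexx _)).
pose rho := r0 + z0; have rho0 : 0 <= rho by rewrite /rho; lra.
exists (rho * M1 + rho * Mz + (M0 + rho * Mr)).
  by rewrite !addr_ge0 ?mulr_ge0.
move=> eps r /andP[e0 e1] rge0.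
set z := (r - r0) / eps.
have [hz|hz] := ltP z0 `|z|.
  rewrite P_minus_eq0// P_plus_eq0// P_one_eq0// mulr0 addr0 subr0 normr0.
  by rewrite !addr_ge0 ?mulr_ge0.
have rrho : r <= rho.
  have : `|r - r0| <= z0 * eps.
    by move: hz; rewrite /z normrM normfV (gtr0_norm e0) ler_pdivrMr.
  by move=> /ler_normlP[]; rewrite /rho; nra.
have b1 : `|r * U1 r z| <= rho * M1.
  by rewrite normrM (ger0_norm rge0) ler_pM// hM1.
have b2 : `|r * derive1 (U0 r) z| <= rho * Mz.
  move: (rge0); rewrite le_eqVlt => /predU1P[<-|rpos].
    by rewrite mul0r normr0 mulr_ge0.
  rewrite normrM (ger0_norm rge0) ler_pM// (hD r z rpos).1 hMz//.
  by rewrite rge0.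
have b3 : `|r * derive1 (fun s => U0 s z) r| <= rho * Mr.
  move: (rge0); rewrite le_eqVlt => /predU1P[<-|rpos].
    by rewrite mul0r normr0 mulr_ge0.
  rewrite normrM (ger0_norm rge0) ler_pM// (hD r z rpos).2 hMr//.
  by rewrite rge0.
have b4 : `|eps * P_one U0 r z| <= M0 + rho * Mr.
  rewrite normrM (gtr0_norm e0); apply: (@le_trans _ _ `|P_one U0 r z|).
    by rewrite ler_piMl.
  by rewrite /P_one (le_trans (ler_normD _ _))// lerD// hM0.
split; [apply: (le_trans (ler_normD _ _))|apply: (le_trans (ler_normB _ _))];
  rewrite lerD//.
  by rewrite /P_minus (le_trans (ler_normD _ _))// lerD.
by rewrite /P_plus (le_trans (ler_normB _ _))// lerD.
Qed.

Lemma data_limit (r0 z m : R) : 0 < r0 -> 0 < m ->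
  exists2 e0, 0 < e0 & forall eps, 0 < eps < e0 ->
    `|P_minus U0 U1 (r0 + eps * z) z + eps * P_one U0 (r0 + eps * z) z
      - P_minus U0 U1 r0 z| <= m.
Proof.
move=> r00 m0.
have [Dz [Dr [cz cr hD]]] := profile_derivatives.
have c1 : {within [set x : R * R | 0 <= x.1], continuous (fun x => U1 x.1 x.2)}.
  by have [[D [<- hD1]] _ _] := hU1; exact: (hD1 0%N 0%N).1.
have c0 : {within [set x : R * R | 0 <= x.1], continuous (fun x => U0 x.1 x.2)}.
  by have [[D [<- hD1]] _ _] := hU0; exact: (hD1 0%N 0%N).1.
(* The maximum with 0 keeps the path inside the half plane on which continuity is known; near
   [e = 0] it has no effect. *)
pose rr (e : R) := Num.max (r0 + e * z) 0.
have crr : continuous rr.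
  apply: continuous_maxr => e; last exact: cvg_cst.
  by apply: cvgD; [exact: cvg_cst|apply: cvgM; [exact: cvg_id|exact: cvg_cst]].
have comp (f : R -> R -> R) : {within [set x : R * R | 0 <= x.1], continuous (fun x => f x.1 x.2)} ->
    continuous (fun e => f (rr e) z).
  move=> cf.
  have cg : continuous (fun e => (rr e, z)).
    by apply: (continuous_pair crr) => e; exact: cvg_cst.
  have := continuous_comp_within cf cg.
  apply.
  by move=> e /=; rewrite le_max lexx orbT.
pose G e := rr e * U1 (rr e) z + rr e * Dz (rr e) z +
   e * (U0 (rr e) z + rr e * Dr (rr e) z).
have cG : G e @[e --> 0] --> G 0.
  apply: cvgD; first apply: cvgD.
  - by apply: cvgM; [exact: crr|exact: comp].
  - by apply: cvgM; [exact: crr|exact: comp].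
  - apply: cvgM; first exact: cvg_id.
    apply: cvgD; first exact: (comp _ c0).
    by apply: cvgM; [exact: crr|exact: comp].
have rr0 : rr 0 = r0 by rewrite /rr mul0r addr0 max_l// ltW.
have G0 : G 0 = P_minus U0 U1 r0 z.
  by rewrite /G rr0 mul0r addr0 /P_minus (hD r0 z r00).1.
have hpos : \forall e \near 0, 0 < r0 + e * z.
  have : r0 + e * z @[e --> 0] --> r0 + 0 * z.
    by apply: cvgD; [exact: cvg_cst|apply: cvgM; [exact: cvg_id|exact: cvg_cst]].
  by rewrite mul0r addr0 => /cvgr_gt; apply.
move/cvgrPdist_le : cG => /(_ _ m0) hG.
have [e /= e0 he] : \forall e \near 0, 0 < r0 + e * z /\ `|G 0 - G e| <= m.
  by apply: filterS2 hpos hG => e ? ?; split.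
exists e => // eps /andP[p0 pe].
have [|hp] := he eps; first by rewrite /= sub0r normrN gtr0_norm.
rewrite G0 distrC /G /rr (max_l (ltW hp)) /P_minus /P_one.
by rewrite (hD _ z hp).1 (hD _ z hp).2.
Qed.

End profile.

(** The support condition yields vanishing under strict inequalities, whereas the domains of
    dependence are closed; scaling towards the boundary point closes the gap. *)
Lemma zero_closed_ball (R : realType) (f : R -> R) (c : R) :
  continuous f -> 0 < c -> (forall x, `|x| < c -> f x = 0) ->
  forall x, `|x| <= c -> f x = 0.
Proof.
move=> cf c0 h x xc.
have hc : f (k * x) @[k --> 1^'-] --> f (1 * x).
  apply: (@cvg_comp _ _ _ (fun k => k * x) f _ (nbhs (1 * x))); last exact: cf.
  apply: cvg_at_left_filter.
  by apply: cvgM; [exact: cvg_id|exact: cvg_cst].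
suff h0 : f (k * x) @[k --> 1^'-] --> (0 : R).
  by rewrite -[x]mul1r; exact: (cvg_unique _ hc h0).
apply: cvg_near_cst; near=> k; apply: h.
have k1 : k < 1 by near: k; exact: nbhs_left_lt.
have k0 : 0 < k by near: k; exact: nbhs_left_gt.
rewrite normrM gtr0_norm//; nra.
Unshelve. all: by end_near. Qed.

Lemma zero_outside_ball (R : realType) (f : R -> R) (c : R) :
  continuous f -> 0 < c -> (forall x, c < `|x| -> f x = 0) ->
  forall x, c <= `|x| -> f x = 0.
Proof.
move=> cf c0 h x xc.
have hc : f (k * x) @[k --> 1^'+] --> f (1 * x).
  apply: (@cvg_comp _ _ _ (fun k => k * x) f _ (nbhs (1 * x))); last exact: cf.
  apply: cvg_at_right_filter.
  by apply: cvgM; [exact: cvg_id|exact: cvg_cst].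
suff h0 : f (k * x) @[k --> 1^'+] --> (0 : R).
  by rewrite -[x]mul1r; exact: (cvg_unique _ hc h0).
apply: cvg_near_cst; near=> k; apply: h.
have k1 : 1 < k by near: k; exact: nbhs_right_gt.
rewrite normrM gtr0_norm//; nra.
Unshelve. all: by end_near. Qed.

(** * The dissipative case *)

Lemma powR_small (R : realType) (s th : R) : 0 < s -> 0 < th ->
  exists2 e0, 0 < e0 <= 1 & forall eps, 0 < eps < e0 -> eps `^ s <= th.
Proof.
move=> s0 th0; exists (Num.min 1 (th `^ s^-1)).
  by rewrite lt_min ltr01 powR_gt0// ge_min lexx.
move=> eps /andP[e0]; rewrite lt_min => /andP[e1 e2].
have -> : th = (th `^ s^-1) `^ s by rewrite -powRrM mulVf ?gt_eqF// powRr1 ?ltW.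
by apply: ge0_ler_powR; rewrite ?nnegrE ?powR_ge0 ?(ltW e0) ?(ltW e2) ?(ltW s0).
Qed.

Lemma creation_bound_mono (R : realType) (p alpha a eps l l' M : R) :
  1 < p -> 0 < l -> l <= l' ->
  creation_bound p alpha a eps l' M <= creation_bound p alpha a eps l M.
Proof.
move=> p1 l0 ll; rewrite /creation_bound ler_wpM2r ?mulr_ge0 ?powR_ge0//.
rewrite ler_wpM2l ?powR_ge0// -opprB !powRN lef_pV2 ?posrE ?powR_gt0//.
  by apply: ge0_ler_powR; rewrite ?nnegrE; lra.
exact: lt_le_trans ll.
Qed.

(** The exponents add up to [alpha + beta (1 - p) + 1 = 1 - beta], which is positive exactly because
    [beta < 1]. *)
Lemma creation_bound_scaling (R : realType) (p alpha beta a eps lam M : R) :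
  2 <= p -> alpha = beta * (p - 2) -> 0 < eps -> 0 < lam ->
  creation_bound p alpha a eps (lam * eps `^ beta) M * eps =
  lam `^ (1 - p) * (`|a| * 2 `^ (- p) * (2 * M) `^ p) * eps `^ (1 - beta).
Proof.
move=> p2 aE e0 l0; rewrite /creation_bound powRM ?powR_ge0 ?(ltW l0)//.
set K := `|a| * _ * _; rewrite -powRrM.
have -> : eps `^ (1 - beta) = eps `^ alpha * eps `^ (beta * (1 - p)) * eps `^ 1.
  by rewrite -!powRD ?(gt_eqF e0) ?implybT//; congr powR; rewrite aE; ring.
by rewrite powRr1 ?(ltW e0)//; ring.
Qed.

(** As [eps <= eps^(1 - beta)], all four requirements reduce to one smallness condition on
    [eps^(1 - beta)], and [th] collects the four thresholds. The [+ 1] in [A1] and [A2] keeps the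
    divisors positive. *)
Lemma eventually_small (R : realType) (p alpha beta a r0 z0 M lam eta : R) :
  2 <= p -> alpha = beta * (p - 2) -> 0 <= beta -> beta < 1 ->
  0 < r0 -> 0 < z0 -> 0 < lam -> 0 < eta ->
  exists2 e0, 0 < e0 <= 1 & forall eps, 0 < eps < e0 ->
    [/\ z0 * eps <= r0 / 4, 2 * (z0 * eps) <= lam * eps `^ beta,
        creation_bound p alpha a eps (lam * eps `^ beta) M * (z0 * eps) <= eta &
        forall c, r0 / 4 <= c ->
          creation_bound p alpha a eps c M * (z0 * eps) <= eta].
Proof.
move=> p2 aE b0 b1 r00 z00 l0 eta0.
have p1 : 1 < p by lra.
pose K := `|a| * 2 `^ (- p) * (2 * M) `^ p.
have K0 : 0 <= K by rewrite !mulr_ge0 ?powR_ge0.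
pose th1 := r0 / 4 / z0; pose th2 := lam / 2 / z0.
pose A1 := lam `^ (1 - p) * K * z0 + 1.
pose A2 := (r0 / 4) `^ (1 - p) * K * z0 + 1.
have A10 : 0 < A1 by rewrite ltr_wpDl// !mulr_ge0 ?powR_ge0// ltW.
have A20 : 0 < A2 by rewrite ltr_wpDl// !mulr_ge0 ?powR_ge0// ltW.
pose th := Num.min (Num.min th1 th2) (Num.min (eta / A1) (eta / A2)).
have th0 : 0 < th by rewrite /th !lt_min !divr_gt0.
have b1' : 0 < 1 - beta by rewrite subr_gt0.
have [e0 /andP[e00 e01] he] := powR_small b1' th0.
exists e0; first by rewrite e00.
move=> eps hep; have := he eps hep => {he}; have /andP[ep epe] := hep.
have ep1 : eps <= 1 by rewrite (le_trans (ltW epe)).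
have epsE : eps <= eps `^ (1 - beta).
  by apply: ger1_powR; rewrite ?ep//; lra.
rewrite /th !le_min => /andP[/andP[h1 h2] /andP[h3 h4]].
split.
- by rewrite mulrC -ler_pdivlMr//; exact: le_trans epsE h1.
- have epE : eps = eps `^ (1 - beta) * eps `^ beta.
    rewrite -powRD ?(gt_eqF ep) ?implybT// (_ : 1 - beta + beta = 1); last by ring.
    by rewrite powRr1 ?(ltW ep).
  rewrite {1}epE.
  set E := eps `^ beta; have E0 : 0 <= E by exact: powR_ge0.
  set F := eps `^ _ in h2 *.
  have : F * z0 <= lam / 2 by rewrite -ler_pdivlMr.
  nra.
- rewrite [z0 * _]mulrC mulrA creation_bound_scaling// -/K.
  apply: (@le_trans _ _ (A1 * eps `^ (1 - beta))).
    have := powR_ge0 eps (1 - beta); rewrite /A1.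
    set F := eps `^ _; set G := lam `^ _; lra.
  by rewrite mulrC -ler_pdivlMr.
- move=> c hc; have rr : 0 < r0 / 4 by lra.
  apply: (@le_trans _ _ (creation_bound p alpha a eps (r0 / 4) M * (z0 * eps))).
    by apply: ler_wpM2r; [rewrite mulr_ge0 ?(ltW z00) ?(ltW ep)|exact: creation_bound_mono].
  rewrite /creation_bound -/K.
  have ea : eps `^ alpha <= 1.
    have <- : (1 : R) `^ alpha = 1 by rewrite powR1.
    apply: ge0_ler_powR; rewrite ?nnegrE ?(ltW ep)//.
    by rewrite aE mulr_ge0//; lra.
  apply: (@le_trans _ _ (A2 * eps)); last first.
    apply: (@le_trans _ _ (A2 * eps `^ (1 - beta))); first by rewrite ler_pM2l.
    by rewrite mulrC -ler_pdivlMr.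
  set G := (r0 / 4) `^ _; set E := eps `^ alpha in ea *.
  have GK : 0 <= G * K * z0 * eps.
    by rewrite !mulr_ge0 ?powR_ge0// ltW.
  have : E * (G * K * z0 * eps) <= 1 * (G * K * z0 * eps) by rewrite ler_wpM2r.
  rewrite /A2 -/G; lra.
Qed.

Lemma unfolded_initial_zero (R : realType) (r0 z0 eps : R) (U0 U1 : R -> R -> R)
    (vm vp w : R -> R -> R) :
  pulse_profile z0 U0 -> pulse_profile z0 U1 -> 0 < z0 -> 0 < eps ->
  0 < r0 - z0 * eps -> continuous (fun z : R * R => w z.1 z.2) ->
  (forall r : R, 0 <= r ->
     vm 0 r = P_minus U0 U1 r ((r - r0) / eps)
              + eps * P_one U0 r ((r - r0) / eps) /\
     vp 0 r = P_plus U0 U1 r ((r - r0) / eps)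
              - eps * P_one U0 r ((r - r0) / eps)) ->
  (forall r, 0 <= r -> w 0 r = vm 0 r /\ w 0 (- r) = - vp 0 r) ->
  (forall x, `|x| <= r0 - z0 * eps -> w 0 x = 0) /\
  (forall x, r0 + z0 * eps <= `|x| -> w 0 x = 0).
Proof.
move=> hU0 hU1 z00 e0 c0 cw hini wE.
have cw0 : continuous (w 0).
  have -> : w 0 = (fun z : R * R => w z.1 z.2) \o (fun x => (0, x)) by [].
  move=> x; apply: continuous_comp; last exact: cw.
  by apply: continuous_pair => {}x; [exact: cvg_cst|exact: cvg_id].
have ze0 : 0 < z0 * eps by rewrite mulr_gt0.
have key x : z0 * eps < `| `|x| - r0 | -> w 0 x = 0.
  move=> hx; have hz : z0 < `|(`|x| - r0) / eps|.
    by rewrite normrM normfV (gtr0_norm e0) ltr_pdivlMr.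
  have x0 := normr_ge0 x.
  have [hm hp] := hini _ x0; have [wm wp] := wE _ x0.
  rewrite (P_minus_eq0 hU0 hU1 x0 hz) (P_one_eq0 hU0 x0 hz) mulr0 addr0 in hm.
  rewrite (P_plus_eq0 hU0 hU1 x0 hz) (P_one_eq0 hU0 x0 hz) mulr0 subr0 in hp.
  have [xp|xn] := leP 0 x; first by rewrite -[x]ger0_norm// wm hm.
  have xE : x = - `|x| by rewrite ltr0_norm// opprK.
  by rewrite xE wp hp oppr0.
split.
  apply: zero_closed_ball => // x hx; apply: key.
  by rewrite ltr0_norm; lra.
apply: zero_outside_ball => //; first by lra.
by move=> x hx; apply: key; rewrite gtr0_norm; lra.
Qed.

Lemma unfolded_initial_bound (R : realType) (w vm vp : R -> R -> R) (M : R) :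
  (forall r, 0 <= r -> `|vm 0 r| <= M /\ `|vp 0 r| <= M) ->
  (forall r, 0 <= r -> w 0 r = vm 0 r /\ w 0 (- r) = - vp 0 r) ->
  forall x, `|w 0 x| <= M.
Proof.
move=> hM wE x; have [x0|x0] := leP 0 x.
  by rewrite (wE _ x0).1 (hM _ x0).1.
have nx0 : 0 <= - x by rewrite oppr_ge0 ltW.
by rewrite -[x]opprK (wE _ nx0).2 normrN (hM _ nx0).2.
Qed.

(** Both distances scale like [E = eps^beta], which cancels in the ratio; hence [lam] can be fixed
    independently of [eps]. *)
Lemma log_ratio_gt (R : realType) (M k kp lam E : R) :
  0 < k -> 0 < kp -> 0 < lam -> 0 < E -> 2 * lam * expR (M / k) < kp ->
  M < k * ln (kp * E / (2 * (lam * E))).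
Proof.
move=> k0 kp0 l0 E0 h; rewrite -ltr_pdivrMl// mulrC.
have -> : kp * E / (2 * (lam * E)) = kp / (2 * lam).
  by field; rewrite (gt_eqF E0) (gt_eqF l0).
rewrite -ltr_expR lnK ?posrE ?divr_gt0 ?mulr_gt0//.
by rewrite ltr_pdivlMr ?mulr_gt0// [_ * (2 * lam)]mulrC.
Qed.

Lemma pulse_geometry (R : realType) (r0 dl lam E kp : R) :
  0 < r0 -> 0 < dl -> dl <= r0 / 4 -> 0 < lam -> 0 < E -> E <= 1 ->
  kp <= 1 -> kp <= r0 / 4 -> 2 * lam <= kp ->
  [/\ 0 < lam * E, 0 < r0 - dl, dl <= r0 - dl - lam * E &
      r0 - dl - lam * E < r0] /\
  [/\ kp * E <= E, kp * E <= (r0 - dl) / 2, 2 * (lam * E) <= kp * E &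
      r0 / 4 <= (r0 - dl) / 2].
Proof.
move=> r00 dl0 dlr l0 E0 E1 kp1 kpr lk.
have lE0 : 0 < lam * E by rewrite mulr_gt0.
have kp0 : 0 <= kp by lra.
have h1 : 2 * (lam * E) <= kp * E by rewrite mulrA ler_wpM2r// ltW.
have h2 : kp * E <= kp by rewrite ler_piMr.
have h3 : kp * E <= E by rewrite ler_piMl// ltW.
by split; split; lra.
Qed.

Lemma powR_le1 (R : realType) (eps beta : R) :
  0 < eps <= 1 -> 0 <= beta -> 0 < eps `^ beta <= 1.
Proof.
move=> /andP[e0 e1] b0; rewrite powR_gt0//=.
have <- : (1 : R) `^ beta = 1 by rewrite powR1.
by apply: ge0_ler_powR; rewrite ?nnegrE ?(ltW e0).
Qed.

Lemma absorption (R : realType) (p alpha beta a r0 z0 : R)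
    (U0 U1 : R -> R -> R) (vm vp : R -> R -> R -> R) :
  2 <= p -> alpha = beta * (p - 2) -> 0 <= beta -> beta < 1 ->
  0 < r0 -> 0 < z0 -> 0 < a ->
  pulse_profile z0 U0 -> pulse_profile z0 U1 ->
  (forall eps : R, 0 < eps <= 1 ->
      is_solution p alpha a r0 U0 U1 eps +oo%E (vm eps) (vp eps)) ->
  forall eta : R, 0 < eta -> exists2 lam0 : R, 0 < lam0 &
  forall lam : R, 0 < lam < lam0 -> exists2 e0 : R, 0 < e0 <= 1 &
  forall eps : R, 0 < eps < e0 ->
  forall t : R, r0 - z0 * eps - lam * eps `^ beta <= t ->
  forall r : R, 0 <= r <= t -> `|vm eps t r| <= eta /\ `|vp eps t r| <= eta.
Proof.
move=> p2 aE b0 b1 r00 z00 a0 hU0 hU1 hsol eta eta0.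
have p1 : 1 < p by apply: lt_le_trans p2; rewrite ltr1n.
have [M M0 hM] := data_bounded hU0 hU1 r00 z00.
have e20 : 0 < eta / 2 by rewrite divr_gt0.
pose k := `|a| * 2 `^ (- p) * (eta / 2) `^ p.
have k0 : 0 < k by rewrite !mulr_gt0 ?powR_gt0 ?normr_gt0 ?gt_eqF.
(* The logarithm is collected from distance [kp * eps^beta] on: the factor 1 keeps it in the range
   of [coef_ge], the factor [r0 / 4] below the initial distance of the pulse. *)
pose kp := Num.min 1 (r0 / 4).
have kp0 : 0 < kp by rewrite lt_min ltr01 divr_gt0.
have kp1 : kp <= 1 by rewrite ge_min lexx.
have kpr : kp <= r0 / 4 by rewrite ge_min lexx orbT.
have ex0 : 0 < expR (M / k) by exact: expR_gt0.
have ex1 : 1 <= expR (M / k) by rewrite -[leLHS]expR0 ler_expR divr_ge0// ltW.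
(* The threshold at which [k * ln (kp / (2 * lam))] equals [M]. *)
clearbody kp; exists (kp / 2 / expR (M / k)); first by rewrite !divr_gt0.
move=> lam /andP[l0]; rewrite ltr_pdivlMr// ltr_pdivlMr// => ll.
have {}ll : 2 * lam * expR (M / k) < kp by rewrite [2 * lam]mulrC mulrAC.
have l2 : 2 * lam <= kp.
  by apply: le_trans (ltW ll); rewrite ler_peMr// mulr_ge0// ltW.
have [e0 he0 he] := @eventually_small R p alpha beta a r0 z0 M lam _ p2 aE b0 b1
  r00 z00 l0 e20.
exists e0 => // eps hep t tT r /andP[rge0 rt].
have [h1 h2 h3 h4] := he eps hep.
have /andP[ep epe] := hep; have /andP[_ e01] := he0.
have ep1 : 0 < eps <= 1 by rewrite ep (le_trans (ltW epe)).
have /andP[E0 E1] := powR_le1 ep1 b0.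
have dl0 : 0 < z0 * eps by rewrite mulr_gt0.
have [[lp c0 T10 _] [ke kc lk r4]] := pulse_geometry r00 dl0 h1 l0 E0 E1 kp1 kpr l2.
have t0 : 0 < t by apply: lt_le_trans tT; exact: lt_le_trans T10.
have solE := hsol eps ep1.
have tT' : t < t + 1 by rewrite ltrDl.
have T0 : 0 < t + 1 by exact: lt_trans tT'.
have [w U wE] := exists_unfolded p1 T0 (ltry _) solE.
have [cw _ _] := U.
have [_ [_ [_ [_ [_ [hini _]]]]]] := solE.
have wE0 s : 0 <= s -> w 0 s = vm eps 0 s /\ w 0 (- s) = - vp eps 0 s.
  by move=> s0; apply: wE => //; rewrite lexx ltW.
have [w0in w0out] := unfolded_initial_zero hU0 hU1 z00 ep c0 cw hini wE0.
have w0M : forall x, `|w 0 x| <= M.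
  apply: (unfolded_initial_bound _ wE0) => s s0.
  by have [-> ->] := hini s s0; apply: hM.
have wM := dissipative_bound a0 tT' U w0M.
have win := zero_inner p1 tT' U w0in.
have wout := zero_outer p1 tT' U w0out.
have r0E : r0 + z0 * eps = r0 - z0 * eps + 2 * (z0 * eps) by ring.
rewrite r0E {r0E} in wout.
have hln := log_ratio_gt k0 kp0 l0 E0 ll.
clear hM hini wE0 w0in w0out w0M he hsol solE cw hU0 hU1.
move: tT T10 kc r4 h1 h2 h3 h4 dl0 lp c0 lk win wout hln.
move: (z0 * eps) (lam * eps `^ beta) => dl l.
move: (r0 - dl) => c.
set T1 := c - l.
move=> T1t T10 kc r4 h1 h2 h3 h4 dl0 lp c0 lk win wout hln.
have wM1 s x : 0 <= s <= T1 -> `|w s x| <= M.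
  by move=> /andP[s0 s1]; apply: wM; rewrite s0 (le_trans s1).
have win1 s x : 0 <= s <= T1 -> `|x| + s <= c -> w s x = 0.
  by move=> /andP[s0 s1]; apply: win; rewrite s0 (le_trans s1).
have T1T : T1 < t + 1 by exact: le_lt_trans tT'.
have T10' : 0 <= T1 by exact: le_trans (ltW dl0) T10.
have hd : forall x, c <= x + T1 <= c + 2 * dl -> `|w T1 x| <= eta.
  apply: (absorbed (kap := kp * eps `^ beta) p2 aE ep a0 U T1T lp _ wM1 win1) => //.
  by apply: (le_trans kc); lra.
have hs : forall s q, s <= T1 -> c <= q + s <= c + 2 * dl -> q - s <= c ->
     `|w s (- q)| <= eta.
  move=> s q sT qs qc.
  apply: (le_trans (strip_bound p1 T1T U lp (erefl _) wM1 win1 sT qs qc)).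
  by apply: (le_trans h3); rewrite ler_piMr ?(ltW eta0)// invf_le1// ler1n.
have hcr : forall s, dl <= s <= t -> `|w s (s + c)| <= eta.
  move=> s hs'.
  apply: (le_trans (crossing_bound p1 tT' U c0 wM wout hs' (ltW dl0))).
  apply: (le_trans (h4 c _)); first by apply: (le_trans r4); lra.
  by rewrite ler_piMr ?(ltW eta0)// invf_le1// ler1n.
have hz : forall x, `|x| + T1 <= c -> w T1 x = 0.
  by move=> x; apply: win1; rewrite lexx andbT.
have main := aftermath a0 U T1t tT' dl0 T10 (ltW eta0) c0 hz hs hd hcr.
have tt : T1 <= t <= t by rewrite T1t lexx.
have tt0 : 0 <= t <= t + 1 by rewrite !ltW.
have rtc : r <= t + c by apply: (le_trans rt); rewrite lerDl ltW.
have [<- hp] := wE t r tt0 rge0; rewrite -[vp _ _ _]opprK -hp normrN.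
by split; apply: main => //; rewrite ?normrN ger0_norm.
Qed.

(** * Essential suprema and upper limits *)

Lemma Lnormoo_le (d : measure_display) (T : measurableType d) (R : realType)
    (mu : {measure set T -> \bar R}) (f : T -> R) (M : R) :
  0 <= M -> (forall x, `|f x| <= M) ->
  ('N[mu]_(+oo)[EFin \o f] <= M%:E)%E.
Proof.
move=> M0 hf; rewrite unlock; case: ifPn => _; last by rewrite lee_fin.
by apply/ess_supP; apply: nearW => x /=; rewrite lee_fin.
Qed.

Lemma Linf_norm_at_le (R : realType) (v : R -> R -> R) (T M : R) :
  0 <= M -> (forall r, 0 <= r <= T -> `|v T r| <= M) ->
  (Linf_norm_at v T <= M%:E)%E.
Proof.
move=> M0 h; apply: Lnormoo_le => // r; rewrite /patch.
case: ifPn => [|_]; last by rewrite normr0.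
by rewrite inE /= in_itv /=; exact: h.
Qed.

Lemma limf_esup_le (T : choiceType) (X : filteredType T) (R : realType)
    (f : X -> \bar R) (F : set_system X) (y : \bar R) :
  F [set x | (f x <= y)%E] -> (limf_esup f F <= y)%E.
Proof.
move=> h; rewrite limf_esupE.
apply: (@le_trans _ _ (ereal_sup (f @` [set x | (f x <= y)%E]))).
  by apply: ereal_inf_lbound; exists [set x | (f x <= y)%E].
by apply: ge_ereal_sup => _ [x hx <-].
Qed.

Lemma at_right_itv (R : realType) (e0 : R) (P : R -> Prop) :
  0 < e0 -> (forall e, 0 < e < e0 -> P e) -> \forall e \near 0^'+, P e.
Proof.
move=> e00 h; near=> e; apply: h; apply/andP; split.
  by near: e; exact: nbhs_right_gt.
by near: e; exact: nbhs_right_lt.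
Unshelve. all: by end_near. Qed.

(** For [p = 2] the convention [x / 0 = 0] gives the exponent 0, so that both regimes are handled
    with the single [beta = alpha / (p - 2)]. *)
Lemma exponent_beta (R : realType) (p alpha : R) :
  (0 <= alpha /\ alpha < p - 2) \/ (alpha = 0 /\ p - 2 = 0) ->
  [/\ 2 <= p, alpha = alpha / (p - 2) * (p - 2), 0 <= alpha / (p - 2) &
      alpha / (p - 2) < 1].
Proof.
case=> [[a0 ap]|[-> p2]].
  have p20 : 0 < p - 2 by exact: le_lt_trans ap.
  by rewrite divfK ?(gt_eqF p20)// ltr_pdivrMr// mul1r divr_ge0 ?(ltW p20)//; split=> //; lra.
by rewrite !mul0r; split=> //; lra.
Qed.

Lemma T_absorbE (R : realType) (p alpha r0 z0 lambda eps : R) :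
  T_absorb p alpha r0 z0 lambda eps =
  r0 - z0 * eps - lambda * eps `^ (alpha / (p - 2)).
Proof.
rewrite /T_absorb; case: eqP => // ->.
by rewrite subrr invr0 mulr0 powRr0 mulr1.
Qed.

Lemma dissipative_part (R : realType) (p alpha a r0 z0 : R) (U0 U1 : R -> R -> R)
    (hr0 : 0 < r0) (hz0 : 0 < z0)
    (halpha : (0 <= alpha /\ alpha < p - 2) \/ (alpha = 0 /\ p - 2 = 0))
    (hU0 : pulse_profile z0 U0) (hU1 : pulse_profile z0 U1)
    (vm vp : R -> R -> R -> R) :
  0 < a ->
  (forall eps : R, 0 < eps <= 1 ->
      is_solution p alpha a r0 U0 U1 eps +oo%E (vm eps) (vp eps)) ->
   (forall T : R, r0 <= T ->
      limf_esup (fun eps : R =>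
        (Linf_norm_at (vm eps) T + Linf_norm_at (vp eps) T)%E) 0^'+ = 0%E) /\
   (forall T : R -> R -> R,
      (forall lambda eps : R, 0 < lambda -> 0 < eps <= 1 ->
         T_absorb p alpha r0 z0 lambda eps <= T lambda eps) ->
      (fun lambda : R =>
         limf_esup (fun eps : R =>
           (Linf_norm_at (vm eps) (T lambda eps)
            + Linf_norm_at (vp eps) (T lambda eps))%E) 0^'+)
        @ 0^'+ --> 0%E).
Proof.
move=> a0 hsol.
have [p2 aE b0 b1] := exponent_beta halpha.
have key := absorption p2 aE b0 b1 hr0 hz0 a0 hU0 hU1 hsol.
have ge0 (T : R -> R) : (0 <= limf_esup (fun eps : R =>
    (Linf_norm_at (vm eps) (T eps) + Linf_norm_at (vp eps) (T eps))%E) 0^'+)%E.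
  apply: limf_esup_ge0; last by move=> eps; rewrite adde_ge0 // Lnorm_ge0.
  exact: filter_not_empty.
have le2 (eta : R) : 0 < eta -> exists2 lam0, 0 < lam0 &
    forall lam, 0 < lam < lam0 -> forall T : R -> R,
    (forall eps : R, 0 < eps <= 1 -> T_absorb p alpha r0 z0 lam eps <= T eps) ->
    (limf_esup (fun eps : R =>
    (Linf_norm_at (vm eps) (T eps) + Linf_norm_at (vp eps) (T eps))%E) 0^'+
     <= eta%:E)%E.
  move=> eta0; have e20 : 0 < eta / 2 by lra.
  have [lam0 l00 hl] := key _ e20; exists lam0 => // lam hlam T hT.
  have [e0 /andP[e00 e01] he] := hl lam hlam.
  apply: limf_esup_le; apply: (at_right_itv e00) => eps hep.
  have hep1 : 0 < eps <= 1.
    by case/andP: hep => ep epe; rewrite ep (le_trans (ltW epe)).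
  have hTe := hT eps hep1; rewrite T_absorbE in hTe.
  have hr := he eps hep _ hTe.
  rewrite [eta](splitr eta) EFinD; apply: leeD;
    apply: Linf_norm_at_le => [|r hrr]; [exact: ltW|exact: (hr r hrr).1|
    exact: ltW|exact: (hr r hrr).2].
split.
  move=> T rT; apply/eqP; rewrite eq_le (ge0 (fun=> T)) andbT.
  apply/lee_addgt0Pr => eta eta0; rewrite add0e.
  have [lam0 l00 hl] := le2 eta eta0.
  (* Any admissible [lam] works here, since [T_absorb] never exceeds [r0 <= T]. *)
  apply: (hl (lam0 / 2) _ (fun=> T)) => [|eps /andP[e0 e1]].
    by apply/andP; split; lra.
  rewrite T_absorbE; have := powR_ge0 eps (alpha / (p - 2)); nra.
move=> T hT.
have near0 (eta : R) : 0 < eta -> \forall lam \near 0^'+,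
   (0 <= limf_esup (fun eps : R => (Linf_norm_at (vm eps) (T lam eps)
            + Linf_norm_at (vp eps) (T lam eps))%E) 0^'+ <= eta%:E)%E.
  move=> eta0; have [lam0 l00 hl] := le2 eta eta0.
  apply: (at_right_itv l00) => lam hlam; rewrite ge0/=.
  by apply: (hl lam hlam) => eps; apply: hT; case/andP: hlam.
apply/fine_cvgP; split.
  have := near0 _ (ltr01); apply: filterS => lam /andP[h1 h2].
  by rewrite ge0_fin_numE// (le_lt_trans h2) ?ltry.
apply/cvgrPdist_le => eta eta0.
have := near0 _ eta0; apply: filterS => lam /andP[h1 h2] /=.
rewrite sub0r normrN ger0_norm ?fine_ge0//.
have hf : limf_esup (fun eps : R => (Linf_norm_at (vm eps) (T lam eps)
            + Linf_norm_at (vp eps) (T lam eps))%E) 0^'+ \is a fin_num.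
  by rewrite ge0_fin_numE// (le_lt_trans h2) ?ltry.
by rewrite -lee_fin fineK.
Qed.

(** By continuity a value above [M] persists on a small square, which has positive measure. The
    square extends towards larger [t] and [r] to stay in the slab; this is where [t < T] gives
    room. *)
Lemma Linf_norm_slab_pointwise (R : realType) (Tmax : \bar R) (T M : R)
    (v : R -> R -> R) :
  {within slab Tmax, continuous (fun x : R * R => v x.1 x.2)} ->
  (Linf_norm_slab Tmax T v <= M%:E)%E ->
  forall t r, 0 <= t -> (t%:E < Tmax)%E -> t < T -> 0 <= r -> `|v t r| <= M.
Proof.
move=> /subspace_continuousP cv hN t r t0 tTm tT rge0.
rewrite leNgt; apply/negP => hlt.
have hs : slab Tmax (t, r) by split.
have [d d0 hd] : exists2 d, 0 < d & forall s q, t <= s <= t + d ->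
    r <= q <= r + d -> slab Tmax (s, q) -> M < `|v s q|.
  have := cv _ hs; move=> /(@cvg_norm _ _ _ _ _)/cvgr_gt => /(_ _ hlt).
  rewrite /within /= => -[[A B] [/= /nbhs_ballP[d1 /= d10 h1]
    /nbhs_ballP[d2 /= d20 h2]] hAB].
  pose d := Num.min (d1 / 2) (d2 / 2).
  have dd1 : d <= d1 / 2 by rewrite ge_min lexx.
  have dd2 : d <= d2 / 2 by rewrite ge_min lexx orbT.
  exists d; first by rewrite lt_min; apply/andP; split; lra.
  move=> s q /andP[s1 s2] /andP[q1 q2] ssq.
  apply: (hAB (s, q)) => //; split => /=.
    by apply: h1; rewrite /ball /= distrC ger0_norm; lra.
  by apply: h2; rewrite /ball /= distrC ger0_norm; lra.
have [e e0 [eT hTm]] : exists2 e, 0 < e & t + e <= T /\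
    forall s, s <= t + e -> (s%:E < Tmax)%E.
  case: Tmax tTm {hN hd hs cv} => [Tm| |] //=.
    rewrite lte_fin => tTm.
    exists (Num.min ((T - t) / 2) ((Tm - t) / 2)).
      by rewrite lt_min; apply/andP; split; lra.
    have h1 : Num.min ((T - t) / 2) ((Tm - t) / 2) <= (T - t) / 2.
      by rewrite ge_min lexx.
    have h2 : Num.min ((T - t) / 2) ((Tm - t) / 2) <= (Tm - t) / 2.
      by rewrite ge_min lexx orbT.
    split; first lra.
    by move=> s hs; rewrite lte_fin; lra.
  move=> _; exists (T - t); first by lra.
  by split; [lra|move=> s _; exact: ltry].
pose k := Num.min d e.
have k0 : 0 < k by rewrite lt_min d0.
have kd : k <= d by rewrite ge_min lexx.
have ke : k <= e by rewrite ge_min lexx orbT.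
pose mu := (@lebesgue_measure R \x @lebesgue_measure R)%E.
pose Q : set (R * R) := `[t, t + k] `*` `[r, r + k].
have muQ : (0 < mu Q)%E.
  rewrite /mu /Q product_measure1E//= !lebesgue_measure_itv /= !lte_fin.
  rewrite !ltrDl k0 -!EFinB -EFinM lte_fin.
  by rewrite mulr_gt0// addrAC subrr add0r.
have mQ : measurable Q by apply: measurableX.
(* The norm is defined by cases, being the essential supremum only if the total measure is
   positive. *)
have muT : (0 < mu setT)%E.
  by apply: (lt_le_trans muQ); apply: le_measure; rewrite ?inE//; exact: subsetT.
move: hN; rewrite /Linf_norm_slab unlock -/mu muT.
move=> /ess_supP[N [mN N0 hN]].
have : (mu Q <= mu N)%E.
  apply: le_measure; rewrite ?inE// => -[s q] [/= hsq hqq].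
  rewrite in_itv /= in hsq; rewrite in_itv /= in hqq.
  have /andP[s1 s2] := hsq; have /andP[q1 q2] := hqq.
  apply: hN => /=; apply/negP; rewrite -ltNge lte_fin /patch.
  have ssq : slab Tmax (s, q).
    by split => /=; [lra|apply: hTm; lra|lra].
  rewrite mem_set /=; last by split => //=; lra.
  by apply: hd => //; apply/andP; split; lra.
have -> : mu N = 0 by exact: N0.
by rewrite leNgt muQ.
Qed.

(** * Picard iteration *)

Section primitive.
Context {R : realType}.
Notation mu := (@lebesgue_measure R).

(** For [t < 0] the interval is empty and the value is 0, so the function is continuous on the whole
    line when [f] is continuous and bounded. *)
Definition primitive (f : R -> R) (t : R) : R :=
  \int[mu]_(s in `[0, t]) f s.

Lemma continuous_integrable_itv (f : R -> R) (t : R) :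
  continuous f -> mu.-integrable `[0, t] (EFin \o f).
Proof.
move=> cf; apply: continuous_compact_integrable; first exact: segment_compact.
exact: continuous_subspaceT.
Qed.

Lemma primitive0 (f : R -> R) : primitive f 0 = 0.
Proof. by rewrite /primitive set_itv1 Rintegral_set1. Qed.

Lemma primitive_max (f : R -> R) (t : R) : primitive f t = primitive f (Num.max 0 t).
Proof.
have [//|t0] := leP 0 t.
by rewrite primitive0 /primitive set_itv_ge ?Rintegral_set0// -leNgt bnd_simp.
Qed.

Lemma is_derive_primitive (f : R -> R) (t : R) : continuous f -> 0 < t ->
  is_derive t 1 (primitive f) (f t).
Proof.
move=> cf t0.
have [||h1 h2] := @continuous_FTC1_closed R f 0 t (t + 1) _ _ t0 (cf t).
- by rewrite ltrDl.
- exact: continuous_integrable_itv.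
by split; [exact: h1|rewrite -derive1E].
Qed.

Lemma primitive_lipschitz (f : R -> R) (B t t' : R) : continuous f -> (forall s, `|f s| <= B) ->
  `|primitive f t - primitive f t'| <= B * `|t - t'|.
Proof.
move=> cf fB.
have B0 : 0 <= B by apply: le_trans (fB 0).
have key u v : 0 <= u -> u <= v -> `|primitive f v - primitive f u| <= B * (v - u).
  move=> u0; rewrite le_eqVlt => /predU1P[->|uv].
    by rewrite !subrr normr0 mulr0.
  have hd x : x \in `]u, v[%R -> is_derive x 1 (primitive f) (f x).
    rewrite in_itv /= => /andP[ux _]; apply: is_derive_primitive => //.
    exact: le_lt_trans ux.
  have [|x _ ->] := MVT uv hd.
    have := @parameterized_integral_continuous R 0 v f (le_trans u0 (ltW uv))
      (continuous_integrable_itv _ cf).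
    apply: continuous_subspaceW => x /=; rewrite !in_itv /= => /andP[ux ->].
    by rewrite (le_trans u0 ux).
  rewrite normrM (@ger0_norm _ (v - u)) ?subr_ge0 ?(ltW uv)//.
  by rewrite ler_wpM2r ?subr_ge0 ?(ltW uv).
have key2 u v : 0 <= u -> 0 <= v ->
    `|primitive f v - primitive f u| <= B * `|v - u|.
  move=> u0 v0; have [uv|/ltW vu] := leP u v.
    by rewrite (ger0_norm (_ : 0 <= v - u)) ?subr_ge0// key.
  by rewrite distrC [`|v - u|]distrC (ger0_norm (_ : 0 <= u - v)) ?subr_ge0// key.
rewrite (primitive_max f t) (primitive_max f t').
apply: le_trans (key2 _ _ _ _) _; rewrite ?le_max ?lexx// ler_wpM2l//.
have [t0|t0] := leP 0 t; have [s0|s0] := leP 0 t'; rewrite ?subrr ?normr0//.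
  by rewrite subr0 !ger0_norm; lra.
by rewrite sub0r normrN ger0_norm// ltr0_norm; lra.
Qed.

Lemma continuous_primitive (f : R -> R) (B : R) : continuous f -> (forall s, `|f s| <= B) ->
  continuous (primitive f).
Proof.
move=> cf fB t; apply/cvgrPdist_le => e e0.
have B0 : 0 <= B by apply: le_trans (fB 0).
have d0 : 0 < e / (B + 1) by rewrite divr_gt0// ltr_wpDl.
have n1 : \forall s \near t, `|t - s| < e / (B + 1).
  have h : s @[s --> t] --> t by exact: cvg_id.
  by move/cvgrPdist_lt : h; apply.
near=> s.
apply: le_trans (primitive_lipschitz _ _ cf fB) _.
have : `|t - s| < e / (B + 1) by near: s.
by rewrite ltr_pdivlMr ?ltr_wpDl// => h; have := normr_ge0 (t - s); nra.
Unshelve. all: by end_near. Qed.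

Lemma continuous_primitive_param (G : R -> R -> R) (B t : R) :
  continuous (fun z : R * R => G z.1 z.2) -> (forall xi s, `|G xi s| <= B) ->
  continuous (fun xi => primitive (G xi) t).
Proof.
move=> cG GB xi.
have c1 x : continuous (G x).
  have -> : G x = (fun z : R * R => G z.1 z.2) \o (fun s => (x, s)) by [].
  move=> s; apply: continuous_comp; last exact: cG.
  by apply: continuous_pair => {}s; [exact: cvg_cst|exact: cvg_id].
have c2 s : continuous (G ^~ s).
  have -> : G ^~ s = (fun z : R * R => G z.1 z.2) \o (fun x => (x, s)) by [].
  move=> x; apply: continuous_comp; last exact: cG.
  by apply: continuous_pair => {}x; [exact: cvg_id|exact: cvg_cst].
have := @continuity_under_integral R _ _ mu G `[0, t] _ (xi - 1) (xi + 1) _ _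
  (cst B).
apply.
- exact: measurable_itv.
- by move=> x _; exact: continuous_integrable_itv.
- by apply: aeW => s _ x _; exact: c2.
- by apply: continuous_integrable_itv => s; exact: cvg_cst.
- by move=> x _; apply: aeW => s _; exact: GB.
- by rewrite inE /= in_itv /=; apply/andP; split; lra.
Qed.

Lemma continuous_primitive2 (G : R -> R -> R) (B : R) :
  continuous (fun z : R * R => G z.1 z.2) -> (forall xi s, `|G xi s| <= B) ->
  continuous (fun z : R * R => primitive (G z.2) z.1).
Proof.
move=> cG GB [t xi]; apply/cvgrPdist_lt => e e0.
have B0 : 0 <= B by apply: le_trans (GB 0 0).
have c1 x : continuous (G x).
  have -> : G x = (fun z : R * R => G z.1 z.2) \o (fun s => (x, s)) by [].
  move=> s; apply: continuous_comp; last exact: cG.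
  by apply: continuous_pair => {}s; [exact: cvg_cst|exact: cvg_id].
have e20 : 0 < e / 2 by lra.
have d0 : 0 < e / 2 / (B + 1) by rewrite divr_gt0// ltr_wpDl.
have n1 : \forall z \near (t, xi), `|t - z.1| < e / 2 / (B + 1).
  have h : z.1 @[z --> (t, xi)] --> t by exact: cvg_fst.
  by move/cvgrPdist_lt : h; apply.
have n2 : \forall z \near (t, xi),
    `|primitive (G xi) t - primitive (G z.2) t| < e / 2.
  have h : primitive (G z.2) t @[z --> (t, xi)] --> primitive (G xi) t.
    have -> : (fun z : R * R => primitive (G z.2) t) =
      (fun x => primitive (G x) t) \o snd by [].
    apply: (@continuous_comp _ _ _ snd); first exact: cvg_snd.
    exact: (continuous_primitive_param cG GB).
  by move/cvgrPdist_lt : h; apply.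
near=> z => /=.
have h1 : `|t - z.1| < e / 2 / (B + 1) by near: z.
have h2 : `|primitive (G xi) t - primitive (G z.2) t| < e / 2 by near: z.
have h3 := primitive_lipschitz t z.1 (c1 z.2) (GB z.2).
rewrite ltr_pdivlMr ?ltr_wpDl// in h1.
have h4 := ler_distD (primitive (G z.2) t) (primitive (G xi) t) (primitive (G z.2) z.1).
have := normr_ge0 (t - z.1); nra.
Unshelve. all: by end_near. Qed.

End primitive.

(** With [q n = C / 2 ^+ n] the intervals [[u n - 2 q n, u n + 2 q n]] are nested, [2 q n] being the
    tail of the geometric series; the supremum of their left ends is the limit, with the explicit
    error. *)
Lemma geometric_limit (R : realType) (u : nat -> R) (C : R) :
  (forall n, `|u n.+1 - u n| <= C / 2 ^+ n) ->
  exists l, forall n, `|l - u n| <= 2 * C / 2 ^+ n.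
Proof.
move=> hu.
pose q n : R := C / 2 ^+ n.
have q2 n : q n.+1 = q n / 2 by rewrite /q exprS invfM [2^-1 * _]mulrC mulrA.
have q0 n : 0 <= q n by apply: le_trans (hu n).
have hu2 n : q n.+1 * 2 = q n by rewrite q2; lra.
pose lo n := u n - 2 * q n; pose hi n := u n + 2 * q n.
have inc m n : (m <= n)%N -> lo m <= lo n.
  elim: n => [|n IH]; first by rewrite leqn0 => /eqP ->.
  rewrite leq_eqVlt => /predU1P[->//|/IH h]; apply: (le_trans h).
  by have := hu n; rewrite -/(q n) ler_norml => /andP[]; rewrite /lo; have := hu2 n; lra.
have dec m n : (m <= n)%N -> hi n <= hi m.
  elim: n => [|n IH]; first by rewrite leqn0 => /eqP ->.
  rewrite leq_eqVlt => /predU1P[->//|/IH h]; apply: le_trans h.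
  by have := hu n; rewrite -/(q n) ler_norml => /andP[]; rewrite /hi; have := hu2 n; lra.
have lohi m n : lo m <= hi n.
  apply: (le_trans (inc m (maxn m n) (leq_maxl _ _))).
  apply: le_trans (dec n (maxn m n) (leq_maxr _ _)).
  by rewrite /lo /hi; have := q0 (maxn m n); lra.
have hs : has_sup (range lo).
  split; first by exists (lo 0%N); exists 0%N.
  by exists (hi 0%N) => _ [m _ <-].
exists (sup (range lo)) => n.
have h1 : lo n <= sup (range lo).
  by apply: ub_le_sup; [case: hs|exists n].
have h2 : sup (range lo) <= hi n.
  by apply: ge_sup; [case: hs|move=> _ [m _ <-]].
rewrite -mulrA -/(q n) ler_norml; move: h1 h2; rewrite /lo /hi => h1 h2.
by apply/andP; split; lra.
Qed.

Section picard.
Context {R : realType} (F : R -> R -> R) (w0 : R -> R) (L B : R).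
Context (cF : continuous (fun z : R * R => F z.1 z.2))
  (hL : forall x y y', `|F x y - F x y'| <= L * `|y - y'|)
  (hB : forall x y, `|F x y| <= B) (cw0 : continuous w0).

Implicit Types (w v : R -> R -> R) (xi t x s y C e : R).

Definition picard_rhs (w : R -> R -> R) (xi s : R) : R :=
  F (xi - s) (w s (xi - s) - w s (- (xi - s))).

(** Duhamel's formula along the ray on which [x + t] is constant. *)
Definition picard_map (w : R -> R -> R) (t x : R) : R :=
  w0 (x + t) + primitive (picard_rhs w (x + t)) t.

Let joint (w : R -> R -> R) := continuous (fun z : R * R => w z.1 z.2).

Lemma continuous_picard_rhs w : joint w -> joint (picard_rhs w).
Proof.
move=> cw.
have c1 : continuous (fun z : R * R => z.1 - z.2).
  by move=> z; apply: cvgB; [exact: cvg_fst|exact: cvg_snd].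
have c2 : continuous (fun z : R * R => - (z.1 - z.2)).
  by move=> z; apply: cvgN; exact: c1.
have cs : continuous (fun z : R * R => z.2) by move=> z; exact: cvg_snd.
have comp (f : R -> R -> R) (g h : R * R -> R) : joint f -> continuous g ->
    continuous h -> continuous (fun z => f (g z) (h z)).
  move=> cf cg ch z.
  apply: (@continuous_comp _ _ _ (fun z => (g z, h z)) (fun z : R * R => f z.1 z.2)).
    exact: continuous_pair.
  exact: cf.
apply: (comp F _ _ cF c1) => z.
by apply: cvgB; apply: comp.
Qed.

Lemma continuous_picard_map w : joint w -> joint (picard_map w).
Proof.
move=> cw.
have c1 : continuous (fun z : R * R => z.2 + z.1).
  by move=> z; apply: cvgD; [exact: cvg_snd|exact: cvg_fst].
have c2 := continuous_primitive2 (continuous_picard_rhs cw)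
  (fun xi s => hB (xi - s) (w s (xi - s) - w s (- (xi - s)))).
move=> z; apply: cvgD.
  by apply: (@continuous_comp _ _ _ (fun z : R * R => z.2 + z.1) w0);
    [exact: c1|exact: cw0].
apply: (@continuous_comp _ _ _ (fun z : R * R => (z.1, z.2 + z.1))
  (fun z : R * R => primitive (picard_rhs w z.2) z.1)); last exact: c2.
by apply: continuous_pair => {}z; [exact: cvg_fst|exact: c1].
Qed.

Let rhs_cont w xi : joint w -> continuous (picard_rhs w xi).
Proof.
move=> /continuous_picard_rhs cw s.
apply: (@continuous_comp _ _ _ (fun s => (xi, s))
  (fun z : R * R => picard_rhs w z.1 z.2)); last exact: cw.
by apply: continuous_pair => {}s; [exact: cvg_cst|exact: cvg_id].
Qed.

Lemma is_derive_primitive_rhs w xi t : joint w -> 0 < t ->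
  is_derive t 1 (primitive (picard_rhs w xi)) (picard_rhs w xi t).
Proof. by move=> cw; apply: is_derive_primitive; exact: rhs_cont. Qed.

(** The two values of [w] in the source give the Lipschitz constant [2 L], and integrating
    [e^(kp s)] gains [1 / kp], so the contraction factor is [2 L / kp <= 1 / 2]. The [+ 1] ensures
    [kp >= 1], used for the first iterate. *)
Let kp := 4 * L + 1.

Context (L0 : 0 <= L).

Let B0 : 0 <= B.
Proof. by apply: le_trans (hB 0 0). Qed.

(* [picard_map] halves the distance [sup e^(-kp t) |w - v|]. *)
Lemma picard_map_contract w v C : joint w -> joint v ->
  (forall s y, 0 <= s -> `|w s y - v s y| <= C * expR (kp * s)) ->
  forall t x, 0 <= t -> `|picard_map w t x - picard_map v t x| <= C / 2 * expR (kp * t).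
Proof.
move=> cw cv hC t x t0; rewrite /picard_map; set xi := x + t.
have kp0 : 0 < kp by rewrite /kp; have := L0; lra.
have C0 : 0 <= C.
  by have := hC 0 0 (lexx _); rewrite mulr0 expR0 mulr1; apply: le_trans.
rewrite opprD addrACA subrr add0r.
have bnd s : 0 < s -> `|picard_rhs w xi s - picard_rhs v xi s| <=
    2 * L * C * expR (kp * s).
  move=> s0; apply: (le_trans (hL _ _ _)).
  have h1 := hC s (xi - s) (ltW s0); have h2 := hC s (- (xi - s)) (ltW s0).
  have -> : w s (xi - s) - w s (- (xi - s)) - (v s (xi - s) - v s (- (xi - s))) =
    (w s (xi - s) - v s (xi - s)) - (w s (- (xi - s)) - v s (- (xi - s))) by ring.
  have h3 := ler_normB (w s (xi - s) - v s (xi - s))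
    (w s (- (xi - s)) - v s (- (xi - s))).
  have -> : 2 * L * C * expR (kp * s) = L * (2 * (C * expR (kp * s))) by ring.
  by apply: ler_wpM2l => //; lra.
have dE s : is_derive s 1 (fun s => C / 2 * expR (kp * s))
    (C / 2 * (kp * expR (kp * s))).
  have hl : is_derive s 1 (fun u : R => kp * u) kp.
    have -> : (fun u : R => kp * u) = kp \*: id by [].
    by apply: is_derive_eq; rewrite /GRing.scale /= mulr1.
  have hE : is_derive s 1 (expR \o (fun u : R => kp * u)) (expR (kp * s) * kp).
    exact: is_derive1_comp.
  have -> : (fun s => C / 2 * expR (kp * s)) =
    (C / 2) \*: (expR \o (fun u : R => kp * u)) by [].
  by apply: is_derive_eq; rewrite /GRing.scale /= [_ * kp]mulrC.
have cE : continuous (fun s => C / 2 * expR (kp * s)).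
  move=> s; apply: cvgM; first exact: cvg_cst.
  apply: (@continuous_comp _ _ _ (fun s : R => kp * s) (@expR R)).
    by apply: cvgM; [exact: cvg_cst|exact: cvg_id].
  exact: continuous_expR.
have cp u : joint u -> continuous (primitive (picard_rhs u xi)).
  move=> cu; apply: (@continuous_primitive _ _ B); first exact: rhs_cont.
  by move=> s; exact: hB.
have one (u1 u2 : R -> R -> R) : joint u1 -> joint u2 ->
    (forall s, 0 < s -> picard_rhs u1 xi s - picard_rhs u2 xi s <=
      2 * L * C * expR (kp * s)) ->
    primitive (picard_rhs u1 xi) t - primitive (picard_rhs u2 xi) t <=
      C / 2 * expR (kp * t).
  move=> c1 c2 h.
  pose y s := primitive (picard_rhs u1 xi) s - primitive (picard_rhs u2 xi) s
    - C / 2 * expR (kp * s).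
  have hd s : 0 < s < t -> is_derive s 1 y (picard_rhs u1 xi s -
      picard_rhs u2 xi s - C / 2 * (kp * expR (kp * s))).
    move=> /andP[s0 _].
    have d1 := is_derive_primitive_rhs xi c1 s0.
    have d2 := is_derive_primitive_rhs xi c2 s0.
    have d3 := dE s.
    exact: (is_deriveB (is_deriveB d1 d2) d3).
  have : y t - y 0 <= 0 * (t - 0).
    apply: (le_increment t0 _ hd).
      move=> s; apply: cvgB; last exact: cE.
      by apply: cvgB; [exact: cp|exact: cp].
    move=> s /andP[s0 _].
    have := h s s0.
    have : 0 <= C * expR (kp * s) by rewrite mulr_ge0 ?expR_ge0.
    rewrite /kp; set E := expR _; nra.
  by rewrite /y !primitive0 mulr0 expR0; lra.
rewrite ler_norml; apply/andP; split.
  rewrite lerNl opprB; apply: one => // s s0; rewrite -opprB.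
  by have := bnd s s0; rewrite ler_norml => /andP[]; lra.
apply: one => // s s0.
by have := bnd s s0; rewrite ler_norml => /andP[]; lra.
Qed.

Fixpoint picard_seq (n : nat) : R -> R -> R :=
  if n is m.+1 then picard_map (picard_seq m) else fun t x => w0 (x + t).

Lemma continuous_picard_seq n : joint (picard_seq n).
Proof.
elim: n => [|n IH] /=; last exact: continuous_picard_map.
move=> z; apply: (@continuous_comp _ _ _ (fun z : R * R => z.2 + z.1) w0);
  last exact: cw0.
by apply: cvgD; [exact: cvg_snd|exact: cvg_fst].
Qed.

Lemma picard_seq_step n t x : 0 <= t ->
  `|picard_seq n.+1 t x - picard_seq n t x| <= B / 2 ^+ n * expR (kp * t).
Proof.
elim: n t x => [|n IH] t x t0.
  rewrite expr0 divr1 /= /picard_map addrAC subrr add0r.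
  rewrite -[X in `|X|]subr0 -(@primitive0 _ (picard_rhs (picard_seq 0) (x + t))).
  apply: (le_trans (@primitive_lipschitz _ _ B _ _ _ _)) => [|s|].
  - by apply: rhs_cont; exact: (@continuous_picard_seq 0).
  - exact: hB.
  rewrite ler_wpM2l// subr0 ger0_norm//.
  apply: le_trans (expR_ge1Dx _); rewrite /kp; have := L0; nra.
have := picard_map_contract (@continuous_picard_seq n.+1) (@continuous_picard_seq n)
  IH x t0.
suff -> : B / 2 ^+ n.+1 = B / 2 ^+ n / 2 by [].
by rewrite exprS invfM; ring.
Qed.

Lemma picard_solution : exists w : R -> R -> R,
  [/\ joint w, forall x, w 0 x = w0 x &
    forall t x, 0 < t -> is_derive t 1 (fun s => w s (x + t - s))
      (F x (w t x - w t (- x)))].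
Proof.
(* For [t <= 0] all iterates equal [w0 (x + t)]; with the maximum the error bound holds on the whole
   plane, so the limit is continuous there. *)
pose E t := expR (kp * Num.max 0 t).
have kp0 : 0 < kp by rewrite /kp; have := L0; lra.
have step n t x : `|picard_seq n.+1 t x - picard_seq n t x| <= B * E t / 2 ^+ n.
  have [t0|t0] := leP 0 t.
    rewrite mulrAC; apply: (le_trans (picard_seq_step n x t0)).
    by rewrite /E max_r.
  have neg m : picard_seq m t x = w0 (x + t).
    case: m => [//|m] /=; rewrite /picard_map primitive_max max_l ?(ltW t0)//.
    by rewrite primitive0 addr0.
  by rewrite !neg subrr normr0 !mulr_ge0 ?expR_ge0 ?invr_ge0 ?exprn_ge0.
have /choice[W hW] : forall z : R * R, exists l : R, forall n,
    `|l - picard_seq n z.1 z.2| <= 2 * (B * E z.1) / 2 ^+ n.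
  by move=> z; apply: geometric_limit => n; exact: step.
pose w t x := W (t, x).
have hw n t x : `|w t x - picard_seq n t x| <= 2 * (B * E t) / 2 ^+ n.
  exact: hW (t, x) n.
have small C e : 0 <= C -> 0 < e -> exists n, C / 2 ^+ n < e.
  move=> C0 e0; have hc : 0 < e / (C + 1) by rewrite divr_gt0// ltr_wpDl.
  have : (2 : R)^-1 ^+ n @[n --> \oo] --> (0 : R).
    by apply: cvg_expr; rewrite ger0_norm ?invr_ge0//; lra.
  move/cvgrPdist_lt => /(_ _ hc)[N _ /(_ N (leqnn _))].
  rewrite /= sub0r normrN ger0_norm ?exprn_ge0 ?invr_ge0// => h; exists N.
  rewrite ltr_pdivlMr ?ltr_wpDl// exprVn in h.
  apply: le_lt_trans h; rewrite mulrC ler_wpM2l ?invr_ge0 ?exprn_ge0//; lra.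
have cw : joint w.
  move=> [t x]; apply/cvgrPdist_lt => e e0.
  pose C := 2 * (B * E (t + 1)).
  have C0 : 0 <= C by rewrite !mulr_ge0 ?expR_ge0.
  have e30 : 0 < e / 3 by lra.
  have [n hn] := small C _ C0 e30.
  have hC s y : s <= t + 1 -> `|w s y - picard_seq n s y| < e / 3.
    move=> st; apply: le_lt_trans hn; apply: (le_trans (hw n s y)).
    rewrite ler_wpM2r ?invr_ge0 ?exprn_ge0// ler_wpM2l// ler_wpM2l//.
    rewrite /E ler_expR ler_pM2l// ge_max !le_max lexx /=.
    by rewrite st orbT.
  have n1 : \forall z \near (t, x), z.1 < t + 1.
    have h : z.1 @[z --> (t, x)] --> t by exact: cvg_fst.
    by apply: (cvgr_lt _ h); rewrite ltrDl.
  have n2 : \forall z \near (t, x),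
      `|picard_seq n t x - picard_seq n z.1 z.2| < e / 3.
    have h := @continuous_picard_seq n (t, x).
    by move/cvgrPdist_lt : h; apply.
  near=> z => /=.
  have h1 : z.1 < t + 1 by near: z.
  have h2 : `|picard_seq n t x - picard_seq n z.1 z.2| < e / 3 by near: z.
  have h3 := hC z.1 z.2 (ltW h1).
  have h4 : `|w t x - picard_seq n t x| < e / 3 by apply: hC; lra.
  move: h2 h3 h4; rewrite !ltr_norml => /andP[? ?] /andP[? ?] /andP[? ?].
  by apply/andP; split; lra.
have fixp t x : 0 <= t -> w t x = picard_map w t x.
  move=> t0; apply/eqP; rewrite -subr_eq0 -normr_le0; apply/ler_addgt0Pr => e e0.
  rewrite add0r.
  have C0 : 0 <= 2 * (B * E t) by rewrite !mulr_ge0 ?expR_ge0.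
  have e20 : 0 < e / 2 by lra.
  have [n hn] := small _ _ C0 e20.
  have hc s y : 0 <= s ->
      `|picard_seq n s y - w s y| <= 2 * B / 2 ^+ n * expR (kp * s).
    move=> s0; rewrite distrC; apply: (le_trans (hw n s y)).
    by rewrite /E max_r// mulrA mulrAC.
  have h1 := picard_map_contract (@continuous_picard_seq n) cw hc x t0.
  have h2 := hw n.+1 t x.
  have EE : E t = expR (kp * t) by rewrite /E max_r.
  rewrite -EE in h1.
  have D0 : 0 <= 2 * (B * E t) / 2 ^+ n by rewrite mulr_ge0// invr_ge0 exprn_ge0.
  have h1' : 2 * B / 2 ^+ n / 2 * E t = 2 * (B * E t) / 2 ^+ n / 2 by ring.
  have h2' : 2 * (B * E t) / 2 ^+ n.+1 = 2 * (B * E t) / 2 ^+ n / 2.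
    by rewrite exprS invfM; ring.
  rewrite h1' in h1; rewrite h2' in h2.
  move: h1 h2; rewrite /= !ler_norml => /andP[? ?] /andP[? ?].
  by apply/andP; split; lra.
exists w; split=> // [x|t x t0].
  by rewrite fixp// /picard_map primitive0 !addr0.
have hd := is_derive_primitive_rhs (x + t) cw t0.
have -> : F x (w t x - w t (- x)) = picard_rhs w (x + t) t.
  by rewrite /picard_rhs addrK.
have hd2 : is_derive t 1 (fun s => w0 (x + t) + primitive (picard_rhs w (x + t)) s)
    (picard_rhs w (x + t) t).
  have -> : (fun s => w0 (x + t) + primitive (picard_rhs w (x + t)) s) =
    cst (w0 (x + t)) + primitive (picard_rhs w (x + t)) by [].
  by apply: is_derive_eq; rewrite add0r.
apply: near_eq_is_derive hd2.
have : \forall s \near t, 0 < s by exact: lt_nbhsr.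
apply: filterS => s s0.
by rewrite (fixp s _ (ltW s0)) /picard_map subrK.
Unshelve. all: by end_near. Qed.

End picard.

(** * The accretive case *)

Lemma continuous_powR_gt0 (R : realType) (q x : R) : 0 < x ->
  {for x, continuous (@powR R ^~ q)}.
Proof.
move=> x0; apply: differentiable_continuous; apply/derivable1_diffP.
by have [] := is_derive1_powR q x0.
Qed.

Lemma powR_lipschitz (R : realType) (p B u v : R) : 1 < p ->
  0 <= u -> u <= v -> v <= B -> v `^ p - u `^ p <= p * B `^ (p - 1) * (v - u).
Proof.
move=> p1 u0 uv vB; have p0 : 0 < p by lra.
move: uv; rewrite le_eqVlt => /predU1P[->|uv]; first by rewrite !subrr mulr0.
have v0 : 0 < v by exact: le_lt_trans uv.
have BB c : 0 <= c -> c <= v -> c `^ (p - 1) <= B `^ (p - 1).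
  by move=> c0 cv; apply: ge0_ler_powR; rewrite ?nnegrE; lra.
move: u0; rewrite le_eqVlt => /predU1P[<-|u0].
  rewrite powR0 ?gt_eqF// !subr0 -mulr_powRB1 ?(ltW v0)// mulrC ler_wpM2r ?(ltW v0)//.
  apply: (le_trans (BB v (ltW v0) (lexx _))).
  by rewrite ler_peMl ?powR_ge0// ltW.
have hd x : x \in `]u, v[%R -> is_derive x 1 (@powR R ^~ p) (p * x `^ (p - 1)).
  rewrite in_itv /= => /andP[ux _]; apply: is_derive1_powR.
  exact: lt_trans ux.
have [|x] := MVT uv hd.
  apply: continuous_in_subspaceT => x; rewrite inE /= in_itv /= => /andP[ux _].
  by apply: continuous_powR_gt0; exact: lt_le_trans ux.
rewrite in_itv /= => /andP[ux xv] ->.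
rewrite ler_wpM2r ?subr_ge0 ?(ltW uv)// ler_wpM2l ?(ltW p0)// BB//; lra.
Qed.

(** [|y|^(p-1) y] is odd and equals [y^p] for [y >= 0], so the bound on [[0, B]] suffices; arguments
    of opposite signs are joined through 0. *)
Lemma g_nl_lipschitz (R : realType) (a p B u v : R) : 1 < p ->
  `|u| <= B -> `|v| <= B ->
  `|g_nl a p u - g_nl a p v| <=
    `|a| * 2 `^ (- p) * (p * B `^ (p - 1)) * `|u - v|.
Proof.
move=> p1; set A := p * B `^ (p - 1).
have p0 : 0 < p by lra.
pose h y : R := `|y| `^ (p - 1) * y.
have hE y : 0 <= y -> h y = y `^ p.
  by move=> y0; rewrite /h ger0_norm// mulrC mulr_powRB1.
have hN y : h (- y) = - h y by rewrite /h normrN mulrN.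
have h0 y : 0 <= y -> 0 <= h y by move=> y0; rewrite hE// powR_ge0.
have up x y : 0 <= x -> x <= y -> y <= B -> 0 <= h y - h x <= A * (y - x).
  move=> x0 xy yB; have y0 : 0 <= y by exact: le_trans xy.
  rewrite !hE// powR_lipschitz// andbT subr_ge0.
  by apply: ge0_ler_powR; rewrite ?nnegrE//; lra.
have h00 : h 0 = 0 by rewrite /h mulr0.
have key x y : `|x| <= B -> `|y| <= B -> x <= y -> 0 <= h y - h x <= A * (y - x).
  rewrite !ler_norml => /andP[x1 x2] /andP[y1 y2] xy.
  have [x0|x0] := leP 0 x; first exact: up.
  have nx0 : 0 <= - x by lra.
  have [y0|y0] := leP 0 y.
    have := up 0 y (lexx _) y0 y2; have := up 0 (- x) (lexx _) nx0.
    rewrite hN h00 !subr0 => /(_ _)/andP[|u1 u2]; first lra.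
    by move=> /andP[u3 u4]; apply/andP; split; lra.
  have ny0 : 0 <= - y by lra.
  have := up (- y) (- x) ny0; rewrite !hN => /(_ _ _)/andP[||u1 u2]; [lra|lra|].
  by apply/andP; split; lra.
move=> uB vB.
have hh : `|h u - h v| <= A * `|u - v|.
  have [uv|vu] := leP u v.
    rewrite distrC [`|u - v|]distrC; have /andP[h1 h2] := key u v uB vB uv.
    by rewrite ger0_norm// ger0_norm// subr_ge0.
  have /andP[h1 h2] := key v u vB uB (ltW vu).
  by rewrite ger0_norm// ger0_norm// subr_ge0 ltW.
have -> : g_nl a p u - g_nl a p v = - a * 2 `^ (- p) * (h u - h v).
  by rewrite /g_nl /h; ring.
rewrite normrM normrM normrN (ger0_norm (powR_ge0 _ _)) -[leRHS]mulrA.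
by rewrite ler_wpM2l// mulr_ge0 ?powR_ge0.
Qed.

(** * Truncation of the source *)

Definition cutoff (R : realType) (B y : R) : R := Num.max (- B) (Num.min y B).

Lemma cutoff_id (R : realType) (B y : R) : `|y| <= B -> cutoff B y = y.
Proof. by rewrite ler_norml /cutoff => /andP[h1 h2]; rewrite min_l// max_r. Qed.

Lemma normr_cutoff (R : realType) (B y : R) : 0 <= B -> `|cutoff B y| <= B.
Proof.
move=> B0; rewrite ler_norml /cutoff le_max lexx /= ge_max ge_min lexx orbT andbT.
lra.
Qed.

Lemma cutoff_lipschitz (R : realType) (B y y' : R) : 0 <= B ->
  `|cutoff B y - cutoff B y'| <= `|y - y'|.
Proof.
move=> B0.
have maxl u v c : `|Num.max c u - Num.max c v| <= `|u - v| :> R.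
  have := ler_norm (u - v); have := lerNnormlW (lexx `|u - v|) => h1 h2.
  by rewrite ler_norml; case: (leP c u) => ?; case: (leP c v) => ?;
    apply/andP; split; lra.
have minl u v c : `|Num.min u c - Num.min v c| <= `|u - v| :> R.
  have := ler_norm (u - v); have := lerNnormlW (lexx `|u - v|) => h1 h2.
  by rewrite ler_norml; case: (leP u c) => ?; case: (leP v c) => ?;
    apply/andP; split; lra.
exact: le_trans (maxl _ _ _) (minl _ _ _).
Qed.

(** Replacing [|x|] by its maximum with [rho] removes the singularity, and cutting off [y] makes
    [g_nl] bounded and Lipschitz: these are the global hypotheses of the Picard iteration. *)
Definition truncated_source (R : realType) (p alpha a eps rho B x y : R) : R :=
  source p alpha a eps (Num.max `|x| rho) (cutoff B y).

Section truncated.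
Context {R : realType} (p alpha a eps rho B : R).
Context (p1 : 1 < p) (rho0 : 0 < rho) (B0 : 0 <= B).

Let S := truncated_source p alpha a eps rho B.
Let K := eps `^ alpha * rho `^ (1 - p) * (`|a| * 2 `^ (- p)).

Lemma truncated_source_id x y : `|y| <= B -> (`|x| < rho -> y = 0) ->
  S x y = source p alpha a eps x y.
Proof.
move=> yB hy; rewrite /S /truncated_source cutoff_id//.
have [xr|xr] := ltP `|x| rho; first by rewrite hy// /source g_nl0 !mulr0.
by rewrite /source normr_id.
Qed.

Implicit Types x y : R.

Let rho_le (x : R) : rho <= `| Num.max `|x| rho |.
Proof. by rewrite ger0_norm le_max ?normr_ge0// lexx orbT. Qed.

Lemma normr_truncated_source x y :
  `|S x y| <= eps `^ alpha * rho `^ (1 - p) * (`|a| * 2 `^ (- p) * B `^ p).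
Proof.
by apply: normr_source_le => //; exact: normr_cutoff.
Qed.

Lemma coef_le x : `| Num.max `|x| rho | `^ (1 - p) <= rho `^ (1 - p).
Proof.
have h := rho_le x.
rewrite -opprB !powRN lef_pV2 ?posrE ?powR_gt0//; last exact: lt_le_trans h.
by apply: ge0_ler_powR; rewrite ?nnegrE ?(ltW rho0)// subr_ge0 ltW.
Qed.

Lemma truncated_source_lipschitz x y y' :
  `|S x y - S x y'| <= K * (p * B `^ (p - 1)) * `|y - y'|.
Proof.
rewrite /S /truncated_source /source -mulrBr normrM.
rewrite (ger0_norm (mulr_ge0 (powR_ge0 _ _) (powR_ge0 _ _))) /K -!mulrA.
rewrite ler_wpM2l ?powR_ge0//; apply: ler_pM; rewrite ?powR_ge0// ?coef_le//.
apply: (le_trans (g_nl_lipschitz a p1 (normr_cutoff y B0) (normr_cutoff y' B0))).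
rewrite -!mulrA; do 2 (apply: ler_wpM2l; rewrite ?powR_ge0//).
rewrite mulrA [leRHS]mulrA ler_wpM2l ?cutoff_lipschitz// mulr_ge0 ?powR_ge0//.
by have := p1; lra.
Qed.

Lemma continuous_truncated_source : continuous (fun z : R * R => S z.1 z.2).
Proof.
have cc : continuous (fun z : R * R => eps `^ alpha * `| Num.max `|z.1| rho | `^ (1 - p)).
  move=> z; apply: cvgM; first exact: cvg_cst.
  have h : {for z, continuous (fun z : R * R => `|Num.max `|z.1| rho|)}.
    apply: cvg_norm; apply: (@continuous_maxr R _ (fun z : R * R => `|z.1|)
      (fun _ => rho)) => {}z; last exact: cvg_cst.
    by apply: cvg_norm; exact: cvg_fst.
  apply: (@continuous_comp _ _ _ (fun z : R * R => `|Num.max `|z.1| rho|)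
    (@powR R ^~ (1 - p)) z h).
  by apply: continuous_powR_gt0; exact: lt_le_trans (rho_le _).
have cg : continuous (fun y => g_nl a p (cutoff B y)).
  move=> y; apply/cvgrPdist_le => e e0.
  pose A := `|a| * 2 `^ (- p) * (p * B `^ (p - 1)).
  have A0 : 0 <= A by rewrite !mulr_ge0 ?powR_ge0//; have := p1; lra.
  have d0 : 0 < e / (A + 1) by rewrite divr_gt0// ltr_wpDl.
  have n1 : \forall z \near y, `|y - z| < e / (A + 1).
    have h : z @[z --> y] --> y by exact: cvg_id.
    by move/cvgrPdist_lt : h; apply.
  near=> z.
  apply: (le_trans (g_nl_lipschitz a p1 (normr_cutoff y B0) (normr_cutoff z B0))).
  rewrite -/A; apply: (@le_trans _ _ (A * `|y - z|)).
    by rewrite ler_wpM2l ?cutoff_lipschitz.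
  have : `|y - z| < e / (A + 1) by near: z.
  by rewrite ltr_pdivlMr ?ltr_wpDl// => h; have := normr_ge0 (y - z); nra.
move=> z; apply: cvgM; first exact: cc.
apply: (@continuous_comp _ _ _ (fun z : R * R => z.2)
  (fun y => g_nl a p (cutoff B y))); [exact: cvg_snd|exact: cg].
Unshelve. all: by end_near. Qed.

End truncated.

(* A bounded solution that has not reached the axis agrees with the global
   solution of the truncated equation, which stays a solution of the original
   one a little longer. *)
Lemma continuation (R : realType) (p alpha a r0 : R) (U0 U1 : R -> R -> R)
    (eps Tm c M : R) (vm vp : R -> R -> R) :
  1 < p -> is_solution p alpha a r0 U0 U1 eps Tm%:E vm vp -> Tm < c ->
  (forall r, 0 <= r <= c -> vm 0 r = 0 /\ vp 0 r = 0) ->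
  (forall t r, 0 <= t < Tm -> 0 <= r -> `|vm t r| <= M /\ `|vp t r| <= M) ->
  exists Tm' vm' vp', Tm < Tm' /\
    is_solution p alpha a r0 U0 U1 eps Tm'%:E vm' vp'.
Proof.
move=> p1 sol Tc v0 vM.
have [Tm0 [_ [_ [_ [_ [hini _]]]]]] := sol; rewrite lte_fin in Tm0.
have M0 : 0 <= M.
  have h0 : 0 <= (0 : R) < Tm by rewrite lexx Tm0.
  by apply: le_trans (vM 0 0 h0 (lexx _)).1.
(* The solution vanishes for [|x| + t <= c = Tm + 2 rho], so up to the time [Tm + rho] it does not
   see the truncation [|x| < rho]. The unit added to [M] in [Bd] leaves room for growth after
   [Tm]. *)
pose rho := (c - Tm) / 2; have rho0 : 0 < rho by rewrite /rho; lra.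
pose Bd := 2 * (M + 1); have Bd0 : 0 <= Bd by rewrite /Bd; lra.
pose S := truncated_source p alpha a eps rho Bd.
pose A := eps `^ alpha * rho `^ (1 - p) * (`|a| * 2 `^ (- p)) *
  (p * Bd `^ (p - 1)).
have A0 : 0 <= A by rewrite !mulr_ge0 ?powR_ge0//; lra.
pose BF := eps `^ alpha * rho `^ (1 - p) * (`|a| * 2 `^ (- p) * Bd `^ p).
have BF0 : 0 <= BF by rewrite !mulr_ge0 ?powR_ge0.
have cS := @continuous_truncated_source R p alpha a eps rho Bd p1 rho0 Bd0.
have lS := @truncated_source_lipschitz R p alpha a eps rho Bd p1 rho0 Bd0.
have bS := @normr_truncated_source R p alpha a eps rho Bd p1 rho0 Bd0.
have unf T : 0 < T -> T < Tm -> exists2 w, unfolded_solution p alpha a eps T w &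
    forall t r, 0 <= t <= T -> 0 <= r -> w t r = vm t r /\ w t (- r) = - vp t r.
  by move=> T0 TTm; apply: (exists_unfolded p1 T0 _ sol); rewrite lte_fin.
(* Needed for its value at time 0 only: a continuous unfolded initial datum. *)
have [wi [cwi _ _] wiE] : exists2 w, unfolded_solution p alpha a eps (Tm / 2) w &
    forall t r, 0 <= t <= Tm / 2 -> 0 <= r -> w t r = vm t r /\ w t (- r) = - vp t r.
  by apply: unf; lra.
have cw0 : continuous (wi 0).
  have -> : wi 0 = (fun z : R * R => wi z.1 z.2) \o (fun x => (0, x)) by [].
  move=> x; apply: continuous_comp; last exact: cwi.
  by apply: continuous_pair => {}x; [exact: cvg_cst|exact: cvg_id].
have wi0 r : 0 <= r -> wi 0 r = vm 0 r /\ wi 0 (- r) = - vp 0 r.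
  by apply: wiE; rewrite lexx; lra.
have wic x : `|x| <= c -> wi 0 x = 0.
  move=> xc; have hx : 0 <= `|x| <= c by rewrite normr_ge0.
  have [h1 h2] := v0 _ hx; have [h3 h4] := wi0 _ (normr_ge0 x).
  have [x0|x0] := leP 0 x; first by rewrite -[x]ger0_norm// h3.
  have xE : x = - `|x| by rewrite ltr0_norm// opprK.
  by rewrite xE h4 h2 oppr0.
have [w [cw w0E dw]] := picard_solution cS lS bS cw0 A0.
rewrite -/S in dw.
have w0c x : `|x| <= c -> w 0 x = 0 by move=> xc; rewrite w0E wic.
have S0 x : S x 0 = 0.
  rewrite /S truncated_source_id ?normr0//.
  by rewrite /source g_nl0 !mulr0.
have wzero t x : 0 <= t -> `|x| + t <= c -> w t x = 0.
  move=> t0 xt.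
  apply: (@uniqueness_on _ w (fun _ _ => 0) (fun t x => S x (w t x - w t (- x)))
    (fun _ _ => 0) _ t A cw _ (cone_backward_closed t c)) => //.
  - by move=> z; exact: cvg_cst.
  - by move=> s y _ _; exact: is_derive_cst.
  - by move=> s y _ _; rewrite -{1}(S0 y) !subr0 (le_trans (lS _ _ _))// subr0.
  - by move=> y [/= _ _]; rewrite addr0; exact: w0c.
(* On [[0, t]] the unfolded solution is bounded by [M] and zero near the axis, so it also solves the
   truncated equation, for which uniqueness holds. *)
have agree t r : 0 <= t < Tm -> 0 <= r -> w t r = vm t r /\ w t (- r) = - vp t r.
  move=> /andP[t0 tT] rge0.
  have tT2 : t < (t + Tm) / 2 by lra.
  have [||u U uE] := unf ((t + Tm) / 2); [lra|lra|].
  have [cu du lu] := U.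
  have u0c x : `|x| <= c -> u 0 x = 0.
    move=> xc; have hx : 0 <= `|x| <= c by rewrite normr_ge0.
    have h0 : 0 <= (0 : R) <= (t + Tm) / 2 by rewrite lexx; lra.
    have [h1 h2] := v0 _ hx; have [h3 h4] := uE 0 _ h0 (normr_ge0 x).
    have [x0|x0] := leP 0 x; first by rewrite -[x]ger0_norm// h3.
    have xE : x = - `|x| by rewrite ltr0_norm// opprK.
    by rewrite xE h4 h2 oppr0.
  have uzero := zero_inner p1 tT2 U u0c.
  have uM s x : 0 <= s <= t -> `|u s x| <= M.
    move=> /andP[s0 st].
    have hs : 0 <= s <= (t + Tm) / 2 by rewrite s0; lra.
    have hs2 : 0 <= s < Tm by rewrite s0; lra.
    have [h3 h4] := uE s _ hs (normr_ge0 x); have [h5 h6] := vM s _ hs2 (normr_ge0 x).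
    have [x0|x0] := leP 0 x; first by rewrite -[x]ger0_norm// h3.
    have xE : x = - `|x| by rewrite ltr0_norm// opprK.
    by rewrite xE h4 normrN.
  have eqw x : w t x = u t x.
    apply: (@uniqueness_on _ w u (fun t x => S x (w t x - w t (- x)))
      (fun t x => S x (u t x - u t (- x))) _ t A cw cu
      (cone_backward_closed t (`|x| + t)) A0) => //.
    - move=> s y [/= s0 st _] sp.
      have hs : 0 <= s <= t by rewrite s0.
      have -> : S y (u s y - u s (- y)) = source p alpha a eps y (u s y - u s (- y)).
        rewrite /S truncated_source_id//.
          rewrite (le_trans (ler_normB _ _))//.
          by have := uM s y hs; have := uM s (- y) hs; rewrite /Bd; lra.
        move=> yr; rewrite !uzero ?subrr ?normrN//; move: yr; rewrite /rho; lra.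
      by apply: du; apply/andP; split; lra.
    - move=> s y _ _; apply: (le_trans (lS _ _ _)).
      by rewrite (_ : w s y - w s (- y) - (u s y - u s (- y)) =
        w s y - u s y - (w s (- y) - u s (- y)))//; ring.
    - move=> y _; rewrite w0E.
      have h0 : 0 <= (0 : R) <= (t + Tm) / 2 by rewrite lexx; lra.
      have [h1 h2] := uE 0 _ h0 (normr_ge0 y); have [h3 h4] := wi0 _ (normr_ge0 y).
      have [y0|y0] := leP 0 y; first by rewrite -[y]ger0_norm// h1.
      have yE : y = - `|y| by rewrite ltr0_norm// opprK.
      by rewrite yE h2 h4.
  by rewrite !eqw; apply: uE => //; rewrite t0; lra.
have wM t x : 0 <= t < Tm -> `|w t x| <= M.
  move=> tT; have [h1 h2] := agree t _ tT (normr_ge0 x).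
  have [h3 h4] := vM t _ tT (normr_ge0 x).
  have [x0|x0] := leP 0 x; first by rewrite -[x]ger0_norm// h1.
  have xE : x = - `|x| by rewrite ltr0_norm// opprK.
  by rewrite xE h2 normrN.
(* The first term keeps [|x| < rho] in the zero region; the second makes [BF * (2 * tau) <= 1], so
   that [w] gains at most 1 beyond [Tm]. *)
pose tau := Num.min (rho / 2) (2 * (BF + 1))^-1.
have BF1 : 0 < 2 * (BF + 1) by lra.
have tau0 : 0 < tau by rewrite lt_min invr_gt0 BF1 divr_gt0.
have taur : tau <= rho / 2 by rewrite ge_min lexx.
have tauB : BF * (2 * tau) <= 1.
  have : tau <= (2 * (BF + 1))^-1 by rewrite ge_min lexx orbT.
  rewrite -[(_)^-1]mul1r ler_pdivlMr//; nra.
have wM1 t x : 0 <= t < Tm + tau -> `|w t x| <= M + 1.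
  move=> /andP[t0 tT]; have [tTm|Tmt] := ltP t Tm.
    have h : `|w t x| <= M by apply: wM; rewrite t0.
    lra.
  (* The bound [M] is known for times strictly before [Tm], so the comparison starts slightly
     earlier, at a positive time within [2 * tau] of [t]. *)
  pose sg := Num.min Tm tau / 2.
  have sg0 : 0 < sg by rewrite divr_gt0// lt_min Tm0.
  have [sg1 sg2] : sg <= Tm / 2 /\ sg <= tau / 2.
    by split; rewrite /sg ler_pM2r ?invr_gt0// ge_min lexx ?orbT.
  pose s := Tm - sg.
  have st : s <= t by rewrite /s; lra.
  have hd u : s < u < t -> is_derive u 1 (fun u => w u (x + t - u))
      (S (x + t - u) (w u (x + t - u) - w u (- (x + t - u)))).
    move=> /andP[u1 u2]; have u0 : 0 < u by move: u1; rewrite /s; lra.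
    by have := dw u (x + t - u) u0; rewrite subrK.
  have h := @abs_increment R _ _ s t BF st (path_continuous (xi := x + t) cw) hd
    (fun u _ => bS _ _).
  rewrite addrK in h.
  have hs : `|w s (x + t - s)| <= M by apply: wM; rewrite /s; lra.
  have : BF * (t - s) <= 1.
    by apply: le_trans tauB; apply: ler_wpM2l => //; rewrite /s; lra.
  have := ler_normD (w t x - w s (x + t - s)) (w s (x + t - s)).
  by rewrite subrK; lra.
have wz t x : 0 <= t < Tm + tau -> `|x| < rho -> w t x = 0.
  move=> /andP[t0 tT] xr; apply: wzero => //.
  by move: xr taur; rewrite /rho; lra.
have Sid t x : 0 <= t < Tm + tau -> S x (w t x - w t (- x)) =
    source p alpha a eps x (w t x - w t (- x)).
  move=> tT; rewrite /S truncated_source_id//.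
    rewrite (le_trans (ler_normB _ _))//.
    by have := wM1 t x tT; have := wM1 t (- x) tT; rewrite /Bd; lra.
  by move=> xr; rewrite !wz ?subrr ?normrN.
exists (Tm + tau), w, (fun t r => - w t (- r)); split; first by lra.
have cp : continuous (fun z : R * R => - w z.1 (- z.2)).
  move=> z; apply: cvgN.
  apply: (@continuous_comp _ _ _ (fun z : R * R => (z.1, - z.2))
    (fun z : R * R => w z.1 z.2)); last exact: cw.
  by apply: continuous_pair => {}z; [exact: cvg_fst|apply: cvgN; exact: cvg_snd].
split; first by rewrite lte_fin; lra.
split; first exact: continuous_subspaceT.
split; first exact: continuous_subspaceT.
split.
  move=> t r t0; rewrite lte_fin => tT rpos.
  have tT' : 0 <= t < Tm + tau by rewrite ltW.
  split; apply/is_derive_along.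
  - have := dw t r t0; rewrite (Sid _ _ tT') /source (gtr0_norm rpos).
    have -> : (fun s => w s (r + t - s)) = (fun s => w s (r + -1 * (s - t))).
      by apply/funext => s; congr w; ring.
    by [].
  - have := dw t (- r) t0; rewrite (Sid _ _ tT').
    have -> : (fun s => w s (- r + t - s)) = (fun s => w s (- (r + 1 * (s - t)))).
      by apply/funext => s; congr w; ring.
    move=> /is_deriveN; rewrite opprK -sourceN opprK opprB.
    by rewrite /source (gtr0_norm rpos).
split; first by move=> t _ _; rewrite oppr0 subrr.
split.
  move=> r rge0; rewrite !w0E; have [-> ->] := wi0 _ rge0.
  by rewrite opprK; exact: hini.
(* The sum vanishes for [r < rho] and is at most [2 (M + 1)] elsewhere, hence this slope. *)
move=> T q; rewrite lte_fin => TT; exists (2 * (M + 1) / rho).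
move=> t r /andP[t0 tT] /andP[rge0 _].
have tT' : 0 <= t < Tm + tau by rewrite t0 (le_lt_trans tT).
have [rr|rr] := ltP r rho.
  have h1 : w t r = 0 by apply: wz => //; rewrite ger0_norm.
  have h2 : w t (- r) = 0 by apply: wz => //; rewrite normrN ger0_norm.
  by rewrite h1 h2 subrr normr0 mulr_ge0// divr_ge0 ?(ltW rho0)//; lra.
apply: (@le_trans _ _ (2 * (M + 1))).
  apply: (le_trans (ler_normB _ _)).
  by have := wM1 t r tT'; have := wM1 t (- r) tT'; lra.
rewrite mulrAC ler_pdivlMr// ler_wpM2l//; lra.
Qed.

Lemma incoming_unbounded (R : realType) (p alpha a r0 z0 : R)
    (U0 U1 : R -> R -> R) (hr0 : 0 < r0) (hz0 : 0 < z0)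
    (halpha : (0 <= alpha /\ alpha < p - 2) \/ (alpha = 0 /\ p - 2 = 0))
    (hU0 : pulse_profile z0 U0) (hU1 : pulse_profile z0 U1) :
  a < 0 -> (exists z : R, P_minus U0 U1 r0 z <> 0) ->
  forall (Tmax : R -> \bar R) (vm vp : R -> R -> R -> R),
  (forall eps : R, 0 < eps <= 1 ->
      is_maximal_solution p alpha a r0 U0 U1 eps
        (Tmax eps) (vm eps) (vp eps)) ->
  ~ exists M : R, forall eps : R, 0 < eps <= 1 ->
         (Linf_norm_slab (Tmax eps) r0 (vm eps) <= M%:E)%E /\
         (Linf_norm_slab (Tmax eps) r0 (vp eps) <= M%:E)%E.
Proof.
move=> a0 [z hz] Tmax vm vp hsol [M hM].
have [p2 aE b0 b1] := exponent_beta halpha.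
have p1 : 1 < p by apply: lt_le_trans p2; rewrite ltr1n.
set beta := alpha / (p - 2) in aE b0 b1.
pose P := P_minus U0 U1 r0 z.
have zz0 : `|z| <= z0.
  rewrite leNgt; apply/negP => hzz; apply: hz.
  by apply: (P_minus_eq0 hU0 hU1 _ hzz); exact: ltW.
(* Half of [|P|] is given up to the error in [data_limit], so the datum at [xi = r0 + eps z] still
   has size at least [m] and the sign of [P]. *)
pose m := `|P| / 2.
have m0 : 0 < m by rewrite divr_gt0// normr_gt0; apply/eqP.
have m40 : 0 < m / 4 by rewrite divr_gt0.
have M0 : 0 <= M.
  have h1 : 0 < (1 : R) <= 1 by rewrite ltr01 lexx.
  have [h _] := hM 1 h1; rewrite -lee_fin; apply: le_trans h.
  exact: Lnorm_ge0.
pose k := `|a| * 2 `^ (- p) * (m / 4) `^ p.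
have k0 : 0 < k by rewrite !mulr_gt0 ?powR_gt0 ?normr_gt0 ?lt_eqF.
pose kp := Num.min 1 (r0 / 4).
have kp0 : 0 < kp by rewrite lt_min ltr01 divr_gt0.
have kp1 : kp <= 1 by rewrite ge_min lexx.
have kpr : kp <= r0 / 4 by rewrite ge_min lexx orbT.
have ex0 : 0 < expR (M / k) by exact: expR_gt0.
have ex1 : 1 <= expR (M / k) by rewrite -[leLHS]expR0 ler_expR divr_ge0// ltW.
clearbody kp.
have [lam l0 ll] : exists2 lam, 0 < lam & 2 * lam * expR (M / k) < kp.
  exists (kp / 4 / expR (M / k)); first by rewrite !divr_gt0.
  rewrite mulrA divfK ?gt_eqF//; lra.
have l2 : 2 * lam <= kp.
  by apply: le_trans (ltW ll); rewrite ler_peMr// mulr_ge0// ltW.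
have [e0 /andP[e00 e01] he] := @eventually_small R p alpha beta a r0 z0 M lam _
  p2 aE b0 b1 hr0 hz0 l0 m40.
have [e1 e10 he1] := data_limit (U1 := U1) hU0 hU1 z hr0 m0.
have [eps [ep0 epe0 epe1]] : exists eps : R, [/\ 0 < eps, eps < e0 & eps < e1].
  have e20 : 0 < Num.min e0 e1 by rewrite lt_min e00.
  have e2e : Num.min e0 e1 / 2 < Num.min e0 e1 by rewrite ltr_pdivrMr// ltr_pMr// ltr1n.
  exists (Num.min e0 e1 / 2); split; first by rewrite divr_gt0.
    by apply: lt_le_trans e2e _; rewrite ge_min lexx.
  by apply: lt_le_trans e2e _; rewrite ge_min lexx orbT.
have hep : 0 < eps < e0 by rewrite ep0.
have ep1 : 0 < eps <= 1 by rewrite ep0 (le_trans (ltW epe0)).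
have [h1 h2 h3 h4] := he eps hep.
have hdat : `|P_minus U0 U1 (r0 + eps * z) z + eps * P_one U0 (r0 + eps * z) z - P| <= m.
  by apply: he1; rewrite ep0.
clear he he1 hep epe0 epe1 e00 e10 e01 e0 e1.
have [sol hmax] := hsol eps ep1; have [hMm hMp] := hM eps ep1.
have /andP[E0 E1] := powR_le1 ep1 b0.
have dl0 : 0 < z0 * eps by rewrite mulr_gt0.
have [[lp c0 T10 T1r0] [ke kc lk r4]] := pulse_geometry hr0 dl0 h1 l0 E0 E1 kp1 kpr l2.
have hln := log_ratio_gt k0 kp0 l0 E0 ll.
have ze : `|eps * z| <= z0 * eps.
  by rewrite normrM (gtr0_norm ep0) mulrC ler_wpM2r// ltW.
clear ll l2 ex0 ex1 kpr kp1 kp0.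
have [Tm0 [cm [cp [_ [_ [hini _]]]]]] := sol.
have bnd t r : 0 <= t -> (t%:E < Tmax eps)%E -> t < r0 -> 0 <= r ->
    `|vm eps t r| <= M /\ `|vp eps t r| <= M.
  by move=> t0 tT tr rge0; split;
    [exact: (Linf_norm_slab_pointwise cm hMm)|exact: (Linf_norm_slab_pointwise cp hMp)].
set c := r0 - z0 * eps in c0 T10 T1r0 kc r4.
set l := lam * eps `^ beta in lp h2 h3 T10 T1r0 lk hln.
set T1 := c - l in T10 T1r0.
have inside T : 0 < T -> (T%:E < Tmax eps)%E ->
    exists2 w, unfolded_solution p alpha a eps T w & [/\
      forall t r, 0 <= t <= T -> 0 <= r -> w t r = vm eps t r /\ w t (- r) = - vp eps t r,
      forall x, `|x| <= c -> w 0 x = 0 &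
      forall t x, 0 <= t <= T -> t < r0 -> `|w t x| <= M].
  move=> T0 TT; have [w U wE] := exists_unfolded p1 T0 TT sol.
  have [cw _ _] := U.
  have wE0 s : 0 <= s -> w 0 s = vm eps 0 s /\ w 0 (- s) = - vp eps 0 s.
    by move=> s0; apply: wE => //; rewrite lexx ltW.
  have [w0in _] := unfolded_initial_zero hU0 hU1 hz0 ep0 c0 cw hini wE0.
  exists w => //; split=> // t x tT tr; have /andP[t0 tT'] := tT.
  have tm : (t%:E < Tmax eps)%E by rewrite (le_lt_trans _ TT)// lee_fin.
  have [h5 h6] := bnd t _ t0 tm tr (normr_ge0 x).
  have [h7 h8] := wE t _ tT (normr_ge0 x).
  have [x0|x0] := leP 0 x; first by rewrite -[x]ger0_norm// h7.
  have xE : x = - `|x| by rewrite ltr0_norm// opprK.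
  by rewrite xE h8 normrN.
have T1c : T1 < c by rewrite /T1 ltrBlDr ltrDl.
have T1pos : 0 < T1 by exact: lt_le_trans T10.
clear hsol hM hMm hMp cm cp.
(* If the lifespan ended by [T1 < c], the pulse would not have reached the axis, and [continuation]
   would contradict maximality. *)
have [Tlt|Tge] := ltP T1%:E (Tmax eps); last first.
  case: (Tmax eps) Tge Tm0 sol hmax inside bnd => [Tm| |] //=.
  rewrite lee_fin lte_fin => TmT1 Tm0 sol hmax inside bnd.
  have Tmc : Tm < c by exact: le_lt_trans T1c.
  have Tmr : Tm < r0 by exact: le_lt_trans T1r0.
  have v0 r : 0 <= r <= c -> vm eps 0 r = 0 /\ vp eps 0 r = 0.
    move=> /andP[rge0 rc].
    have Tm20 : 0 < Tm / 2 by rewrite divr_gt0.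
    have [|w _ [wE w0 _]] := inside (Tm / 2) Tm20.
      by rewrite lte_fin ltr_pdivrMr// ltr_pMr// ltr1n.
    have h0 : 0 <= (0 : R) <= Tm / 2 by rewrite lexx ltW.
    have [h5 h6] := wE 0 r h0 rge0.
    split; first by rewrite -h5 w0// ger0_norm.
    by apply: oppr_inj; rewrite -h6 w0 ?oppr0// normrN ger0_norm.
  have vM t r : 0 <= t < Tm -> 0 <= r -> `|vm eps t r| <= M /\ `|vp eps t r| <= M.
    by move=> /andP[t0 tT] rge0; apply: bnd => //; rewrite ?lte_fin// (lt_trans tT).
  have [Tm' [vm' [vp' [TT sol']]]] := continuation p1 sol Tmc v0 vM.
  by have := hmax _ _ _ sol'; rewrite lee_fin leNgt TT.
have [T T1T TTm] : exists2 T, T1 < T & (T%:E < Tmax eps)%E.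
  case: (Tmax eps) Tlt => [Tm| |] //=.
    by rewrite lte_fin => h; exists ((T1 + Tm) / 2); rewrite ?lte_fin midf_lt.
  by move=> _; exists (T1 + 1); [rewrite ltrDl|exact: ltry].
have T0 : 0 < T by exact: lt_trans T1T.
have [w U [wE w0in wMT]] := inside T T0 TTm.
have wM s x : 0 <= s <= T1 -> `|w s x| <= M.
  move=> /andP[s0 s1]; apply: wMT; last exact: le_lt_trans T1r0.
  by rewrite s0 (le_trans s1)// ltW.
have win := zero_inner p1 T1T U w0in.
pose xi := r0 + eps * z.
have xir : c <= xi <= c + 2 * (z0 * eps).
  clear -ze; move: ze; rewrite ler_norml /xi /c => /andP[z1 z2].
  by apply/andP; split; lra.
have xi0 : 0 <= xi by case/andP: xir => + _; apply: le_trans; exact: ltW.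
have wxi : `|w 0 xi - P| <= m.
  have h0 : 0 <= (0 : R) <= T by rewrite lexx ltW.
  have [-> _] := wE 0 xi h0 xi0; have [-> _] := hini xi xi0.
  have -> : (xi - r0) / eps = z.
    by rewrite /xi addrAC subrr add0r mulrAC divff ?mul1r// gt_eqF.
  exact: hdat.
have hcc : creation_bound p alpha a eps (c / 2) M * (z0 * eps) <= m / 4 by exact: h4.
have amp w' : unfolded_solution p alpha a eps T w' ->
    (forall s x, 0 <= s <= T1 -> `|w' s x| <= M) ->
    (forall s x, 0 <= s <= T1 -> `|x| + s <= c -> w' s x = 0) ->
    m <= w' 0 xi -> False.
  move=> U' wM' win' hw'.
  have h : m / 2 + k * ln (kp * eps `^ beta / (2 * l)) <= M.
    exact: (amplified p2 aE ep0 a0 U' T1T lp (erefl _) wM' win' ke kc lk h2 m0 h3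
      hcc xir hw').
  have : k * ln (kp * eps `^ beta / (2 * l)) <= M.
    by apply: le_trans h; rewrite lerDr divr_ge0// ltW.
  by rewrite leNgt hln.
have mE : m + m = `|P| by rewrite /m -splitr.
move: wxi; rewrite ler_norml => /andP[w1 w2].
have [P0|P0] := leP 0 P.
  apply: (amp w U wM win).
  by move: mE w1; rewrite ger0_norm//; clear; lra.
apply: (amp _ (unfolded_solutionN U)).
- by move=> s x hs; rewrite normrN wM.
- by move=> s x hs hx; rewrite win ?oppr0.
- by move: mE w2; rewrite ltr0_norm//; clear; lra.
Qed.

Unset Implicit Arguments.
Set Strict Implicit.

Theorem theorem1p2 (R : realType) (p alpha a r0 z0 : R) (U0 U1 : R -> R -> R)
  (hp : 1 < p) (hr0 : 0 < r0) (hz0 : 0 < z0)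
  (halpha : (0 <= alpha /\ alpha < p - 2) \/ (alpha = 0 /\ p - 2 = 0))
  (hU0 : pulse_profile z0 U0) (hU1 : pulse_profile z0 U1) :
  (0 < a ->
   forall vm vp : R -> R -> R -> R,
   (forall eps : R, 0 < eps <= 1 ->
      is_solution p alpha a r0 U0 U1 eps +oo%E (vm eps) (vp eps)) ->
   (forall T : R, r0 <= T ->
      limf_esup (fun eps : R =>
        (Linf_norm_at (vm eps) T + Linf_norm_at (vp eps) T)%E) 0^'+ = 0%E) /\
   (forall T : R -> R -> R,
      (forall lambda eps : R, 0 < lambda -> 0 < eps <= 1 ->
         T_absorb p alpha r0 z0 lambda eps <= T lambda eps) ->
      (fun lambda : R =>
         limf_esup (fun eps : R =>
           (Linf_norm_at (vm eps) (T lambda eps)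
            + Linf_norm_at (vp eps) (T lambda eps))%E) 0^'+)
        @ 0^'+ --> 0%E)) /\
  (a < 0 ->
   (exists z : R, P_minus U0 U1 r0 z <> 0) ->
   forall (Tmax : R -> \bar R) (vm vp : R -> R -> R -> R),
   (forall eps : R, 0 < eps <= 1 ->
      is_maximal_solution p alpha a r0 U0 U1 eps
        (Tmax eps) (vm eps) (vp eps)) ->
   exists Tstar : R, Tstar <= r0 /\
     ~ exists M : R, forall eps : R, 0 < eps <= 1 ->
         (Linf_norm_slab (Tmax eps) Tstar (vm eps) <= M%:E)%E /\
         (Linf_norm_slab (Tmax eps) Tstar (vp eps) <= M%:E)%E).
Proof.
split=> [a0 vm vp|a0 hP Tmax vm vp hsol]; first exact: dissipative_part.
(* The contradiction arises at the time [T1 < r0], so [r0] itself can be taken. *)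
exists r0; split=> //.
exact: (incoming_unbounded hr0 hz0 halpha hU0 hU1 a0 hP hsol).
Qed.
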